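(* Let $s>1$, $n\ge 1$, and for each $j=1,\dots,n$ let $a_j,b_j\in G^s(\mathbb{T}^1)$ be real-valued functions of the variable $t_j$. Consider on $\mathbb{T}^{n+1}$, with coordinates $(t,x)=(t_1,\dots,t_n,x)$, the system of vector fields $$L_j=\frac{\partial}{\partial t_j}+(a_j+ib_j)(t_j)\frac{\partial}{\partial x},\qquad j=1,\dots,n.$$ Put $a_{j0}=\frac1{2\pi}\int_0^{2\pi}a_j(\tau)\,d\tau$ and $J=\{j\in\{1,\dots,n\}: b_j\equiv 0\}$. Then the system $(L_1,\dots,L_n)$ is globally $s$-hypoelliptic if and only if at least one of the following conditions holds: (I) there is $j\in\{1,\dots,n\}$ such that the function $t_j\in\mathbb{T}^1\mapsto b_j(t_j)$ does not change sign and is not identically zero; (II) $J=\{j_1<\dots<j_\ell\}\neq\emptyset$, and the vector $a_{J0}=(a_{j_10},\dots,a_{j_\ell0})\in\mathbb{R}^\ell$ does not belong to $\mathbb{Q}^\ell$ and is not an exponential Liouville vector of order $s$.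
   Context: $\mathbb{T}^m=\mathbb{R}^m/2\pi\mathbb{Z}^m$ and $\mathbb{N}_0=\{0,1,2,\dots\}$. Gevrey spaces: for $s\ge1$, $h>0$, $G^{s,h}(\mathbb{T}^m)$ is the Banach space of smooth functions $f:\mathbb{T}^m\to\mathbb{C}$ with finite norm $\|f\|_{s,h}=\sup_{\alpha\in\mathbb{N}_0^m}\sup_{y\in\mathbb{T}^m}|\partial^\alpha f(y)|h^{-|\alpha|}(\alpha!)^{-s}$. The space $G^s(\mathbb{T}^m)$ is the inductive limit of $G^{s,h}(\mathbb{T}^m)$ as $h\to+\infty$; thus $f\in G^s(\mathbb{T}^m)$ iff there are $C,h>0$ with $|\partial^\alpha f(y)|\le Ch^{|\alpha|}(\alpha!)^s$ for all $\alpha,y$. Its dual (continuous linear functionals) is denoted $D'_s(\mathbb{T}^m)$ (ultradistributions); differentiation and multiplication by elements of $G^s$ are defined on $D'_s$ by duality, and $G^s(\mathbb{T}^m)\subset D'_s(\mathbb{T}^m)$ in the usual way. Global $s$-hypoellipticity: the system $(L_1,\dots,L_n)$ is globally $s$-hypoelliptic if the conditions $u\in D'_s(\mathbb{T}^{n+1})$ and $L_ju\in G^s(\mathbb{T}^{n+1})$ for all $j=1,\dots,n$ imply $u\in G^s(\mathbb{T}^{n+1})$. Exponential Liouville vectors: $\alpha\in\mathbb{R}^m\setminus\mathbb{Q}^m$ is an exponential Liouville vector of order $s\ge1$ if there exists $\epsilon>0$ such that the inequality $|q\alpha-p|<e^{-\epsilon|q|^{1/s}}$ has infinitely many solutions $(p,q)\in\mathbb{Z}^m\times\mathbb{Z}$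 (here $|\cdot|$ is a fixed norm on $\mathbb{R}^m$, e.g. the maximum norm; the notion does not depend on the choice). A real-valued function does not change sign if it is everywhere $\ge0$ or everywhere $\le0$. *)

(* Defs.v *)
From HB Require Import structures.
From mathcomp Require Import all_boot all_order all_algebra.
From mathcomp Require Import all_classical all_reals all_analysis.
From mathcomp Require Import complex.

Set Implicit Arguments.
Unset Strict Implicit.
Unset Printing Implicit Defensive.

Import Order.TTheory GRing.Theory Num.Theory.
Import numFieldNormedType.Exports.

Local Open Scope classical_set_scope.
Local Open Scope ring_scope.
Local Open Scope complex_scope.

(* Functions on the torus (R / 2 pi Z)^m are the functions on 'rV[R]_m that
   are 2 pi-periodic in each coordinate (see [periodic]). *)

Definition cmod (R : realType) (z : R[i]) : R := ComplexField.Normc.normc z.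

Definition basis_vec (R : realType) (m : nat) (k : 'I_m) : 'rV[R]_m :=
  delta_mx 0 k.

Definition periodic (R : realType) (m : nat) (f : 'rV[R]_m -> R[i]) : Prop :=
  forall (k : 'I_m) (y : 'rV[R]_m), f (y + (2 * pi) *: basis_vec R k) = f y.

(* R[i] carries no canonical normed module structure over R, hence the
   componentwise derivatives, limits and integrals below. *)
Definition partial (R : realType) (m : nat) (k : 'I_m)
    (f : 'rV[R]_m -> R[i]) : 'rV[R]_m -> R[i] :=
  fun y => ('D_(basis_vec R k) (fun z => complex.Re (f z)) y)
           +i* ('D_(basis_vec R k) (fun z => complex.Im (f z)) y).

Definition has_partial (R : realType) (m : nat) (k : 'I_m)
    (f : 'rV[R]_m -> R[i]) : Prop :=
  forall y : 'rV[R]_m,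
    derivable (fun z => complex.Re (f z)) y (basis_vec R k) /\
    derivable (fun z => complex.Im (f z)) y (basis_vec R k).

Definition ccontinuous (R : realType) (m : nat) (f : 'rV[R]_m -> R[i]) : Prop :=
  continuous (fun z : 'rV[R]_m => complex.Re (f z)) /\
  continuous (fun z : 'rV[R]_m => complex.Im (f z)).

(* C^infinity: every iterated partial derivative, in any order of the
   variables, is continuous and has all its partial derivatives. *)
Definition smooth (R : realType) (m : nat) (f : 'rV[R]_m -> R[i]) : Prop :=
  forall w : seq 'I_m,
    ccontinuous (foldr (@partial R m) f w) /\
    forall k : 'I_m, has_partial k (foldr (@partial R m) f w).

Definition mpartial (R : realType) (m : nat) (al : 'I_m -> nat)
    (f : 'rV[R]_m -> R[i]) : 'rV[R]_m -> R[i] :=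
  foldr (fun k g => iter (al k) (partial k) g) f (enum 'I_m).

Definition mlength (m : nat) (al : 'I_m -> nat) : nat := (\sum_(k < m) al k)%N.

Definition mfact (m : nat) (al : 'I_m -> nat) : nat :=
  (\prod_(k < m) (al k)`!)%N.

Definition gevrey_norm (R : realType) (m : nat) (s h : R)
    (f : 'rV[R]_m -> R[i]) : \bar R :=
  ereal_sup [set x : \bar R | exists (al : 'I_m -> nat) (y : 'rV[R]_m),
    x = (cmod (mpartial al f y) * h ^- mlength al
         * ((mfact al)%:R `^ s)^-1)%:E].

Definition gevrey_step (R : realType) (m : nat) (s h : R) :
    set ('rV[R]_m -> R[i]) :=
  [set f | [/\ periodic f, smooth f & (gevrey_norm s h f < +oo)%E]].

Definition gevrey (R : realType) (m : nat) (s : R) : set ('rV[R]_m -> R[i]) :=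
  [set f | exists2 h : R, 0 < h & gevrey_step s h f].

(* The locally convex inductive limit topology on [gevrey s]: a base of
   neighbourhoods of 0 is given by the absolutely convex sets whose trace on
   each Banach space G^{s,h} is a neighbourhood of 0 there. *)
Definition absolutely_convex (R : realType) (m : nat)
    (V : set ('rV[R]_m -> R[i])) : Prop :=
  forall (f g : 'rV[R]_m -> R[i]) (c d : R[i]),
    V f -> V g -> cmod c + cmod d <= 1 -> V (fun y => c * f y + d * g y).

Definition gevrey_nbhs0 (R : realType) (m : nat) (s : R)
    (U : set ('rV[R]_m -> R[i])) : Prop :=
  exists V : set ('rV[R]_m -> R[i]),
    [/\ V `<=` gevrey s, V `<=` U, absolutely_convex V &
     forall h : R, 0 < h -> exists2 del : R, 0 < del &
       forall f, gevrey_step s h f -> (gevrey_norm s h f < del%:E)%E -> V f].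

Definition gevrey_nbhs (R : realType) (m : nat) (s : R)
    (f : 'rV[R]_m -> R[i]) (U : set ('rV[R]_m -> R[i])) : Prop :=
  gevrey_nbhs0 s [set g | U (fun y => f y + g y)].

(* A functional is represented by a total function, of which only the values
   on [gevrey s] are meaningful. *)
Definition functional (R : realType) (m : nat) := ('rV[R]_m -> R[i]) -> R[i].

Definition ultradistribution (R : realType) (m : nat) (s : R)
    (u : functional R m) : Prop :=
  (forall (c : R[i]) (f g : 'rV[R]_m -> R[i]), gevrey s f -> gevrey s g ->
     u (fun y => c * f y + g y) = c * u f + u g) /\
  (forall f : 'rV[R]_m -> R[i], gevrey s f ->
     forall eps : R, 0 < eps ->
       gevrey_nbhs s f [set g | cmod (u g - u f) < eps]).

Definition dpartial (R : realType) (m : nat) (k : 'I_m) (u : functional R m) :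
    functional R m :=
  fun phi => - u (partial k phi).

Definition dmul (R : realType) (m : nat) (c : 'rV[R]_m -> R[i])
    (u : functional R m) : functional R m :=
  fun phi => u (fun y => c y * phi y).

Definition dadd (R : realType) (m : nat) (u v : functional R m) :
    functional R m :=
  fun phi => u phi + v phi.

Definition cintegral (R : realType) (f : R -> R[i]) : R[i] :=
  (\int[lebesgue_measure]_(x in `[0, 2 * pi]) complex.Re (f x))%R
  +i* (\int[lebesgue_measure]_(x in `[0, 2 * pi]) complex.Im (f x))%R.

Definition set_coord (R : realType) (m : nat) (y : 'rV[R]_m) (k : 'I_m)
    (x : R) : 'rV[R]_m :=
  \row_i (if i == k then x else y 0 i).

(* Integral over [0, 2 pi]^m, as an iterated integral; it is only applied to
   continuous functions. *)
Definition torus_integral (R : realType) (m : nat) (f : 'rV[R]_m -> R[i]) :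
    R[i] :=
  foldr (fun k g y => cintegral (fun x => g (set_coord y k x))) f (enum 'I_m) 0.

(* [u] belongs to G^s, through the embedding of G^s in D'_s. *)
Definition in_gevrey (R : realType) (m : nat) (s : R) (u : functional R m) :
    Prop :=
  exists2 g : 'rV[R]_m -> R[i], gevrey s g &
    forall phi, gevrey s phi -> u phi = torus_integral (fun y => g y * phi y).

Definition globally_hypoelliptic (R : realType) (m n : nat) (s : R)
    (L : 'I_n -> functional R m -> functional R m) : Prop :=
  forall u : functional R m, ultradistribution s u ->
    (forall j : 'I_n, in_gevrey s (L j u)) -> in_gevrey s u.

Definition gevrey_circle (R : realType) (s : R) (f : R -> R) : Prop :=
  gevrey s (fun y : 'rV[R]_1 => (f (y 0 0))%:C).

(* The torus T^{n+1} has coordinates (t_1, ..., t_n, x). *)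
Definition t_idx (n : nat) (j : 'I_n) : 'I_n.+1 := lift ord_max j.
Definition x_idx (n : nat) : 'I_n.+1 := ord_max.

Definition vfield (R : realType) (n : nat) (a b : 'I_n -> R -> R) (j : 'I_n)
    (u : functional R n.+1) : functional R n.+1 :=
  dadd (dpartial (t_idx j) u)
       (dmul (fun y => a j (y 0 (t_idx j)) +i* b j (y 0 (t_idx j)))
             (dpartial (x_idx n) u)).

Definition mean (R : realType) (f : R -> R) : R :=
  (2 * pi)^-1 * (\int[lebesgue_measure]_(x in `[0, 2 * pi]) f x)%R.

Definition rational_vector (R : realType) (m : nat) (v : 'rV[R]_m) : Prop :=
  exists r : 'rV[rat]_m, v = map_mx ratr r.

(* The norm of 'rV[R]_m is the maximum norm. *)
Definition exp_liouville (R : realType) (m : nat) (s : R) (v : 'rV[R]_m) :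
    Prop :=
  ~ rational_vector v /\
  exists2 eps : R, 0 < eps &
    infinite_set [set pq : 'rV[int]_m * int |
      `|pq.2%:~R *: v - map_mx intr pq.1|
        < expR (- eps * (`|pq.2%:~R : R| `^ s^-1))].

Definition real_indices (R : realType) (n : nat) (b : 'I_n -> R -> R) :
    {set 'I_n} :=
  [set j | `[< forall x : R, b j x = 0 >]].

(* [enum_val] lists the elements of J in increasing order. *)
Definition mean_vector (R : realType) (n : nat) (a : 'I_n -> R -> R)
    (J : {set 'I_n}) : 'rV[R]_#|J| :=
  \row_(i < #|J|) mean (a (enum_val i)).

Definition keeps_sign (R : realType) (f : R -> R) : Prop :=
  (forall x, 0 <= f x) \/ (forall x, f x <= 0).

(* Main.v *)
(* Gevrey functions are the functions whose Fourier coefficients are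
   O(exp (- d |k|^(1/s))) for some d > 0, and ultradistributions correspond to
   the sequences that are O(exp (d |k|^(1/s))) for every d > 0.  Hypoellipticity
   thus becomes a statement about sequences v(tau, xi) with
   i tau_j v + i xi (c_j^ * v) decaying, where c_j = a_j + i b_j.

   Sufficiency.  On a line in the direction tau_j, dividing by tau_j absorbs the
   convolution for |tau_j| >> |xi|, so that v decays in tau_j at a cost
   exp (d K |xi|^(1/s)) with d as small as desired.  Integrating the resulting
   periodic equation v' + i xi c_j v = g over one period, on the side where the
   exponential weight does not grow, bounds v by g divided by
   |exp (2 pi i xi c_j0) - 1|.  The divisor is bounded below when b_j keeps its
   sign and is not zero, and it is at least exp (- e |xi|^(1/s)) for some index in
   J when a_J0 is neither rational nor exponential Liouville.

   Necessity.  Otherwise, there are infinitely many xi > 0 for which every xi a_j0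
   with j in J is exp (- e xi^(1/s))-close to an integer.  For these xi each L_j
   has a quasimode v_j(t_j, xi) with |v_j| <= 1, |v_j| = 1 at some point, and
   L_j v_j of size exp (- e xi^(1/s)).  For j in J it is an exact solution for a
   nearby constant mean; when b_j changes sign it is a WKB solution that peaks at
   a local maximum of the primitive of b_j, the mean of c_j being cancelled by
   Gevrey bumps placed where the solution is exponentially small.  The product of
   the v_j over j defines an ultradistribution that is not Gevrey, whereas its
   image under each L_j is Gevrey. *)

From mathcomp Require Import all_boot all_order all_algebra.
From mathcomp Require Import all_classical all_reals all_analysis.
From mathcomp Require Import complex ring lra zify.
Require Import Defs.
Set Implicit Arguments.
Unset Strict Implicit.
Unset Printing Implicit Defensive.
Import Order.TTheory GRing.Theory Num.Theory.
Import numFieldNormedType.Exports.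
Local Open Scope classical_set_scope.
Local Open Scope ring_scope.
Local Open Scope complex_scope.

(** * Complex-valued functions of a real variable *)

(** The cost of decay in [tau_j] has an exponent proportional to the rate that is gained. Quasimodes
    are required to have this proportionality: lowering the rate makes the loss negligible against
    the fixed [e] in the size of [L_j v_j], and also against the unknown rate at which a Gevrey
    product would have to decay. The size of [L_j v_j] is known uniformly only, its decay in [tau_j]
    only with a loss; the geometric mean of the two bounds decays in both variables. An index whose
    [b_j] changes sign puts no condition on [xi], because the real part of the mean of [c_j] is
    removed together with the imaginary part; the indices of [J] alone select the frequencies. If
    [J] is empty, the vector [a_J0] has no entry, hence is rational, and every [xi] is admissible.
    Gevrey bumps exist because [s > 1]: they are infinite convolutions of two-point averages, about
    [2^(i/s)] of width proportional to [2^-i] for each [i], and the total width is a convergent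
    geometric series. All series are compared with their partial sums at one common rate, the tail
    of the lattice sum of the weights. *)

Section ComplexModulus.
Variable R : realType.
Implicit Types z w : R[i].

Lemma cmodE z : cmod z = Num.sqrt (complex.Re z ^+ 2 + complex.Im z ^+ 2).
Proof. by case: z. Qed.

Lemma cmod_ge0 z : 0 <= cmod z.
Proof. by rewrite cmodE sqrtr_ge0. Qed.

Lemma cmodD z w : cmod (z + w) <= cmod z + cmod w.
Proof. exact: (@le_normcD R). Qed.

Lemma cmodM z w : cmod (z * w) = cmod z * cmod w.
Proof. exact: ComplexField.Normc.normcM. Qed.

Lemma cmodN z : cmod (- z) = cmod z.
Proof. by case: z => a b; rewrite !cmodE /= !sqrrN. Qed.

Lemma cmodB z w : cmod (z - w) <= cmod z + cmod w.
Proof. by rewrite -(cmodN w); exact: cmodD. Qed.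

Lemma cmod_distC z w : cmod (z - w) = cmod (w - z).
Proof. by rewrite -cmodN opprB. Qed.

Lemma cmod_triangle (x z w : R[i]) : cmod (z - w) <= cmod (z - x) + cmod (x - w).
Proof. by apply: le_trans (cmodD _ _); rewrite addrA subrK. Qed.

Lemma cmod0 : cmod (0 : R[i]) = 0.
Proof. exact: ComplexField.Normc.normc0. Qed.

Lemma cmod1 : cmod (1 : R[i]) = 1.
Proof. exact: ComplexField.Normc.normc1. Qed.

Lemma cmodR (x : R) : cmod (x%:C) = `|x|.
Proof. by rewrite cmodE /= expr0n addr0 sqrtr_sqr. Qed.

Lemma cmodi : cmod ('i : R[i]) = 1.
Proof. by rewrite cmodE /= expr0n expr1n add0r sqrtr1. Qed.

Lemma cmod_eq0 z : cmod z = 0 -> z = 0.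
Proof. exact: ComplexField.Normc.eq0_normc. Qed.

Lemma cmodX z n : cmod (z ^+ n) = cmod z ^+ n.
Proof. by elim: n => [|n IH]; rewrite ?expr0 ?cmod1// !exprS cmodM IH. Qed.

Lemma Re_le_cmod z : `|complex.Re z| <= cmod z.
Proof. by rewrite cmodE -sqrtr_sqr ler_wsqrtr// lerDl sqr_ge0. Qed.

Lemma Im_le_cmod z : `|complex.Im z| <= cmod z.
Proof. by rewrite cmodE -sqrtr_sqr ler_wsqrtr// lerDr sqr_ge0. Qed.

Lemma complexP z w :
  complex.Re z = complex.Re w -> complex.Im z = complex.Im w -> z = w.
Proof. by case: z; case: w => a b c d /= -> ->. Qed.

Lemma cmod_le_ReIm z : cmod z <= `|complex.Re z| + `|complex.Im z|.
Proof.
rewrite {1}(_ : z = (complex.Re z)%:C + (complex.Im z)%:C * 'i); last first.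
  by apply: complexP; case: z => a b /=; ring.
by apply: le_trans (cmodD _ _) _; rewrite cmodM cmodi mulr1 !cmodR.
Qed.

Lemma cmod_prod (I : Type) (r : seq I) (P : pred I) (F : I -> R[i]) :
  cmod (\prod_(i <- r | P i) F i) = \prod_(i <- r | P i) cmod (F i).
Proof. by elim/big_rec2 : _ => [|i x y _ <-]; rewrite ?cmod1 ?cmodM. Qed.

(** Identities between limits are proved in this form: both sides agree up to [t * B] for every
    small [t], where [t] is the step of a difference quotient or a bound for the tail of a
    series. *)
Lemma cmod_eps z (B : R) : 0 <= B ->
  (forall t : R, 0 < t -> t <= 1 -> cmod z <= t * B) -> z = 0.
Proof.
move=> B0 h; apply: cmod_eq0; apply/eqP; rewrite eq_le cmod_ge0 andbT.
apply/ler_addgt0Pr => e e0; rewrite add0r.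
have t0 : 0 < Num.min 1 (e / (B + 1)).
  by rewrite lt_min ltr01 divr_gt0// ltr_wpDl.
apply: le_trans (h _ t0 _) _; first by rewrite ge_min lexx.
apply: (@le_trans _ _ (e / (B + 1) * B)).
  by rewrite ler_wpM2r// ge_min lexx orbT.
rewrite -mulrA ler_piMr ?(ltW e0)// mulrC ler_pdivrMr ?mul1r ?lerDl//.
by rewrite ltr_wpDl.
Qed.

Lemma cReD z w : complex.Re (z + w) = complex.Re z + complex.Re w.
Proof. by case: z; case: w. Qed.
Lemma cImD z w : complex.Im (z + w) = complex.Im z + complex.Im w.
Proof. by case: z; case: w. Qed.
Lemma cReN z : complex.Re (- z) = - complex.Re z.
Proof. by case: z. Qed.
Lemma cImN z : complex.Im (- z) = - complex.Im z.
Proof. by case: z. Qed.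
Lemma cReM z w : complex.Re (z * w) =
  complex.Re z * complex.Re w - complex.Im z * complex.Im w.
Proof. by case: z; case: w. Qed.
Lemma cImM z w : complex.Im (z * w) =
  complex.Re z * complex.Im w + complex.Im z * complex.Re w.
Proof. by case: z => a b; case: w => c d /=; rewrite mulrC addrC; ring. Qed.
Lemma cReR (x : R) : complex.Re x%:C = x. Proof. by []. Qed.
Lemma cImR (x : R) : complex.Im x%:C = 0. Proof. by []. Qed.

Lemma cRei : complex.Re ('i : R[i]) = 0. Proof. by []. Qed.
Lemma cImi : complex.Im ('i : R[i]) = 1. Proof. by []. Qed.
Lemma cRe1 : complex.Re (1 : R[i]) = 1. Proof. by []. Qed.
Lemma cIm1 : complex.Im (1 : R[i]) = 0. Proof. by []. Qed.
Lemma cRe0 : complex.Re (0 : R[i]) = 0. Proof. by []. Qed.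
Lemma cIm0 : complex.Im (0 : R[i]) = 0. Proof. by []. Qed.

Definition ReIm := (cRei, cImi, cRe1, cIm1, cRe0, cIm0, cReD, cImD, cReN, cImN, cReM, cImM, cReR, cImR).

End ComplexModulus.

Section ComplexExp.
Variable R : realType.
Implicit Types z w : R[i].

Lemma mvt_le (f df : R -> R) (M a b : R) : a <= b ->
  (forall x, a <= x <= b -> is_derive x 1 f (df x)) ->
  (forall x, a <= x <= b -> `|df x| <= M) -> `|f b - f a| <= M * (b - a).
Proof.
move=> ab fd dfM.
have [|c|c /[!in_itv]/= ac ->] := @MVT_segment R f df a b ab.
- by move=> x /[!in_itv]/= /andP[ax xb]; apply: fd; rewrite (ltW ax) (ltW xb).
- apply: continuous_in_subspaceT => y /[!inE]/= /[!in_itv]/= hy.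
  by have [/derivable1_diffP/differentiable_continuous] := fd _ hy.
- by rewrite normrM (ger0_norm (x := b - a)) ?subr_ge0// ler_wpM2r ?subr_ge0 ?dfM.
Qed.

Definition cis (x : R) : R[i] := cos x +i* sin x.

Lemma Re_cis x : complex.Re (cis x) = cos x. Proof. by []. Qed.
Lemma Im_cis x : complex.Im (cis x) = sin x. Proof. by []. Qed.

Lemma cis0 : cis 0 = 1.
Proof. by rewrite /cis cos0 sin0. Qed.

Lemma cisD x y : cis (x + y) = cis x * cis y.
Proof. by apply: complexP; rewrite !ReIm /= (cosD, sinD)//; ring. Qed.

Lemma cmod_cis x : cmod (cis x) = 1.
Proof. by rewrite cmodE /= cos2Dsin2 sqrtr1. Qed.

Lemma cisN x : cis x * cis (- x) = 1.
Proof. by rewrite -cisD subrr cis0. Qed.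

Lemma cis2piz (k : int) : cis (k%:~R * (2 * pi)) = 1.
Proof.
have cisnat n : cis (n%:R * (2 * pi)) = 1.
  elim: n => [|n IH]; first by rewrite mul0r cis0.
  rewrite -natr1 mulrDl mul1r cisD IH mul1r /cis.
  by rewrite mulr_natl cos2pi sin2pi.
case: k => n; first exact: cisnat.
by rewrite NegzE mulrNz mulNr -[LHS]mul1r -{1}(cisnat n.+1) cisN.
Qed.

Lemma cos_lip x y : `|cos x - cos y| <= `|x - y| :> R.
Proof.
wlog xy : x y / y <= x.
  move=> h; case/orP: (le_total y x); first exact: h.
  by move=> /h; rewrite distrC (distrC x y).
rewrite (ger0_norm (x := x - y)) ?subr_ge0// -[leRHS]mul1r.
apply: (@mvt_le cos (fun x => - sin x)) => // t _.
by rewrite normrN ler_norml sin_geN1 sin_le1.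
Qed.

Lemma sin_lip x y : `|sin x - sin y| <= `|x - y| :> R.
Proof.
wlog xy : x y / y <= x.
  move=> h; case/orP: (le_total y x); first exact: h.
  by move=> /h; rewrite distrC (distrC x y).
rewrite (ger0_norm (x := x - y)) ?subr_ge0// -[leRHS]mul1r.
apply: (@mvt_le sin cos) => // t _.
by rewrite ler_norml cos_geN1 cos_le1.
Qed.

Lemma cis_lip x y : cmod (cis x - cis y) <= 2 * `|x - y|.
Proof.
apply: le_trans (cmod_le_ReIm _) _; rewrite !ReIm /= mulr_natl mulr2n.
by apply: lerD; [exact: cos_lip|exact: sin_lip].
Qed.

(** The derivatives of [cos x] and of [sin x - x] are already of size [|x|], so the mean value
    inequality gains one more power. A remainder quadratic in the frequency is what termwise
    differentiation of Fourier series needs. *)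
Lemma cis_taylor x : cmod (cis x - 1 - x%:C * 'i) <= 2 * x ^+ 2.
Proof.
apply: le_trans (cmod_le_ReIm _) _; rewrite !ReIm /= !(mulr0, mul0r, subr0, addr0, mulr1).
have c1 y : `|cos y - 1| <= `|y| :> R.
  by have := cos_lip y 0; rewrite cos0 subr0.
have s1 y : `|sin y| <= `|y| :> R.
  by have := sin_lip y 0; rewrite sin0 !subr0.
have hc : `|cos x - 1| <= x ^+ 2.
  wlog x0 : x / 0 <= x.
    move=> h; case/orP: (le_total 0 x); first exact: h.
    by rewrite -oppr_ge0 => /h; rewrite cosN sqrrN.
  rewrite -cos0 -[X in cos X - _](subr0 x) subr0.
  have := @mvt_le cos (fun x => - sin x) x 0 x x0.
  rewrite subr0 -expr2; apply=> t /andP[t0 tx]; rewrite normrN.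
  by apply: le_trans (s1 _) _; rewrite ger0_norm.
have hs : `|sin x - x| <= x ^+ 2.
  wlog x0 : x {hc} / 0 <= x.
    move=> h; case/orP: (le_total 0 x); first exact: h.
    rewrite -oppr_ge0 => /h; rewrite sinN sqrrN -normrN.
    by congr (`|_| <= _); ring.
  have := @mvt_le (fun x => sin x - x) (fun x => cos x - 1) x 0 x x0.
  rewrite sin0 !subr0 -expr2; apply=> t /andP[t0 tx].
  by apply: le_trans (c1 _) _; rewrite ger0_norm.
by rewrite mulr_natl mulr2n; exact: lerD.
Qed.

Definition cexp z : R[i] := (expR (complex.Re z))%:C * cis (complex.Im z).

Lemma cmod_cexp z : cmod (cexp z) = expR (complex.Re z).
Proof. by rewrite cmodM cmod_cis mulr1 cmodR gtr0_norm ?expR_gt0. Qed.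

Lemma cexpD z w : cexp (z + w) = cexp z * cexp w.
Proof. by rewrite /cexp !ReIm expRD cisD rmorphM /=; ring. Qed.

Lemma cexp0 : cexp 0 = 1.
Proof. by rewrite /cexp /= expR0 cis0 mulr1. Qed.

Definition cder (f : R -> R[i]) (t : R) (d : R[i]) :=
  is_derive t 1 (fun x => complex.Re (f x)) (complex.Re d) /\
  is_derive t 1 (fun x => complex.Im (f x)) (complex.Im d).

Lemma cderM f g t df dg : cder f t df -> cder g t dg ->
  cder (fun x => f x * g x) t (df * g t + f t * dg).
Proof.
move=> [f1 f2] [g1 g2]; split.
  have -> : (fun x => complex.Re (f x * g x)) =
    (fun x => complex.Re (f x)) * (fun x => complex.Re (g x))
    - (fun x => complex.Im (f x)) * (fun x => complex.Im (g x)).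
    by apply/funext => x; rewrite cReM.
  by apply: is_derive_eq; rewrite !ReIm /GRing.scale/=; ring.
have -> : (fun x => complex.Im (f x * g x)) =
    (fun x => complex.Re (f x)) * (fun x => complex.Im (g x))
    + (fun x => complex.Im (f x)) * (fun x => complex.Re (g x)).
  by apply/funext => x; rewrite cImM.
by apply: is_derive_eq; rewrite !ReIm /GRing.scale/=; ring.
Qed.

Lemma cderD f g t df dg : cder f t df -> cder g t dg ->
  cder (fun x => f x + g x) t (df + dg).
Proof.
move=> [f1 f2] [g1 g2]; split.
  have -> : (fun x => complex.Re (f x + g x)) =
    (fun x => complex.Re (f x)) + (fun x => complex.Re (g x)).
    by apply/funext => x; rewrite cReD.
  by rewrite cReD; exact: is_deriveD.
have -> : (fun x => complex.Im (f x + g x)) =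
    (fun x => complex.Im (f x)) + (fun x => complex.Im (g x)).
  by apply/funext => x; rewrite cImD.
by rewrite cImD; exact: is_deriveD.
Qed.

Lemma cder_cst c t : cder (fun=> c) t 0.
Proof. by split; exact: is_derive_cst. Qed.

Lemma cderZ c f t df : cder f t df -> cder (fun x => c * f x) t (c * df).
Proof.
by move=> h; have := cderM (cder_cst c t) h; rewrite mul0r add0r.
Qed.

Lemma cder_id t : cder (fun x => x%:C) t 1.
Proof. by split => /=; [exact: is_derive_id | exact: is_derive_cst]. Qed.

Lemma cder_cexp f t df : cder f t df ->
  cder (fun x => cexp (f x)) t (df * cexp (f t)).
Proof.
move=> [f1 f2].
have h : cder (fun x => cis (complex.Im (f x))) t
    ((complex.Im df)%:C * 'i * cis (complex.Im (f t))).
  have E1 (a b : R) : - sin a * b = complex.Re (b%:C * 'i * cis a).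
    by rewrite !(Re_cis, Im_cis, ReIm); ring.
  have E2 (a b : R) : cos a * b = complex.Im (b%:C * 'i * cis a).
    by rewrite !(Re_cis, Im_cis, ReIm); ring.
  split.
    exact: (is_derive_eq (is_derive1_comp (is_derive_cos _) f2) (E1 _ _)).
  exact: (is_derive_eq (is_derive1_comp (is_derive_sin _) f2) (E2 _ _)).
have h' : cder (fun x => (expR (complex.Re (f x)))%:C) t
    ((complex.Re df)%:C * (expR (complex.Re (f t)))%:C).
  split; rewrite /=; last by rewrite !mul0r mulr0 addr0; exact: is_derive_cst.
  have E (a b : R) : a * b = b * a - 0 * 0 by ring.
  exact: (is_derive_eq (is_derive1_comp (is_derive_expR _) f1) (E _ _)).
have := cderM h' h; congr cder; rewrite /cexp.
by apply: complexP; rewrite !ReIm /=; ring.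
Qed.

Lemma cder_lip f df (M a b : R) : a <= b ->
  (forall x, a <= x <= b -> cder f x (df x)) ->
  (forall x, a <= x <= b -> cmod (df x) <= M) ->
  cmod (f b - f a) <= 2 * M * (b - a).
Proof.
move=> ab fd dM; apply: le_trans (cmod_le_ReIm _) _; rewrite !ReIm.
rewrite -mulrA mulr_natl mulr2n; apply: lerD.
  apply: (@mvt_le (fun x => complex.Re (f x)) (fun x => complex.Re (df x))) => //.
    by move=> x /fd[].
  by move=> x xab; apply: le_trans (Re_le_cmod _) (dM _ xab).
apply: (@mvt_le (fun x => complex.Im (f x)) (fun x => complex.Im (df x))) => //.
  by move=> x /fd[].
by move=> x xab; apply: le_trans (Im_le_cmod _) (dM _ xab).
Qed.

Lemma cder_periodic f t d a : cder f (t + a) d -> cder (fun x => f (x + a)) t d.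
Proof.
have h : is_derive t 1 (fun x : R => x + a) 1.
  have -> : (+%R^~ a) = id + cst a by apply/funext.
  by apply: is_derive_eq; rewrite addr0.
move=> [f1 f2]; split.
  by have := @is_derive1_comp _ _ (+%R^~ a) t _ _ f1 h; rewrite mulr1.
by have := @is_derive1_comp _ _ (+%R^~ a) t _ _ f2 h; rewrite mulr1.
Qed.

End ComplexExp.

(** * Integration on the torus *)

Section PeriodIntegral.
Variable R : realType.

Definition RI (f : R -> R) : R :=
  (\int[lebesgue_measure]_(x in `[0, 2 * pi]) f x)%R.

Lemma cintegralE (f : R -> R[i]) : cintegral f =
  RI (fun x => complex.Re (f x)) +i* RI (fun x => complex.Im (f x)).
Proof. by []. Qed.

Lemma Re_CI (f : R -> R[i]) :
  complex.Re (cintegral f) = RI (fun x => complex.Re (f x)).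
Proof. by []. Qed.

Lemma Im_CI (f : R -> R[i]) :
  complex.Im (cintegral f) = RI (fun x => complex.Im (f x)).
Proof. by []. Qed.

Lemma pi2_gt0 : 0 < 2 * pi :> R.
Proof. by rewrite mulr_gt0 ?pi_gt0. Qed.

Definition lip (f : R -> R) (M : R) := forall x y, `|f x - f y| <= M * `|x - y|.

Lemma lip_continuous f M : lip f M -> continuous f.
Proof.
move=> fM x; apply/cvgrPdist_le => e e0.
have M1 : 0 < `|M| + 1 by rewrite ltr_wpDl.
near=> y.
apply: le_trans (fM _ _) _.
have : `|x - y| <= e / (`|M| + 1).
  by near: y; apply: cvgr_dist_le; [exact: cvg_id|rewrite divr_gt0].
rewrite ler_pdivlMr// => h; apply: le_trans h; rewrite mulrC ler_wpM2l//.
by rewrite (le_trans (ler_norm _))// lerDl.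
Unshelve. all: by end_near. Qed.

Lemma continuous_RI_integrable (f : R -> R) a b : continuous f ->
  lebesgue_measure.-integrable `[a, b] (EFin \o f).
Proof.
move=> cf; apply: continuous_compact_integrable; first exact: segment_compact.
exact: continuous_subspaceT.
Qed.

Lemma RID (f g : R -> R) : continuous f -> continuous g ->
  RI (fun x => f x + g x) = RI f + RI g.
Proof. by move=> cf cg; rewrite /RI RintegralD//; exact: continuous_RI_integrable. Qed.

Lemma RIZ c (f : R -> R) : continuous f -> RI (fun x => c * f x) = c * RI f.
Proof. by move=> cf; rewrite /RI RintegralZl//; exact: continuous_RI_integrable. Qed.

Lemma RI_cst c : RI (fun=> c) = 2 * pi * c.
Proof.
rewrite /RI Rintegral_cst//= lebesgue_measure_itv/= lte_fin pi2_gt0.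
by rewrite -EFinD/= subr0 mulrC.
Qed.

Lemma RI_le (f g : R -> R) : continuous f -> continuous g ->
  (forall x, 0 <= x <= 2 * pi -> f x <= g x) -> RI f <= RI g.
Proof.
move=> cf cg fg; apply: le_Rintegral => //; try exact: continuous_RI_integrable.
Qed.

Lemma RI_norm (f : R -> R) M : continuous f ->
  (forall x, 0 <= x <= 2 * pi -> `|f x| <= M) -> `|RI f| <= 2 * pi * M.
Proof.
move=> cf fM; rewrite ler_norml -mulrN -!RI_cst; apply/andP; split.
  apply: RI_le => // [|x /fM]; first exact: cst_continuous.
  by rewrite ler_norml => /andP[].
apply: RI_le => // [|x /fM]; first exact: cst_continuous.
by rewrite ler_norml => /andP[].
Qed.

Lemma eq_RI (f g : R -> R) : (forall x, f x = g x) -> RI f = RI g.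
Proof. by move=> /funext ->. Qed.

Lemma RI_FTC (f F : R -> R) : continuous f -> (forall x, 0 <= x <= 2 * pi -> is_derive x 1 F (f x)) ->
  RI f = F (2 * pi) - F 0.
Proof.
move=> cf Ff.
have h := @continuous_FTC2 R f F 0 (2 * pi) pi2_gt0.
rewrite /RI /Rintegral h//.
- exact: continuous_subspaceT.
- have Fc x : 0 <= x <= 2 * pi -> F @ x --> F x.
    by move=> /Ff [/derivable1_diffP/differentiable_continuous].
  split.
  + move=> x /[!in_itv]/= /andP[/ltW ? /ltW ?]; have h0 : 0 <= x <= 2 * pi by exact/andP.
    by have [] := Ff x h0.
  + by apply: cvg_at_right_filter; apply: Fc; rewrite lexx ltW ?pi2_gt0.
  + by apply: cvg_at_left_filter; apply: Fc; rewrite lexx ltW ?pi2_gt0.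
- move=> x /[!in_itv]/= /andP[/ltW ? /ltW ?]; rewrite derive1E.
  have h0 : 0 <= x <= 2 * pi by exact/andP.
  by have [_ ->] := Ff x h0.
Qed.

(** The integral from [c] is a primitive only to the right of [c]; each use takes [c] to the left of
    all the points in play. *)
Lemma local_primitive (f : R -> R) (c : R) : continuous f ->
  exists F : R -> R, forall x, c < x -> is_derive x 1 F (f x).
Proof.
move=> cf; exists (fun x => \int[lebesgue_measure]_(t in `[c, x]) f t) => x cx.
have [] := @continuous_FTC1 R f (BLeft c) x (x + 1) _ _ _ _.
- by rewrite ltrDl.
- exact: continuous_RI_integrable.
- have : (BLeft c < BRight x)%O by rewrite bnd_simp ltW.
  exact.
- exact: cf.
by rewrite derive1E => d <-; exact: DeriveDef.
Qed.

(** If [F] is a primitive of [f], then [F (t + 2 * pi) - F t] has derivative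
    [f (t + 2 * pi) - f t = 0], hence takes the same value at [s] and at 0. *)
Lemma RI_translate (f : R -> R) (s : R) : continuous f -> (forall x, f (x + 2 * pi) = f x) ->
  RI (fun x => f (x + s)) = RI f.
Proof.
move=> cf fp.
have [F dF] := @local_primitive f (- `|s| - 1) cf.
have sh : forall (a y : R), is_derive y 1 (fun x : R => x + a) 1.
  move=> a y; have -> : (+%R^~ a) = id + cst a by apply/funext.
  by apply: is_derive_eq; rewrite addr0.
have dFs (y a : R) : - `|s| - 1 < y + a -> is_derive y 1 (fun x => F (x + a)) (f (y + a)).
  move=> /dF d; have := @is_derive1_comp R F (+%R^~ a) y _ _ d (sh a y).
  by rewrite mulr1.
have ns : - `|s| <= s by rewrite lerNl -normrN ler_norm.
have G t : - `|s| - 1 < t -> RI (fun x => f (x + t)) = F (2 * pi + t) - F t.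
  move=> st; have := @RI_FTC (fun x => f (x + t)) (fun x => F (x + t)).
  rewrite add0r; apply.
    move=> x; apply: (@continuous_comp _ _ _ (fun x => x + t) f); last exact: cf.
    by apply: cvgD; [exact: cvg_id|exact: cvg_cst].
  move=> x /andP[x0 _]; apply: dFs; rewrite (lt_le_trans st)// lerDr//.
rewrite G; last by rewrite ltrBlDr; lra.
rewrite (_ : RI f = RI (fun x => f (x + 0))); last by apply: eq_RI => x; rewrite addr0.
rewrite G; last by have := normr_ge0 s; lra.
have H t : - `|s| - 1 < t -> is_derive t 1 (fun t => F (t + 2 * pi) - F t) 0.
  move=> st; have d1 := dF _ st.
  have d2 : is_derive t 1 (fun x => F (x + 2 * pi)) (f (t + 2 * pi)).
    by apply: dFs; rewrite (lt_le_trans st)// lerDl ltW ?pi2_gt0.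
  by apply: is_derive_eq (is_deriveB d2 d1) _; rewrite fp subrr.
have K a b : a <= b -> - `|s| - 1 < a ->
    F (b + 2 * pi) - F b = F (a + 2 * pi) - F a.
  move=> ab sa; apply/eqP; rewrite -subr_eq0 -normr_le0.
  have := @mvt_le R (fun t => F (t + 2 * pi) - F t) (fun=> 0) 0 a b ab.
  rewrite mul0r; apply => x /andP[ax xb]; last by rewrite normr0.
  by apply: H; exact: lt_le_trans ax.
rewrite !(addrC (2 * pi)).
case: (lerP 0 s) => s0.
  by apply: K => //; have := normr_ge0 s; lra.
by symmetry; apply: K; [exact: ltW|lra].
Qed.

Lemma continuous_translate (f : R -> R) s : continuous f -> continuous (fun x => f (x + s)).
Proof.
move=> cf x; apply: (@continuous_comp _ _ _ (fun x => x + s) f); last exact: cf.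
by apply: cvgD; [exact: cvg_id|exact: cvg_cst].
Qed.

Definition lipC (f : R -> R[i]) (M : R) :=
  forall x y, cmod (f x - f y) <= M * `|x - y|.

Definition cc (f : R -> R[i]) :=
  continuous (fun x => complex.Re (f x)) /\ continuous (fun x => complex.Im (f x)).

Lemma lipC_cc f M : lipC f M -> cc f.
Proof.
move=> h; split; apply: (@lip_continuous _ M) => x y; apply: le_trans (h x y).
  by rewrite -cReN -cReD; exact: Re_le_cmod.
by rewrite -cImN -cImD; exact: Im_le_cmod.
Qed.

Lemma ccM f g : cc f -> cc g -> cc (fun x => f x * g x).
Proof.
move=> [f1 f2] [g1 g2]; split.
  rewrite (_ : (fun x => _) = fun x => complex.Re (f x) * complex.Re (g x) -
     complex.Im (f x) * complex.Im (g x)); last by apply/funext => x; rewrite cReM.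
  by move=> x; apply: cvgB; apply: cvgM; [exact: f1|exact: g1|exact: f2|exact: g2].
rewrite (_ : (fun x => _) = fun x => complex.Re (f x) * complex.Im (g x) +
     complex.Im (f x) * complex.Re (g x)); last by apply/funext => x; rewrite cImM.
by move=> x; apply: cvgD; apply: cvgM; [exact: f1|exact: g2|exact: f2|exact: g1].
Qed.

Lemma ccD f g : cc f -> cc g -> cc (fun x => f x + g x).
Proof.
move=> [f1 f2] [g1 g2]; split.
  rewrite (_ : (fun x => _) = fun x => complex.Re (f x) + complex.Re (g x)).
    by move=> x; apply: cvgD; [exact: f1|exact: g1].
  by apply/funext => x; rewrite cReD.
rewrite (_ : (fun x => _) = fun x => complex.Im (f x) + complex.Im (g x)).
  by move=> x; apply: cvgD; [exact: f2|exact: g2].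
by apply/funext => x; rewrite cImD.
Qed.

Lemma cc_cst c : cc (fun=> c).
Proof. by split; exact: cst_continuous. Qed.

Lemma cc_cis (a : R) : cc (fun x => cis (a * x)).
Proof.
apply: (@lipC_cc _ (2 * `|a|)) => x y; apply: le_trans (cis_lip _ _) _.
by rewrite -mulrBr normrM mulrA.
Qed.

Lemma CID f g : cc f -> cc g ->
  cintegral (fun x => f x + g x) = cintegral f + cintegral g.
Proof.
move=> [f1 f2] [g1 g2]; apply: complexP.
  by rewrite cReD !Re_CI -RID//; apply: eq_RI => x; rewrite cReD.
by rewrite cImD !Im_CI -RID//; apply: eq_RI => x; rewrite cImD.
Qed.

Lemma CIZ c f : cc f -> cintegral (fun x => c * f x) = c * cintegral f.
Proof.
move=> [cR cI].
have cZ (g : R -> R) a : continuous g -> continuous (fun x => a * g x).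
  by move=> cg x; apply: cvgM; [exact: cvg_cst|exact: cg].
apply: complexP.
  rewrite cReM !(Re_CI, Im_CI) -mulNr -!RIZ// -RID; [|exact: cZ|exact: cZ].
  by apply: eq_RI => x; rewrite cReM mulNr.
rewrite cImM !(Re_CI, Im_CI) -!RIZ// -RID; [|exact: cZ|exact: cZ].
by apply: eq_RI => x; rewrite cImM.
Qed.

(** The real and imaginary parts are bounded separately, which doubles the sharp constant; this is
    the origin of [2 ^+ m] in [coef_norm]. *)
Lemma CI_norm f B : cc f -> (forall x, 0 <= x <= 2 * pi -> cmod (f x) <= B) ->
  cmod (cintegral f) <= 4 * pi * B.
Proof.
move=> [f1 f2] hB; apply: le_trans (cmod_le_ReIm _) _; rewrite Re_CI Im_CI.
rewrite (_ : 4 * pi * B = 2 * pi * B + 2 * pi * B); last by ring.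
apply: lerD; apply: RI_norm => // x /hB; apply: le_trans.
  exact: Re_le_cmod.
exact: Im_le_cmod.
Qed.

Lemma CI_translate f s : cc f -> (forall x, f (x + 2 * pi) = f x) ->
  cintegral (fun x => f (x + s)) = cintegral f.
Proof.
move=> [f1 f2] fp; rewrite !cintegralE; congr Complex.
  by rewrite (RI_translate s f1)// => x; rewrite fp.
by rewrite (RI_translate s f2)// => x; rewrite fp.
Qed.

Lemma eq_CI (f g : R -> R[i]) : (forall x, f x = g x) -> cintegral f = cintegral g.
Proof. by move=> /funext ->. Qed.

Lemma CI_cst (c : R[i]) : cintegral (fun=> c) = (2 * pi)%:C * c.
Proof.
by rewrite cintegralE !RI_cst; apply: complexP; rewrite !ReIm /= mul0r ?subr0 ?addr0.
Qed.

(** For [k != 0], translation by [pi / k] changes the sign of the integrand but not the integral. *)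
Lemma CI_cis (k : int) :
  cintegral (fun x => cis (k%:~R * x)) = if k == 0 then (2 * pi)%:C else 0 : R[i].
Proof.
case: eqVneq => [->|k0].
  rewrite (@eq_CI _ (fun=> 1)) ?CI_cst ?mulr1// => x.
  by rewrite mul0r cis0.
have kn0 : (k%:~R : R) != 0 by rewrite intr_eq0.
have hl := cc_cis (k%:~R).
have : cintegral (fun x : R => cis (k%:~R * (x + pi / k%:~R))) = - cintegral (fun x => cis (k%:~R * x)).
  rewrite -mulN1r -(CIZ _ hl); apply: eq_CI => x.
  rewrite mulrDr mulrCA divff// mulr1 cisD mulrC; congr (_ * _).
  by rewrite /cis cospi sinpi; apply: complexP; rewrite /= ?oppr0.
rewrite (CI_translate (pi / k%:~R) hl); last first.
  by move=> x; rewrite mulrDr cisD (cis2piz R k) mulr1.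
move=> /eqP; rewrite -addr_eq0 -mulr2n -mulr_natl mulf_eq0 pnatr_eq0 /=.
by move=> /eqP.
Qed.

End PeriodIntegral.

(** * Coordinates on the torus and bounded Lipschitz functions *)

Section TorusFunctions.
Variables (R : realType) (m : nat).
Implicit Types (f g : 'rV[R]_m -> R[i]) (y z : 'rV[R]_m).

Lemma norm_rV_le y (c : R) : 0 <= c -> (forall j, `|y 0 j| <= c) -> `|y| <= c.
Proof.
move=> c0 h; rewrite [`|y|]mx_normrE; apply: bigmax_le => // -[i j] _ /=.
by rewrite (ord1 i).
Qed.

Lemma le_norm_rV y j : `|y 0 j| <= `|y|.
Proof.
rewrite [`|y|]mx_normrE.
by apply: (@le_bigmax _ _ _ 0 (fun i : 'I_1 * 'I_m => `|y i.1 i.2|) (0, j)).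
Qed.

Lemma set_coordE y j x i : set_coord y j x 0 i = if i == j then x else y 0 i.
Proof. by rewrite mxE. Qed.

Lemma set_coord_lip y z j x : `|set_coord y j x - set_coord z j x| <= `|y - z|.
Proof.
apply: norm_rV_le => // i; rewrite !mxE; case: eqP => _; first by rewrite subrr normr0.
by have := le_norm_rV (y - z) i; rewrite !mxE.
Qed.

Lemma set_coord_lip1 y j x x' : `|set_coord y j x - set_coord y j x'| <= `|x - x'|.
Proof.
apply: norm_rV_le => // i; rewrite !mxE; case: eqP => _//.
by rewrite subrr normr0.
Qed.

Lemma set_coord_id y j : set_coord y j (y 0 j) = y.
Proof. by apply/rowP => i; rewrite mxE; case: eqP => [->|]. Qed.

Lemma set_coord_set y j x x' : set_coord (set_coord y j x) j x' = set_coord y j x'.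
Proof. by apply/rowP => i; rewrite !mxE; case: eqP. Qed.

Lemma add_basisE y j x i : (y + x *: basis_vec R j) 0 i = y 0 i + (if i == j then x else 0).
Proof. by rewrite !mxE eqxx /= eq_sym; case: eqP; rewrite ?mulr1 ?mulr0. Qed.

Lemma set_coord_add y j x x' :
  set_coord y j (x + x') = set_coord y j x + x' *: basis_vec R j.
Proof.
by apply/rowP => i; rewrite add_basisE !mxE; case: eqP => // _; rewrite addr0.
Qed.

Lemma set_coord_shift y i j x s : i != j ->
  set_coord (y + s *: basis_vec R j) i x = set_coord y i x + s *: basis_vec R j.
Proof.
move=> ij; apply/rowP => l; rewrite add_basisE !set_coordE add_basisE.
by case: (eqVneq l i) => [->|//]; rewrite (negbTE ij) addr0.
Qed.

(* Bounded Lipschitz functions, on which iterated integrals need no compactness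
   argument. *)
Definition BL f := exists2 M, (forall y, cmod (f y) <= M) &
  forall y z, cmod (f y - f z) <= M * `|y - z|.

Lemma BLP f M M' : (forall y, cmod (f y) <= M) ->
  (forall y z, cmod (f y - f z) <= M' * `|y - z|) -> BL f.
Proof.
move=> h h'; exists (Num.max M M') => [y|y z].
  by rewrite le_max h.
by apply: le_trans (h' y z) _; rewrite ler_wpM2r// le_max lexx orbT.
Qed.

Lemma BL_cst c : BL (fun=> c).
Proof.
exists (cmod c) => [//|y z]; rewrite subrr cmod0 mulr_ge0 ?cmod_ge0//.
Qed.

Lemma BLD f g : BL f -> BL g -> BL (fun y => f y + g y).
Proof.
move=> [M h h'] [N k k']; exists (M + N) => [y|y z].
  by apply: le_trans (cmodD _ _) (lerD (h _) (k _)).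
rewrite opprD addrACA mulrDl; apply: le_trans (cmodD _ _) (lerD (h' _ _) (k' _ _)).
Qed.

Lemma BLM f g : BL f -> BL g -> BL (fun y => f y * g y).
Proof.
move=> [M h h'] [N k k']; apply: (@BLP _ (M * N) (M * N + N * M)) => [y|y z].
  by rewrite cmodM ler_pM ?cmod_ge0.
rewrite (_ : _ - _ = f y * (g y - g z) + (f y - f z) * g z); last by ring.
apply: le_trans (cmodD _ _) _; rewrite !cmodM mulrDl -!mulrA; apply: lerD.
  by apply: ler_pM; rewrite ?cmod_ge0.
by rewrite mulrC; apply: ler_pM; rewrite ?cmod_ge0.
Qed.

Lemma BLZ c f : BL f -> BL (fun y => c * f y).
Proof. exact: BLM (BL_cst c). Qed.

Lemma BLN f : BL f -> BL (fun y => - f y).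
Proof. by move=> /(BLZ (-1)); congr BL; apply/funext => y; rewrite mulN1r. Qed.

Lemma BLB f g : BL f -> BL g -> BL (fun y => f y - g y).
Proof. by move=> hf /BLN; exact: BLD. Qed.

Lemma BL_sum (I : Type) (r : seq I) (F : I -> 'rV[R]_m -> R[i]) :
  (forall i, BL (F i)) -> BL (fun y => \sum_(i <- r) F i y).
Proof.
move=> h; elim: r => [|i r IH].
  by rewrite (_ : (fun _ => _) = fun=> 0) ?BL_cst//; first exact: BL_cst; apply/funext => y; rewrite big_nil.
rewrite (_ : (fun _ => _) = fun y => F i y + \sum_(i <- r) F i y); first exact: BLD.
by apply/funext => y; rewrite big_cons.
Qed.

Lemma BL_translate f v : BL f -> BL (fun y => f (y + v)).
Proof.
move=> [M h h']; exists M => [//|y z]; apply: le_trans (h' _ _) _.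
by rewrite opprD addrACA subrr addr0.
Qed.

Lemma BL_cc f y j : BL f -> cc (fun x => f (set_coord y j x)).
Proof.
move=> [M h h']; apply: (@lipC_cc _ _ M) => x x'; apply: le_trans (h' _ _) _.
rewrite ler_wpM2l ?set_coord_lip1//.
by apply: le_trans (h y); exact: cmod_ge0.
Qed.

Lemma BL_ccontinuous f : BL f -> ccontinuous f.
Proof.
move=> [M h h'].
have M0 : 0 <= M by apply: le_trans (h 0); exact: cmod_ge0.
have key (F : 'rV[R]_m -> R) : (forall y z, `|F y - F z| <= M * `|y - z|) -> continuous F.
  move=> hF x; apply/(@cvgrPdist_le _ _ _ (nbhs x) (nbhs_filter x)) => e e0.
  have M1 : 0 < M + 1 by rewrite ltr_wpDl.
  near=> y.
  apply: le_trans (hF _ _) _.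
  have : `|x - y| <= e / (M + 1).
    by near: y; apply: cvgr_dist_le; [exact: cvg_id|rewrite divr_gt0].
  rewrite ler_pdivlMr// => hh; apply: le_trans hh; rewrite mulrC ler_wpM2l//.
  by rewrite lerDl.
split; apply: key => y z; apply: le_trans (h' y z).
  by rewrite -cReN -cReD; exact: Re_le_cmod.
by rewrite -cImN -cImD; exact: Im_le_cmod.
Unshelve. all: by end_near. Qed.

End TorusFunctions.

(** * Iterated integrals, characters and Fourier coefficients *)

Section TorusIntegral.
Variables (R : realType) (m : nat).
Implicit Types (f g : 'rV[R]_m -> R[i]) (y z : 'rV[R]_m) (k l : 'rV[int]_m).

Definition Iop (j : 'I_m) f : 'rV[R]_m -> R[i] :=
  fun y => cintegral (fun x => f (set_coord y j x)).

Definition FI (s : seq 'I_m) f := foldr Iop f s.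

Lemma torus_integralE f : torus_integral f = FI (enum 'I_m) f 0.
Proof. by []. Qed.

Lemma IopD j f g : BL f -> BL g ->
  Iop j (fun y => f y + g y) = fun y => Iop j f y + Iop j g y.
Proof. by move=> hf hg; apply/funext => y; apply: CID; exact: BL_cc. Qed.

Lemma IopZ j c f : BL f -> Iop j (fun y => c * f y) = fun y => c * Iop j f y.
Proof. by move=> hf; apply/funext => y; apply: CIZ; exact: BL_cc. Qed.

Lemma Iop_norm j f M : BL f -> (forall y, cmod (f y) <= M) ->
  forall y, cmod (Iop j f y) <= 4 * pi * M.
Proof. by move=> hf h y; apply: CI_norm => [|x _]; [exact: BL_cc|exact: h]. Qed.

Lemma BL_Iop j f : BL f -> BL (Iop j f).
Proof.
move=> hf; have [M h h'] := hf; apply: (@BLP _ _ _ (4 * pi * M) (4 * pi * M)).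
  exact: Iop_norm.
move=> y z; have hz := BL_cc z j hf; have hm := ccM (cc_cst (-1)) hz.
have -> : Iop j f y - Iop j f z =
    cintegral (fun x => f (set_coord y j x) + -1 * f (set_coord z j x)).
  by rewrite (CID (BL_cc y j hf) hm) (CIZ _ hz) mulN1r.
rewrite -(mulrA (4 * pi)); apply: CI_norm => [|x _].
  exact: ccD (BL_cc y j hf) hm.
rewrite mulN1r; apply: le_trans (h' _ _) _.
rewrite ler_wpM2l ?set_coord_lip//.
by apply: le_trans (h y); exact: cmod_ge0.
Qed.

Lemma BL_FI s f : BL f -> BL (FI s f).
Proof. by move=> hf; elim: s => //= j s; exact: BL_Iop. Qed.

Lemma FID s f g : BL f -> BL g ->
  FI s (fun y => f y + g y) = fun y => FI s f y + FI s g y.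
Proof.
move=> hf hg; elim: s => //= j s ->; rewrite IopD//; exact: BL_FI.
Qed.

Lemma FIZ s c f : BL f -> FI s (fun y => c * f y) = fun y => c * FI s f y.
Proof. by move=> hf; elim: s => //= j s ->; rewrite IopZ//; exact: BL_FI. Qed.

Lemma FI_norm s f M : BL f -> (forall y, cmod (f y) <= M) ->
  forall y, cmod (FI s f y) <= (4 * pi) ^+ size s * M.
Proof.
move=> hf h; elim: s => [|j s IH] y; first by rewrite expr0 mul1r.
rewrite [size _]/= exprS -mulrA; apply: Iop_norm => //; exact: BL_FI.
Qed.

Lemma TID f g : BL f -> BL g ->
  torus_integral (fun y => f y + g y) = torus_integral f + torus_integral g.
Proof. by move=> hf hg; rewrite !torus_integralE FID. Qed.

Lemma TIZ c f : BL f -> torus_integral (fun y => c * f y) = c * torus_integral f.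
Proof. by move=> hf; rewrite !torus_integralE FIZ. Qed.

Lemma TI_norm f M : BL f -> (forall y, cmod (f y) <= M) ->
  cmod (torus_integral f) <= (4 * pi) ^+ m * M.
Proof. by move=> hf h; have := FI_norm (enum 'I_m) hf h 0; rewrite size_enum_ord. Qed.

Lemma TI_sum (I : Type) (r : seq I) (F : I -> 'rV[R]_m -> R[i]) :
  (forall i, BL (F i)) -> torus_integral (fun y => \sum_(i <- r) F i y) =
  \sum_(i <- r) torus_integral (F i).
Proof.
move=> h; elim: r => [|i r IH].
  rewrite big_nil (_ : (fun _ => _) = fun y => 0 * 0); last first.
    by apply/funext => y; rewrite big_nil mul0r.
  by rewrite (@TIZ 0 (fun=> 0)) ?mul0r//; exact: BL_cst.
rewrite big_cons -IH -TID//; last exact: BL_sum.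
by congr torus_integral; apply/funext => y; rewrite big_cons.
Qed.

Lemma Iop_out j (phi : 'rV[R]_m -> R[i]) f : BL f ->
  (forall y x, phi (set_coord y j x) = phi y) ->
  Iop j (fun y => phi y * f y) = fun y => phi y * Iop j f y.
Proof.
move=> hf h; apply/funext => y; rewrite -(CIZ _ (BL_cc y j hf)).
by apply: eq_CI => x; rewrite h.
Qed.

Lemma FI_out s (phi : 'rV[R]_m -> R[i]) f : BL f ->
  (forall j y x, j \in s -> phi (set_coord y j x) = phi y) ->
  FI s (fun y => phi y * f y) = fun y => phi y * FI s f y.
Proof.
move=> hf; elim: s => //= j s IH h; rewrite IH; last first.
  by move=> i y x is_; apply: h; rewrite inE is_ orbT.
by apply: Iop_out => [|y x]; [exact: BL_FI|apply: h; rewrite inE eqxx].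
Qed.

Lemma periodic_Iop j f : periodic f -> periodic (Iop j f).
Proof.
move=> pf i y; apply: eq_CI => x.
have [->|ij] := eqVneq j i.
  congr f; apply/rowP => l; rewrite !set_coordE add_basisE.
  by case: (l == i); rewrite ?addr0.
by rewrite set_coord_shift// pf.
Qed.

Lemma periodic_FI s f : periodic f -> periodic (FI s f).
Proof. by move=> pf; elim: s => //= j s; exact: periodic_Iop. Qed.

Lemma set_coord_per f y j x : periodic f ->
  f (set_coord y j (x + 2 * pi)) = f (set_coord y j x).
Proof. by move=> pf; rewrite set_coord_add pf. Qed.

Lemma Iop_translate j f s : BL f -> periodic f ->
  Iop j (fun y => f (y + s *: basis_vec R j)) = Iop j f.
Proof.
move=> hf pf; apply/funext => y.
rewrite /Iop -(CI_translate s (BL_cc y j hf)); first by apply: eq_CI => x; rewrite set_coord_add.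
by move=> x; rewrite set_coord_per.
Qed.

Lemma FI_translate s j f t : uniq s -> BL f -> periodic f ->
  FI s (fun y => f (y + t *: basis_vec R j)) =
  if j \in s then FI s f else fun y => FI s f (y + t *: basis_vec R j).
Proof.
move=> us hf pf; elim: s us => //= i s IH /andP[nis us]; rewrite IH// inE.
case: (eqVneq j i) => [->|ji] /=.
  rewrite (negbTE nis); apply: Iop_translate; [exact: BL_FI|exact: periodic_FI].
case: (j \in s) => //; apply/funext => y; apply: eq_CI => x.
by rewrite set_coord_shift// eq_sym.
Qed.

Lemma TI_translate j f t : BL f -> periodic f ->
  torus_integral (fun y => f (y + t *: basis_vec R j)) = torus_integral f.
Proof.
by move=> hf pf; rewrite !torus_integralE FI_translate ?enum_uniq// mem_enum.
Qed.

Definition kdot k y : R := \sum_j (k 0 j)%:~R * y 0 j.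

Definition ek k y : R[i] := cis (kdot k y).

Lemma kdotD k y z : kdot k (y + z) = kdot k y + kdot k z.
Proof. by rewrite -big_split; apply: eq_bigr => j _; rewrite mxE mulrDr. Qed.

Lemma kdotDl k l y : kdot (k + l) y = kdot k y + kdot l y.
Proof. by rewrite -big_split; apply: eq_bigr => j _; rewrite mxE rmorphD mulrDl. Qed.

Lemma kdot_basis k j t : kdot k (t *: basis_vec R j) = (k 0 j)%:~R * t.
Proof.
rewrite /kdot (bigD1 j)//= big1 => [|i ij].
  by rewrite !mxE !eqxx mulr1 addr0.
by rewrite !mxE eqxx /= (negbTE ij) !mulr0.
Qed.

Lemma ekD k l y : ek (k + l) y = ek k y * ek l y.
Proof. by rewrite /ek kdotDl cisD. Qed.

Lemma ek0 y : ek 0 y = 1.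
Proof. by rewrite /ek /kdot big1 ?cis0// => j _; rewrite mxE mul0r. Qed.

Lemma ek_translate k j t y :
  ek k (y + t *: basis_vec R j) = cis ((k 0 j)%:~R * t) * ek k y.
Proof. by rewrite /ek kdotD kdot_basis addrC cisD. Qed.

Lemma cmod_ek k y : cmod (ek k y) = 1.
Proof. exact: cmod_cis. Qed.

Lemma periodic_ek k : periodic (ek k).
Proof. by move=> j y; rewrite ek_translate cis2piz mul1r. Qed.

Definition l1 k : R := \sum_j `|(k 0 j)%:~R|.

Lemma kdot_lip k y z : `|kdot k y - kdot k z| <= l1 k * `|y - z|.
Proof.
rewrite -sumrB mulr_suml; apply: le_trans (ler_norm_sum _ _ _) _.
apply: ler_sum => j _; rewrite -mulrBr normrM ler_wpM2l//.
by have := le_norm_rV (y - z) j; rewrite !mxE.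
Qed.

Lemma ek_lip k y z : cmod (ek k y - ek k z) <= 2 * l1 k * `|y - z|.
Proof.
by apply: le_trans (cis_lip _ _) _; rewrite -mulrA ler_wpM2l// kdot_lip.
Qed.

Lemma BL_ek k : BL (ek k).
Proof. by apply: (@BLP _ _ _ 1) (ek_lip k) => y; rewrite cmod_ek. Qed.

Lemma ek_set_coord k j y x : ek k (set_coord y j x) =
  ek k (set_coord y j 0) * cis ((k 0 j)%:~R * x).
Proof. by rewrite -{1}(add0r x) set_coord_add ek_translate mulrC. Qed.

Lemma Iop_ek k j : Iop j (ek k) = fun y =>
  (if k 0 j == 0 then (2 * pi)%:C else 0) * ek k y.
Proof.
apply/funext => y.
rewrite /Iop (eq_CI (ek_set_coord k j y)) (CIZ _ (cc_cis _)) CI_cis mulrC.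
case: eqP => [kj|]; last by rewrite !mul0r.
by congr (_ * _); rewrite -{2}(set_coord_id y j) [RHS]ek_set_coord kj mul0r cis0 mulr1.
Qed.

Lemma FI_ek s k : FI s (ek k) = fun y =>
  (\prod_(j <- s) (if k 0 j == 0 then (2 * pi)%:C else 0)) * ek k y.
Proof.
elim: s => [|j s IH]; first by apply/funext => y; rewrite big_nil mul1r.
rewrite /= IH IopZ ?Iop_ek; last exact: BL_ek.
by apply/funext => y; rewrite big_cons mulrCA mulrA.
Qed.

Lemma TI_ek k : torus_integral (ek k) = if k == 0 then ((2 * pi) ^+ m)%:C else 0.
Proof.
rewrite torus_integralE FI_ek; case: eqVneq => [->|k0].
  rewrite (eq_bigr (fun=> (2 * pi)%:C)) ?ek0 ?mulr1; last by move=> j _; rewrite mxE eqxx.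
  by rewrite big_const_seq count_predT size_enum_ord iter_mulr mulr1 rmorphXn.
have /existsP[j kj] : [exists j, k 0 j != 0].
  apply: contraNT k0; rewrite negb_exists => /forallP h; apply/eqP/rowP => j.
  by have := h j; rewrite mxE negbK => /eqP.
by rewrite (bigD1_seq j) ?mem_enum ?enum_uniq//= (negbTE kj) !mul0r.
Qed.

Definition coef f k : R[i] :=
  ((2 * pi) ^- m)%:C * torus_integral (fun y => f y * ek (- k) y).

Lemma BL_fek f k : BL f -> BL (fun y => f y * ek k y).
Proof. by move=> hf; apply: BLM => //; exact: BL_ek. Qed.

Lemma coefD f g k : BL f -> BL g ->
  coef (fun y => f y + g y) k = coef f k + coef g k.
Proof.
move=> hf hg; rewrite /coef -mulrDr -TID//; try exact: BL_fek.
by congr (_ * torus_integral _); apply/funext => y; rewrite mulrDl.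
Qed.

Lemma coefZ c f k : BL f -> coef (fun y => c * f y) k = c * coef f k.
Proof.
move=> hf; rewrite /coef mulrCA -(TIZ c (BL_fek _ hf)).
by congr (_ * torus_integral _); apply/funext => y; rewrite mulrA.
Qed.

Lemma coefB f g k : BL f -> BL g ->
  coef (fun y => f y - g y) k = coef f k - coef g k.
Proof.
move=> hf hg; rewrite -mulN1r -coefZ// -coefD//; last exact: BLZ.
by congr coef; apply/funext => y; rewrite mulN1r.
Qed.

Lemma coef_sum (I : Type) (r : seq I) (F : I -> 'rV[R]_m -> R[i]) k :
  (forall i, BL (F i)) -> coef (fun y => \sum_(i <- r) F i y) k =
  \sum_(i <- r) coef (F i) k.
Proof.
move=> h; rewrite /coef -mulr_sumr -TI_sum; last by move=> i; exact: BL_fek.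
by congr (_ * torus_integral _); apply/funext => y; rewrite mulr_suml.
Qed.

Lemma pi2m_neq0 : ((2 * pi) ^+ m : R) != 0.
Proof. by rewrite expf_neq0// gt_eqF// pi2_gt0. Qed.

Lemma coef_norm f M k : BL f -> (forall y, cmod (f y) <= M) ->
  cmod (coef f k) <= 2 ^+ m * M.
Proof.
move=> hf h; rewrite cmodM cmodR ger0_norm; last first.
  by rewrite invr_ge0 exprn_ge0// ltW// pi2_gt0.
rewrite ler_pdivrMl; last by rewrite exprn_gt0// pi2_gt0.
apply: le_trans (TI_norm (M := M) (BL_fek _ hf) _) _.
  by move=> y; rewrite cmodM cmod_ek mulr1.
by rewrite mulrA -exprMn (_ : 2 * pi * 2 = 4 * pi)//; ring.
Qed.

Lemma coef_ek k l : coef (ek k) l = (k == l)%:R.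
Proof.
rewrite /coef (_ : (fun y => _) = ek (k - l)); last by apply/funext => y; rewrite ekD.
rewrite TI_ek subr_eq0; case: eqP => _; last by rewrite mulr0.
by rewrite -rmorphM /= mulVf ?pi2m_neq0.
Qed.

Lemma coef_translate j f t k : BL f -> periodic f ->
  coef (fun y => f (y + t *: basis_vec R j)) k = cis ((k 0 j)%:~R * t) * coef f k.
Proof.
move=> hf pf; rewrite /coef mulrCA; congr (_ * _).
rewrite -(@TI_translate j (fun y => f y * ek (- k) y) t); last 2 first.
- exact: BL_fek.
- by move=> i y; rewrite pf periodic_ek.
rewrite -TIZ; last first.
  apply: (@BL_translate _ _ (fun y => f y * ek (- k) y)); exact: BL_fek.
congr torus_integral; apply/funext => y.
rewrite ek_translate mxE rmorphN mulNr -[LHS]mul1r -(cisN ((k 0 j)%:~R * t)).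
by ring.
Qed.

End TorusIntegral.

(** * Uniqueness of Fourier coefficients *)

Section FourierUniqueness.
Variable R : realType.

Lemma mvt_ge (f df : R -> R) (L a b : R) : a <= b ->
  (forall x, a <= x <= b -> is_derive x 1 f (df x)) ->
  (forall x, a <= x <= b -> L <= df x) -> L * (b - a) <= f b - f a.
Proof.
move=> ab fd dfM.
have [|c|c /[!in_itv]/= ac ->] := @MVT_segment R f df a b ab.
- by move=> x /[!in_itv]/= /andP[ax xb]; apply: fd; rewrite (ltW ax) (ltW xb).
- apply: continuous_in_subspaceT => y /[!inE]/= /[!in_itv]/= hy.
  by have [/derivable1_diffP/differentiable_continuous] := fd _ hy.
- by rewrite ler_wpM2r ?subr_ge0 ?dfM.
Qed.

Lemma bernoulli (x : R) n : 0 <= x -> 1 + n%:R * x <= (1 + x) ^+ n.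
Proof.
move=> x0; elim: n => [|n IH]; first by rewrite mul0r addr0 expr0.
rewrite exprS; apply: (@le_trans _ _ ((1 + x) * (1 + n%:R * x))).
  by have := ler0n R n; rewrite -natr1; nra.
by rewrite ler_wpM2l// addr_ge0.
Qed.

Lemma bounded_powers (x B : R) : (forall n, (1 + x) ^+ n <= B) -> x <= 0.
Proof.
move=> h; rewrite leNgt; apply/negP => x0.
have [n hn] : exists n : nat, B / x < n%:R.
  by exists (Num.truncn (B / x)).+1; exact: truncnS_gt.
have := le_trans (bernoulli n (ltW x0)) (h n).
by rewrite ltr_pdivrMr// in hn; lra.
Qed.

(* The powers of [1 + cos (x - pi) - cos eta] concentrate at [pi]. *)
Lemma peak_kernel (h : R -> R) (M : R) : continuous h -> (forall x, `|h x| <= M) ->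
  (forall c n, RI (fun x => h x * (c - cos x) ^+ n) = 0) -> h pi <= 0.
Proof.
move=> ch hM hz; rewrite leNgt; apply/negP => h0.
pose a := h pi / 2.
have a0 : 0 < a by rewrite divr_gt0.
have [eta /andP[eta0 eta1] heta] : exists2 eta, 0 < eta <= 1 &
    forall x, `|x - pi| <= eta -> a <= h x.
  have /cvgrPdist_le /(_ a a0) := ch pi.
  rewrite near_simpl => /nbhs_ballP[e /= e0 he].
  exists (Num.min 1 (e / 2)) => [|x].
    by rewrite lt_min ltr01 divr_gt0//= ge_min lexx.
  rewrite le_min => /andP[_ xe].
  have /he : ball (pi : R) e x.
    rewrite /ball/= distrC; apply: le_lt_trans xe _.
    by rewrite ltr_pdivrMr// ltr_pMr// ltr1n.
  rewrite /= ler_norml /a => /andP[_]; lra.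
have pi1 : 1 < pi :> R by have := @pi_ge2 R; lra.
have epi : eta / 2 <= pi by lra.
(* As [- cos x = cos (x - pi)], the base [c - cos x] is at least [1 + rho] for
   [|x - pi| <= eta / 2], nonnegative for [|x - pi| <= eta], and in [[-1, 1]] on the rest of the
   period. *)
pose c := 1 - cos eta.
pose rho := cos (eta / 2) - cos eta.
have rho0 : 0 < rho.
  rewrite subr_gt0 ltr_cos ?in_itv/=; lra.
have cospi (x : R) : - cos x = cos (x - pi) :> R.
  by rewrite cosB cospi sinpi mulr0 addr0 mulrN1.
have cosle (x y : R) : `|x| <= y -> y <= pi -> cos y <= cos x.
  move=> xy ypi.
  have -> : cos x = cos `|x| by case: (ger0P x) => // _; rewrite cosN.
  have x0 := normr_ge0 x; rewrite leNgt ltr_cos ?in_itv/=; [|lra|lra].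
  by rewrite -leNgt.
suff : rho <= 0 by rewrite leNgt rho0.
apply: (@bounded_powers _ (2 * pi * M / (a * eta))) => n.
rewrite ler_pdivlMr ?mulr_gt0//.
have cq : continuous (fun x : R => h x * (c - cos x) ^+ n).
  move=> x; apply: cvgM; first exact: ch.
  apply: (@continuous_comp _ _ _ (fun x => c - cos x) (fun y => y ^+ n)).
    by apply: cvgB; [exact: cvg_cst|exact: continuous_cos].
  exact: exprn_continuous.
have [F dF] := @local_primitive R _ (-1) cq.
have M0 : 0 <= M by apply: le_trans (hM 0).
have dF' (x : R) : 0 <= x -> is_derive x 1 F (h x * (c - cos x) ^+ n).
  by move=> x0; apply: dF; lra.
have E : F (2 * pi) - F 0 = 0.
  rewrite -[RHS](hz c n); symmetry; have := @RI_FTC R _ F cq; apply.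
  by move=> x /andP[x0 _]; exact: dF'.
have lowM (x : R) : 0 <= x <= 2 * pi -> - M <= h x * (c - cos x) ^+ n.
  move=> /andP[x0 x2].
  have cx : -1 <= cos x <= 1 by rewrite cos_geN1 cos_le1.
  have ce : -1 <= cos eta <= 1 by rewrite cos_geN1 cos_le1.
  case: (lerP `|x - pi| eta) => xe.
    apply: (@le_trans _ _ 0); first by rewrite oppr_le0.
    apply: mulr_ge0; first by apply: le_trans (heta _ xe); exact: ltW.
    rewrite exprn_ge0// /c (cospi x); have := cosle (x - pi) eta xe (le_trans eta1 (ltW pi1)).
    by have := cos_geN1 eta; have := cos_le1 eta; lra.
  have q1 : `|c - cos x| <= 1.
    have : cos (x - pi) <= cos eta.
      have -> : cos (x - pi) = cos `|x - pi| by case: (ger0P (x - pi)) => // _; rewrite cosN.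
      have xp : `|x - pi| <= pi by rewrite ler_norml; lra.
      have np := normr_ge0 (x - pi).
      rewrite leNgt ltr_cos ?in_itv/=; [|lra|lra].
      by rewrite -leNgt ltW.
    rewrite -cospi /c ler_norml; move: cx ce => /andP[? ?] /andP[? ?] ?.
    by apply/andP; split; lra.
  have : `|h x * (c - cos x) ^+ n| <= M.
    by rewrite normrM normrX -[leRHS]mulr1 ler_pM ?normr_ge0 ?exprn_ge0 ?exprn_ile1.
  by rewrite ler_norml => /andP[].
(* The vanishing integral is split at [pi - eta / 2] and [pi + eta / 2]: the outer parts are at
   least [- M] times their lengths, the inner one at least [a * (1 + rho) ^+ n * eta], so these
   powers are bounded in [n]. *)
have h1 := @mvt_ge F _ (- M) 0 (pi - eta / 2) _ _ _.
have {}h1 : - M * (pi - eta / 2 - 0) <= F (pi - eta / 2) - F 0.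
  apply: h1; first by lra.
    by move=> x /andP[x0 _]; exact: dF'.
  by move=> x /andP[x0 xp]; apply: lowM; lra.
have h2 := @mvt_ge F _ (- M) (pi + eta / 2) (2 * pi) _ _ _.
have {}h2 : - M * (2 * pi - (pi + eta / 2)) <= F (2 * pi) - F (pi + eta / 2).
  apply: h2; first by lra.
    by move=> x /andP[x0 _]; apply: dF'; lra.
  by move=> x /andP[x0 xp]; apply: lowM; lra.
have h3 := @mvt_ge F _ (a * (1 + rho) ^+ n) (pi - eta / 2) (pi + eta / 2) _ _ _.
have {}h3 : a * (1 + rho) ^+ n * (pi + eta / 2 - (pi - eta / 2)) <=
    F (pi + eta / 2) - F (pi - eta / 2).
  apply: h3; first by lra.
    by move=> x /andP[x0 _]; apply: dF'; lra.
  move=> x /andP[x0 xp].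
  have xe : `|x - pi| <= eta / 2 by rewrite ler_norml; lra.
  have xe' : `|x - pi| <= eta by lra.
  apply: ler_pM; [exact: ltW| | exact: heta|].
    by rewrite exprn_ge0//; lra.
  rewrite lerXn2r// ?nnegrE; [lra| |].
    rewrite /c (cospi x); have := cosle (x - pi) _ xe epi; rewrite /rho in rho0; lra.
  by rewrite /c /rho (cospi x); have := cosle (x - pi) _ xe epi; lra.
rewrite (_ : 2 * pi * M = M * (pi + eta / 2) + M * (pi - eta / 2)); last by ring.
rewrite [leLHS]mulrA (mulrC _ a).
have Me := mulr_ge0 M0 (ltW eta0).
by move: (a * (1 + rho) ^+ n) (F (pi + eta / 2)) (F (pi - eta / 2)) h1 h2 h3 => X u v h1 h2 h3; lra.
Qed.

(** The vanishing of all Fourier coefficients is inherited by the products of [f] with powers of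
    [c - cos (x - t)], which are trigonometric polynomials (property [sp]). The peak kernel, centred
    at an arbitrary point, then applies to the real and imaginary parts of [f] and to their
    negatives. *)
Lemma circle_fourier_uniqueness (f : R -> R[i]) (M : R) : cc f ->
  (forall x, cmod (f x) <= M) -> (forall x, f (x + 2 * pi) = f x) ->
  (forall k : int, cintegral (fun x => f x * cis (k%:~R * x)) = 0) ->
  forall t, f t = 0.
Proof.
move=> cf fM fp fz.
pose sp (p : R -> R[i]) := cc p /\ (forall k : int, cintegral (fun x => f x * p x * cis (k%:~R * x)) = 0).
have spM p (c t : R) : sp p -> sp (fun x => p x * (c - cos (x - t))%:C).
  move=> [cp hp].
  have q x : (c - cos (x - t))%:C = c%:C + (- 2^-1)%:C * cis (- t) * cis (1%:~R * x) +
      (- 2^-1)%:C * cis t * cis ((-1)%:~R * x).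
    apply: complexP; rewrite !(Re_cis, Im_cis, ReIm) mul1r mulN1r !cosN !sinN.
      by rewrite cosB; field.
    by ring.
  have ccq : cc (fun x => (c - cos (x - t))%:C).
    rewrite (_ : (fun x => _) = fun x => c%:C + (- 2^-1)%:C * cis (- t) * cis (1%:~R * x) +
      (- 2^-1)%:C * cis t * cis ((-1)%:~R * x)); last exact/funext.
    have cp0 (a : R[i]) (l : R) := ccM (cc_cst a) (cc_cis l).
    exact: (ccD (ccD (cc_cst _) (cp0 _ _)) (cp0 _ _)).
  split; first exact: ccM.
  move=> k.
  have cck (l : int) : cc (fun x => f x * p x * cis (l%:~R * x)).
    exact: (ccM (ccM cf cp) (cc_cis _)).
  rewrite (@eq_CI _ _ (fun x => c%:C * (f x * p x * cis (k%:~R * x)) +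
     ((- 2^-1)%:C * cis (- t)) * (f x * p x * cis ((1 + k)%:~R * x)) +
     ((- 2^-1)%:C * cis t) * (f x * p x * cis ((-1 + k)%:~R * x)))); last first.
    by move=> x; rewrite q !rmorphD !mulrDl !cisD; ring.
  have ccZ (a : R[i]) (l : int) : cc (fun x => a * (f x * p x * cis (l%:~R * x))).
    by apply: ccM; [exact: cc_cst|exact: cck].
  by rewrite CID ?CID ?CIZ ?hp ?mulr0 ?addr0//; exact: ccD.
have spn (c t : R) n : sp (fun x => ((c - cos (x - t)) ^+ n)%:C).
  elim: n => [|n IH].
    rewrite (_ : (fun x => _) = fun=> 1); last exact/funext.
    split; first exact: cc_cst.
    by move=> k; rewrite -[RHS](fz k); apply: eq_CI => x; rewrite mulr1.
  have := spM _ c t IH; congr sp; apply/funext => x.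
  by rewrite exprSr rmorphM.
have key (t : R) : complex.Re (f t) <= 0 /\ - complex.Re (f t) <= 0 /\
                   complex.Im (f t) <= 0 /\ - complex.Im (f t) <= 0.
  have [cR cI] := cf.
  have ann c n : RI (fun x => complex.Re (f (x + (t - pi))) * (c - cos x) ^+ n) = 0 /\
     RI (fun x => complex.Im (f (x + (t - pi))) * (c - cos x) ^+ n) = 0.
    have [cp hp] := spn c (t - pi) n.
    have := hp 0.
    rewrite -(CI_translate (t - pi)); last 2 first.
    - exact: (ccM (ccM cf cp) (cc_cis _)).
    - move=> x; rewrite fp !mulr0z !mul0r; congr (_ * _ * _).
      by rewrite (addrAC x) cosD2pi || rewrite addrAC -[cos (_ + 2 * pi)]/(cos _) mulr_natl cosD2pi.
    move=> h; split.
      rewrite -[RHS](congr1 (@complex.Re R) h) Re_CI; apply: eq_RI => x.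
      by rewrite addrK mulr0z mul0r cis0 mulr1 cReM cReR cImR mulr0 subr0.
    rewrite -[RHS](congr1 (@complex.Im R) h) Im_CI; apply: eq_RI => x.
    by rewrite addrK mulr0z mul0r cis0 mulr1 cImM cReR cImR mulr0 add0r.
  have et : t = pi + (t - pi) by ring.
  have ctR : continuous (fun x => complex.Re (f (x + (t - pi)))).
    exact: (@continuous_translate R (fun x => complex.Re (f x))).
  have ctI : continuous (fun x => complex.Im (f (x + (t - pi)))).
    exact: (@continuous_translate R (fun x => complex.Im (f x))).
  have bR x : `|complex.Re (f (x + (t - pi)))| <= M by apply: le_trans (Re_le_cmod _) (fM _).
  have bI x : `|complex.Im (f (x + (t - pi)))| <= M by apply: le_trans (Im_le_cmod _) (fM _).
  have cN (g : R -> R) : continuous g -> continuous (fun x => - g x).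
    by move=> cg x; apply: cvgN; exact: cg.
  have cts (g : R -> R) c n : continuous g -> continuous (fun x => g x * (c - cos x) ^+ n).
    move=> cg x; apply: cvgM; first exact: cg.
    apply: (@continuous_comp _ _ _ (fun x => c - cos x) (fun y => y ^+ n)).
      by apply: cvgB; [exact: cvg_cst|exact: continuous_cos].
    exact: exprn_continuous.
  have annN (g : R -> R) c n : continuous g -> RI (fun x => g x * (c - cos x) ^+ n) = 0 ->
      RI (fun x => - g x * (c - cos x) ^+ n) = 0.
    move=> cg e; rewrite -[RHS](mulr0 (-1)) -e -RIZ; last exact: cts.
    by apply: eq_RI => x; rewrite mulNr mulN1r.
  rewrite {1 2 3 4}et; split; last split; last split.
  - exact: (peak_kernel ctR bR (fun c n => (ann c n).1)).
  - apply: (@peak_kernel (fun x => - complex.Re (f (x + (t - pi)))) M); first exact: cN.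
      by move=> x; rewrite normrN.
    by move=> c n; apply: annN => //; exact: (ann c n).1.
  - exact: (peak_kernel ctI bI (fun c n => (ann c n).2)).
  - apply: (@peak_kernel (fun x => - complex.Im (f (x + (t - pi)))) M); first exact: cN.
      by move=> x; rewrite normrN.
    by move=> c n; apply: annN => //; exact: (ann c n).2.
move=> t; have [h1 [h2 [h3 h4]]] := key t.
by apply: complexP => /=; apply/eqP; rewrite eq_le; lra.
Qed.

End FourierUniqueness.

Section TorusUniqueness.
Variables (R : realType) (m : nat).
Implicit Types (f g : 'rV[R]_m -> R[i]) (y z : 'rV[R]_m) (k l : 'rV[int]_m).

(** Induction on the list of integrated variables: with the other variables frozen, the integral
    over the tail of the list is a function of the head coordinate all of whose Fourier coefficients
    on the circle vanish. *)
Lemma FI_uniqueness (s : seq 'I_m) f : uniq s -> BL f -> periodic f ->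
  (forall k, FI s (fun y => f y * ek k y) = fun=> 0) -> f = fun=> 0.
Proof.
elim: s => [|j s IH] /= us hf pf hz.
  by have := hz 0; rewrite /= => <-; apply/funext => y; rewrite ek0 mulr1.
move: us => /andP[js us]; apply: (IH us hf pf) => k; apply/funext => y.
have hF k' : BL (FI s (fun y => f y * ek k' y)) by apply: BL_FI; exact: BL_fek.
have pF k' : periodic (FI s (fun y => f y * ek k' y)).
  by apply: periodic_FI => i z; rewrite pf periodic_ek.
have [M hM _] := hF k.
rewrite -(set_coord_id y j).
apply: (@circle_fourier_uniqueness R (fun x => FI s (fun y => f y * ek k y) (set_coord y j x)) M).
- exact: BL_cc.
- by move=> x; exact: hM.
- by move=> x; exact: set_coord_per.
(* The frequency [r] in direction [j] is obtained by adding it to the [j]-th entry of [k]. *)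
move=> r; have := congr1 (fun F => F y) (hz (k + \row_i (if i == j then r else 0))).
rewrite /Iop => h; rewrite -[RHS]h; apply: eq_CI => x.
rewrite (_ : (fun y => f y * ek (_ + _) y) = fun y =>
   cis (r%:~R * y 0 j) * (f y * ek k y)); last first.
  apply/funext => z; rewrite ekD [RHS]mulrC -mulrA; congr (_ * (_ * _)).
  rewrite /ek /kdot (bigD1 j)//= mxE eqxx big1 ?addr0// => i ij.
  by rewrite mxE (negbTE ij) mul0r.
rewrite (@FI_out R m s (fun y => cis (r%:~R * y 0 j)) (fun y => f y * ek k y)); last 2 first.
- exact: BL_fek.
- by move=> i z x' is_; rewrite set_coordE; case: eqP => // ji; rewrite -ji in is_; rewrite is_ in js.
by rewrite set_coordE eqxx mulrC.
Qed.

Theorem fourier_uniqueness f : BL f -> periodic f ->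
  (forall k, coef f k = 0) -> f = fun=> 0.
Proof.
move=> hf pf hz; apply: (FI_uniqueness (enum_uniq 'I_m)) => // k.
have TI0 : torus_integral (fun y => f y * ek k y) = 0.
  have /eqP := hz (- k); rewrite /coef opprK mulf_eq0 => /orP[|/eqP//].
  by rewrite eq_complex /= invr_eq0 (negbTE (pi2m_neq0 R m)).
apply/funext => y; rewrite -TI0 torus_integralE.
(* [torus_integral] evaluates the iterated integral at 0; once all the variables are integrated, the
   point does not matter. *)
have indep (s : seq 'I_m) (g : 'rV[R]_m -> R[i]) y' z : (forall i, i \notin s -> y' 0 i = z 0 i) ->
    FI s g y' = FI s g z.
  elim: s y' z => [|i s IH] y' z h /=.
    by congr g; apply/rowP => i; exact: h.
  apply: eq_CI => x; apply: IH => l ls; rewrite !set_coordE; case: eqP => // /eqP li.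
  by apply: h; rewrite inE negb_or li.
by apply: indep => i; rewrite mem_enum.
Qed.

End TorusUniqueness.

(** * Subexponential weights and lattice sums *)

Section RootWeight.
Variables (R : realType) (s : R).
Hypothesis s1 : 1 < s.

Definition sroot (x : R) : R := `|x| `^ s^-1.
Local Notation rt := sroot.

Let s0 : 0 < s. Proof. exact: lt_trans s1. Qed.
Let si0 : 0 < s^-1. Proof. by rewrite invr_gt0. Qed.

Lemma rt_ge0 x : 0 <= rt x. Proof. exact: powR_ge0. Qed.

Lemma rt0 : rt 0 = 0.
Proof. by rewrite /sroot normr0 powR0// gt_eqF. Qed.

Lemma rtN x : rt (- x) = rt x. Proof. by rewrite /sroot normrN. Qed.

Lemma rt_norm x : rt `|x| = rt x. Proof. by rewrite /sroot normr_id. Qed.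

Lemma rtK x : rt x `^ s = `|x|.
Proof. by rewrite /sroot -powRrM mulVf ?gt_eqF// powRr1. Qed.

Lemma rt_le x y : `|x| <= `|y| -> rt x <= rt y.
Proof. by move=> xy; apply: ge0_ler_powR; rewrite ?nnegrE ?(ltW si0). Qed.

Lemma rtM x y : rt (x * y) = rt x * rt y.
Proof. by rewrite /sroot normrM powRM. Qed.

Lemma rt_ge1 x : 1 <= `|x| -> 1 <= rt x.
Proof. move=> x1; have e : (1 : R) `^ s^-1 = 1 by rewrite powR1.
by rewrite -[leLHS]e; apply: ge0_ler_powR; rewrite ?nnegrE ?(ltW si0). Qed.

(** With [S = |x| + |y|], one has [|z| <= |z|^(1/s) S^(1 - 1/s)] for [z = x] and [z = y]; the sum of
    the two inequalities is divided by [S^(1 - 1/s)]. *)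
Lemma rtD x y : rt (x + y) <= rt x + rt y.
Proof.
have [xy0|xy0] := eqVneq (`|x| + `|y|) 0.
  have : `|x + y| <= 0 by rewrite -xy0 ler_normD.
  by rewrite normr_le0 => /eqP ->; rewrite rt0 addr_ge0 ?rt_ge0.
have n0 : 0 < `|x| + `|y| by rewrite lt0r xy0 addr_ge0.
apply: (@le_trans _ _ (rt (`|x| + `|y|))).
  by apply: rt_le; rewrite (ger0_norm (ltW n0)) ler_normD.
rewrite {1}/sroot (gtr0_norm n0).
set S := _ + _ in n0 xy0 *.
have P0 : 0 < S `^ (1 - s^-1) by rewrite powR_gt0.
rewrite -(ler_pM2r P0) -powRD; last by rewrite xy0 implybT.
rewrite addrC subrK powRr1 ?(ltW n0)// mulrDl.
have key z : `|z| <= S -> `|z| <= rt z * S `^ (1 - s^-1).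
  move=> zS; have [->|z0] := eqVneq z 0; first by rewrite normr0 rt0 mul0r.
  rewrite -{1}(@powRr1 _ `|z|)// -{1}(subrK s^-1 1) addrC powRD; last by rewrite normr_eq0 z0 implybT.
  rewrite ler_wpM2l ?powR_ge0//; apply: ge0_ler_powR; rewrite ?nnegrE ?(ltW n0)//.
  by rewrite subr_ge0 invf_le1// ltW.
by apply: lerD; apply: key; rewrite /S ?lerDl ?lerDr.
Qed.

Lemma exp_ge_term (x : R) r : 0 <= x -> x ^+ r <= r`!%:R * expR x.
Proof.
move=> x0; case: r => [|r].
  by rewrite expr0 fact0 mul1r -expR0 ler_expR.
rewrite -ler_pdivrMl ?ltr0n ?fact_gt0// mulrC.
by apply: le_trans (expR_ge1Dxn r x0); rewrite lerDr.
Qed.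

Lemma rtX_powR (x : R) r : (rt x ^+ r) `^ s = `|x| ^+ r.
Proof.
by rewrite -powR_mulrn ?rt_ge0// -powRrM mulrC powRrM rtK powR_mulrn.
Qed.

Lemma powRXC (x : R) r : 0 <= x -> (x ^+ r) `^ s = (x `^ s) ^+ r.
Proof. by move=> x0; rewrite -(powR_mulrn r x0) -(powR_mulrn r (powR_ge0 x s)) -!powRrM mulrC. Qed.

Lemma expR_powR (y : R) : (expR y) `^ s = expR (s * y).
Proof. by rewrite /powR gt_eqF ?expR_gt0// expRK. Qed.

(** This is the [s]-th power of [y^r <= r! exp y] at [y = d |x|^(1/s) / s]; the Gevrey factor
    [(r!)^s] arises here. *)
Lemma weight_absorb d (x : R) r : 0 < d ->
  `|x| ^+ r * expR (- d * rt x) <= ((s / d) `^ s) ^+ r * (r`!%:R) `^ s.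
Proof.
move=> d0.
have ds : 0 < d / s by rewrite divr_gt0.
have h := exp_ge_term r (mulr_ge0 (ltW ds) (rt_ge0 x)).
have {}h : ((d / s * rt x) ^+ r) `^ s <= (r`!%:R * expR (d / s * rt x)) `^ s.
  have dr := mulr_ge0 (ltW ds) (rt_ge0 x).
  by apply: ge0_ler_powR; rewrite ?nnegrE ?(ltW s0)// ?exprn_ge0// mulr_ge0 ?expR_ge0.
rewrite exprMn !powRM ?exprn_ge0 ?expR_ge0 ?rt_ge0 ?(ltW ds)// rtX_powR in h.
rewrite expR_powR in h.
rewrite mulNr expRN ler_pdivrMr ?expR_gt0//.
have -> : d * rt x = s * (d / s * rt x) by field; rewrite gt_eqF.
have Q0 : 0 < ((d / s) ^+ r) `^ s by rewrite powR_gt0// exprn_gt0.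
rewrite -(ler_pM2l Q0); apply: le_trans h _.
rewrite !mulrA ler_wpM2r ?expR_ge0// -powRXC ?divr_ge0 ?(ltW s0) ?(ltW d0)//.
rewrite -powRM ?exprn_ge0 ?divr_ge0 ?(ltW s0) ?(ltW d0)// -exprMn.
have -> : d / s * (s / d) = 1 by field; rewrite !gt_eqF.
by rewrite expr1n powR1 mul1r.
Qed.

Lemma expR_le_limit (y B : R) : 0 <= y ->
  (forall n, \sum_(i < n) y ^+ i / i`!%:R <= B) -> expR y <= B.
Proof.
move=> y0 h; rewrite /expR.
apply: limr_le; first exact: is_cvg_series_exp_coeff.
by apply: nearW => n; rewrite /series/= big_mkord; exact: h.
Qed.

(** Converse of [weight_absorb]. After extraction of [s]-th roots the hypothesis reads
    [a^(1/s) Y^r <= D^(1/s) r!] with [Y = (|x| / h)^(1/s)]. Evaluating the exponential series at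
    [Y / 2] supplies the weights [2^-r], at the price of a factor 2 and of half of the rate. *)
Lemma root_decay (a D h x : R) : 0 <= a -> 0 <= D -> 0 < h ->
  (forall r, a * `|x| ^+ r <= D * h ^+ r * (r`!%:R) `^ s) ->
  a <= 2 `^ s * D * expR (- (s / 2 * rt h^-1) * rt x).
Proof.
move=> a0 D0 h0 H.
have hi : 0 < h^-1 by rewrite invr_gt0.
pose Y := rt (h^-1 * x).
have Y0 : 0 <= Y by exact: rt_ge0.
have term r : a `^ s^-1 * Y ^+ r <= D `^ s^-1 * r`!%:R.
  have [fr fr'] : 0 <= (r`!%:R : R) /\ 0 < (r`!%:R : R) by rewrite ler0n ltr0n fact_gt0.
  rewrite -(@ler_pM2r _ 1)// !mulr1.
  have e : (a `^ s^-1 * Y ^+ r) `^ s <= (D `^ s^-1 * r`!%:R) `^ s.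
    rewrite !powRM ?powR_ge0 ?exprn_ge0// -!powRrM !mulVf ?gt_eqF// !powRr1// /Y rtX_powR.
    rewrite normrM exprMn (gtr0_norm hi) exprVn mulrCA ler_pdivrMl ?exprn_gt0//.
    by rewrite mulrA (mulrC _ D); exact: H.
  rewrite leNgt; apply/negP => lt; move: e; apply/negP; rewrite -ltNge.
  by apply: gt0_ltr_powR => //; rewrite nnegrE mulr_ge0 ?powR_ge0 ?exprn_ge0.
have A0 : 0 <= a `^ s^-1 by exact: powR_ge0.
have sum n : a `^ s^-1 * \sum_(i < n) (Y / 2) ^+ i / i`!%:R <= 2 * D `^ s^-1.
  apply: (@le_trans _ _ (D `^ s^-1 * \sum_(i < n) 2^-1 ^+ i)).
    rewrite !mulr_sumr; apply: ler_sum => i _.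
    rewrite exprMn mulrA mulrAC mulrA ler_wpM2r ?exprn_ge0 ?invr_ge0//.
    by rewrite mulrAC ler_pdivrMr ?ltr0n ?fact_gt0//; exact: term.
  rewrite mulrC ler_wpM2r ?powR_ge0//.
  have -> : \sum_(i < n) (2^-1 : R) ^+ i = 2 - 2 * 2^-1 ^+ n.
    elim: n => [|n IH]; first by rewrite big_ord0 expr0; ring.
    by rewrite big_ord_recr /= IH exprS; field.
  by rewrite gerBl mulr_ge0// exprn_ge0.
have [->|an0] := eqVneq a 0.
  by rewrite !mulr_ge0 ?powR_ge0 ?expR_ge0.
have {}A0 : 0 < a `^ s^-1 by rewrite powR_gt0 // lt0r an0.
have key : a `^ s^-1 * expR (Y / 2) <= 2 * D `^ s^-1.
  rewrite -ler_pdivlMl//; apply: expR_le_limit; first by rewrite divr_ge0.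
  by move=> n; rewrite ler_pdivlMl.
have {}key : (a `^ s^-1 * expR (Y / 2)) `^ s <= (2 * D `^ s^-1) `^ s.
  by apply: ge0_ler_powR => //; rewrite ?nnegrE ?(ltW s0)// ?mulr_ge0 ?powR_ge0 ?expR_ge0.
rewrite !powRM ?powR_ge0 ?expR_ge0// -!powRrM !mulVf ?gt_eqF// !powRr1// in key.
rewrite expR_powR in key.
rewrite mulNr expRN ler_pdivlMr ?expR_gt0//; apply: le_trans key.
rewrite ler_wpM2l// ler_expR /Y rtM.
by rewrite (_ : s / 2 * rt h^-1 * rt x = s * (rt h^-1 * rt x / 2))//; field.
Qed.

Lemma rt_absorb (d : R) x : 0 < d -> `|x| * expR (- d * rt x) <= (s / d) `^ s.
Proof. by move=> d0; have := weight_absorb x 1 d0; rewrite !expr1 (_ : 1`!%:R = 1 :> R)// powR1 mulr1. Qed.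

End RootWeight.

(** * Sums of the weights over the lattice *)

Section LatticeSums.
Variables (R : realType) (s : R).
Hypothesis s1 : 1 < s.
Local Notation rt := (sroot s).

Lemma sub_sum (T : eqType) (r r' : seq T) (g : T -> R) : uniq r ->
  {subset r <= r'} -> (forall x, 0 <= g x) ->
  \sum_(x <- r) g x <= \sum_(x <- r') g x.
Proof.
move=> + + g0; elim: r r' => [|x r IH] r' /=.
  by move=> _ _; rewrite big_nil sumr_ge0.
move=> /andP[xr ur] h; have xr' : x \in r' by apply: h; rewrite inE eqxx.
rewrite big_cons (perm_big _ (perm_to_rem xr')) big_cons lerD2l; apply: IH => // y yr.
have : y \in r' by apply: h; rewrite inE yr orbT.
rewrite (perm_mem (perm_to_rem xr')) inE => /orP[/eqP yx|//].
by move: xr; rewrite -yx yr.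
Qed.

(** [weight_absorb] with exponent 2 bounds the terms by a multiple of [1 / (n + 1) - 1 / (n + 2)],
    which telescopes. *)
Lemma int_sum_bound (d : R) : 0 < d -> exists2 S, 0 < S &
  forall N : nat, \sum_(i < (2 * N).+1) expR (- d * rt ((i%:Z - N%:Z)%:~R)) <= S.
Proof.
move=> d0.
(* The summand 1 serves the term [n = 0], whose weight is 1. *)
pose C := ((s / d) `^ s) ^+ 2 * (2`!%:R) `^ s + 1.
have C1 : 1 <= C by rewrite lerDr mulr_ge0 ?exprn_ge0 ?powR_ge0.
have C0 : 0 < C by apply: lt_le_trans C1.
pose t (n : nat) : R := 6 * C * (n.+1%:R^-1 - n.+2%:R^-1).
have tE n : t n = 6 * C / (n.+1%:R * n.+2%:R).
  rewrite /t; have a : (n.+1%:R : R) != 0 by rewrite pnatr_eq0.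
  have b : (n.+2%:R : R) != 0 by rewrite pnatr_eq0.
  have c : (n.+2%:R : R) = n.+1%:R + 1 by rewrite natr1.
  have gen (x : R) : x != 0 -> x + 1 != 0 -> 6 * C * (x^-1 - (x + 1)^-1) = 6 * C / (x * (x + 1)).
    by move=> x0 x1; field; rewrite x0 x1.
  by rewrite c; apply: gen; rewrite // -c.
have bnd n : expR (- d * rt n%:R) <= t n.
  rewrite tE ler_pdivlMr ?mulr_gt0 ?ltr0n//.
  case: n => [|n].
    rewrite rt0// mulr0 expR0 mul1r mul1r; nra.
  have := @weight_absorb R s s1 d n.+1%:R 2 d0.
  rewrite normr_nat => h.
  have e0 : 0 < expR (- d * rt n.+1%:R) by rewrite expR_gt0.
  have nn : (n.+2%:R * n.+3%:R : R) <= 6 * n.+1%:R ^+ 2.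
    rewrite -!natr1; have := ler0n R n; nra.
  apply: (@le_trans _ _ (expR (- d * rt n.+1%:R) * (6 * n.+1%:R ^+ 2))).
    by rewrite ler_wpM2l// ltW.
  rewrite mulrCA ler_wpM2l// mulrC (le_trans h)// /C lerDl//.
have t0 n : 0 <= t n by rewrite tE divr_ge0 ?mulr_ge0 ?(ltW C0).
have tsum N : \sum_(i < N) t i <= 6 * C.
  rewrite -mulr_sumr -[leRHS]mulr1 ler_wpM2l ?mulr_ge0 ?(ltW C0)//.
  have -> : \sum_(i < N) ((i.+1)%:R^-1 - (i.+2)%:R^-1) = 1 - N.+1%:R^-1 :> R.
    elim: N => [|N IH]; first by rewrite big_ord0 invr1 subrr.
    by rewrite big_ord_recr /= IH; ring.
  by rewrite gerBl invr_ge0.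
exists (12 * C) => [|N]; first by rewrite mulr_gt0.
have bi (z : int) : expR (- d * rt z%:~R) <= t `|z|%N.
  by rewrite -(rt_norm s) -intr_norm -abszE; exact: bnd.
apply: (@le_trans _ _ (\sum_(i < (2 * N).+1) t `|(i%:Z - N%:Z)|%N)).
  by apply: ler_sum => i _; exact: bi.
rewrite (_ : (2 * N).+1 = (N + N.+1)%N); last by lia.
rewrite big_split_ord /=.
rewrite (_ : 12 * C = 6 * C + 6 * C); last by ring.
apply: lerD.
  rewrite (reindex_inj rev_ord_inj) /=.
  apply: (@le_trans _ _ (\sum_(i < N.+1) t i)); last exact: tsum.
  rewrite big_ord_recl /= -[leLHS]add0r; apply: lerD => //.
  apply: ler_sum => i _; rewrite /bump leq0n add1n (_ : `|_|%N = i.+1)//; have := ltn_ord i; lia.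
apply: le_trans (tsum N.+1); apply: ler_sum => i _.
by rewrite (_ : `|_|%N = i)//; lia.
Qed.

Variable m : nat.
Local Notation K := 'rV[int]_m.

(** Comparable to [|k|^(1/s)] for any norm. Being a sum over the coordinates, it makes [expweight] a
    product of one-variable weights, so that lattice sums and bounds on mixed derivatives factor. *)
Definition weight (k : K) : R := \sum_j rt (k 0 j)%:~R.

Local Notation pw := weight.

Definition expweight (d : R) (k : K) : R := expR (- d * pw k).
Local Notation om := expweight.

Lemma pw_ge0 k : 0 <= pw k.
Proof. by apply: sumr_ge0 => j _; exact: rt_ge0. Qed.

Lemma pw_ge (k : K) j : rt (k 0 j)%:~R <= pw k.
Proof. by rewrite /weight (bigD1 j)//= lerDl sumr_ge0// => i _; exact: rt_ge0. Qed.

Lemma pwN k : pw (- k) = pw k.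
Proof. by apply: eq_bigr => j _; rewrite mxE rmorphN rtN. Qed.

Lemma pwD k l : pw (k + l) <= pw k + pw l.
Proof. by rewrite -big_split ler_sum// => j _; rewrite mxE rmorphD rtD. Qed.

Lemma om_ge0 d k : 0 <= om d k. Proof. exact: expR_ge0. Qed.
Lemma om_gt0 d k : 0 < om d k. Proof. exact: expR_gt0. Qed.

Lemma om_prod d k : om d k = \prod_j expR (- d * rt (k 0 j)%:~R).
Proof. by rewrite /expweight /weight mulr_sumr expR_sum. Qed.

Lemma omD d d' k : om (d + d') k = om d k * om d' k.
Proof. by rewrite /expweight -expRD -mulrDl opprD. Qed.

Lemma om_le d d' k : d' <= d -> om d k <= om d' k.
Proof. by move=> dd; rewrite ler_expR ler_wpM2r ?pw_ge0// lerN2. Qed.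

Lemma om_le1 d k : 0 <= d -> om d k <= 1.
Proof. by move=> d0; rewrite -expR0 ler_expR mulNr oppr_le0 mulr_ge0 ?pw_ge0. Qed.

(** A finite set of lattice points lies in a cube, over which the sum of products is the product of
    the one-dimensional sums. *)
Lemma lattice_sum_bound (d : R) : 0 < d -> exists2 S, 0 < S &
  forall r : seq K, uniq r -> \sum_(k <- r) om d k <= S.
Proof.
move=> d0; have [S S0 hS] := int_sum_bound d0.
exists (S ^+ m) => [|r ur]; first by rewrite exprn_gt0.
pose N := (\max_(k <- r) \max_j `|(k : K) (0%R : 'I_1) j|)%N.
pose g (phi : {ffun 'I_m -> 'I_(2 * N).+1}) : K := \row_j ((phi j)%:Z - N%:Z).
have sub : {subset r <= [seq g phi | phi : {ffun 'I_m -> 'I_(2 * N).+1}]}.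
  move=> k kr; apply/mapP.
  have kN j : (`|(k : K) (0%R : 'I_1) j| <= N)%N.
    rewrite /N (big_rem k)//= leq_max; apply/orP; left.
    by rewrite (bigD1 j)//= leq_maxl.
  exists [ffun j => inord `|((k : K) 0 j + N%:Z)%R|%N]; first by rewrite mem_enum.
  by apply/rowP => j; rewrite mxE ffunE inordK; have := kN j; move: (k 0 j) => z; lia.
apply: le_trans (sub_sum ur sub (om_ge0 d)) _.
rewrite big_map big_enum /=.
rewrite (eq_bigr (fun phi : {ffun 'I_m -> 'I_(2 * N).+1} =>
   \prod_j expR (- d * rt (((phi j)%:Z - N%:Z)%:~R)))); last first.
  by move=> phi _; rewrite om_prod; apply: eq_bigr => j _; rewrite mxE.
rewrite -(bigA_distr_bigA (fun (_ : 'I_m) (i : 'I_(2 * N).+1) => expR (- d * rt ((i%:Z - N%:Z)%:~R)))) /=.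
rewrite prodr_const card_ord; apply: lerXn2r; [|by rewrite nnegrE ltW|exact: hS].
by rewrite nnegrE; apply: sumr_ge0 => i _; exact: expR_ge0.
Qed.

(** Integers that are not the code of a lattice point contribute 0. *)
Definition psum (V : nmodType) (a : K -> V) (N : nat) : V :=
  \sum_(n < N) oapp a 0 (pickle_inv n).

Definition enumK (N : nat) : seq K := pmap pickle_inv (iota 0 N).

Lemma enumK_uniq N : uniq (enumK N).
Proof.
rewrite /enumK; apply: (@pmap_uniq _ _ _ pickle); last exact: iota_uniq.
exact: pickle_invK.
Qed.

Lemma mem_enumK N k : (pickle k < N)%N -> k \in enumK N.
Proof.
move=> kN; rewrite mem_pmap; apply/mapP; exists (pickle k); rewrite ?mem_iota//.
by rewrite pickleK_inv.
Qed.

Lemma psumE (V : nmodType) (a : K -> V) N : psum a N = \sum_(k <- enumK N) a k.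
Proof.
rewrite /psum -(big_mkord xpredT (fun n => oapp a 0 (pickle_inv n))) /index_iota subn0.
rewrite /enumK; elim: (iota 0 N) => [|n r IH]; first by rewrite !big_nil.
by rewrite big_cons IH /=; case: pickle_inv => [k|] /=; rewrite ?big_cons ?add0r.
Qed.

Definition omseries (d : R) : nat -> R := series (fun n => oapp (om d) 0 (@pickle_inv K n)).

Lemma omseriesE d N : omseries d N = psum (om d) N.
Proof. by rewrite /omseries /series /= big_mkord. Qed.

Lemma omseries_nd d : nondecreasing_seq (omseries d).
Proof.
apply/nondecreasing_seqP => n; rewrite /omseries seriesSr lerDl.
by case: pickle_inv => [k|] //=; exact: om_ge0.
Qed.

Lemma omseries_cvg d : 0 < d -> cvgn (omseries d).
Proof.
move=> d0; have [S S0 hS] := lattice_sum_bound d0.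
apply: nondecreasing_is_cvgn; first exact: omseries_nd.
exists S => _ [N _ <-]; rewrite omseriesE psumE; apply: hS; exact: enumK_uniq.
Qed.

(** Tail of the series of weights. It measures the truncation error of every series dominated by
    [om d]; as it is the same for all of them, series can be exchanged with [coef] and with
    functionals. *)
Definition tl (d : R) (N : nat) : R := limn (omseries d) - omseries d N.

Definition tot (d : R) : R := tl d 0.

Lemma tl_ge0 d N : 0 < d -> 0 <= tl d N.
Proof.
move=> d0; rewrite subr_ge0; apply: nondecreasing_cvgn_le; first exact: omseries_nd.
exact: omseries_cvg.
Qed.

Lemma tot_ge0 d : 0 < d -> 0 <= tot d. Proof. exact: tl_ge0. Qed.

Lemma tl_cvg0 d e : 0 < d -> 0 < e -> exists N0, forall N, (N0 <= N)%N -> tl d N <= e.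
Proof.
move=> d0 e0; have /cvgrPdist_le /(_ e e0) [N0 _ h] := omseries_cvg d0.
by exists N0 => N N0N; apply: le_trans (h N N0N); exact: ler_norm.
Qed.

Lemma dominated_series (u v : nat -> R) (D : R) : 0 <= D ->
  (forall n, `|u n| <= D * v n) -> cvgn (series v) ->
  cvgn (series u) /\
  forall N, `|limn (series u) - series u N| <= D * (limn (series v) - series v N).
Proof.
move=> D0 uv cv.
have cDv : cvgn (series (fun n => D * v n)).
  exact: (@is_cvg_seriesZ _ _ D cv).
have cu : cvgn (series u).
  by apply: normed_cvg; apply: series_le_cvg cDv => n //=; apply: le_trans (uv n).
split=> // N.
have nd : nondecreasing_seq (series (fun n => D * v n)).
  apply/nondecreasing_seqP => n; rewrite seriesSr lerDl.
  by apply: le_trans (uv n).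
have part M : (N <= M)%N -> `|series u M - series u N| <= D * (series v M - series v N).
  move=> NM; rewrite !sub_series_geq// mulr_sumr.
  by apply: le_trans (ler_norm_sum _ _ _) _; exact: ler_sum.
have vle M : D * series v M <= D * limn (series v).
  have e P : series (fun n => D * v n) P = D * series v P by rewrite /series /= mulr_sumr.
  have := nondecreasing_cvgn_le nd cDv M; rewrite e.
  rewrite (_ : limn _ = D * limn (series v))//.
  apply/cvg_lim => //; rewrite (_ : series _ = fun P => D * series v P); last exact/funext.
  by apply: cvgM => //; exact: cvg_cst.
rewrite ler_norml; apply/andP; split.
  rewrite lerBrDl; apply: limr_ge => //; exists N => // M NM.
  have := part M NM; rewrite ler_norml => /andP[h _].
  by have := vle M; rewrite !mulrBr in h *; lra.
rewrite lerBlDl; apply: limr_le => //; exists N => // M NM.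
have := part M NM; rewrite ler_norml => /andP[_ h].
by have := vle M; rewrite !mulrBr in h *; lra.
Qed.

(* The lattice is enumerated by its [pickle] codes; [csum a] is meaningful for
   [a] dominated by [om d] with [d > 0], see [csumP]. *)
Definition csum (a : K -> R[i]) : R[i] :=
  limn (series (fun n => oapp (fun k => complex.Re (a k)) 0 (@pickle_inv K n)))
  +i* limn (series (fun n => oapp (fun k => complex.Im (a k)) 0 (@pickle_inv K n))).

Lemma csumP (a : K -> R[i]) d D : 0 < d -> (forall k, cmod (a k) <= D * om d k) ->
  forall N, cmod (csum a - psum a N) <= 2 * D * tl d N.
Proof.
move=> d0 h N; have D0 : 0 <= D.
  by have := le_trans (cmod_ge0 _) (h 0); rewrite pmulr_lge0// om_gt0.
have cv := omseries_cvg d0.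
have hb (g : R[i] -> R) : (forall z, `|g z| <= cmod z) ->
   forall n, `|oapp (fun k => g (a k)) 0 (@pickle_inv K n)| <= D * oapp (om d) 0 (@pickle_inv K n).
  move=> gz n; case: pickle_inv => [k|] /=; last by rewrite normr0 mulr0.
  exact: le_trans (gz _) (h k).
have [_ h1] := dominated_series D0 (hb _ (@Re_le_cmod R)) cv.
have [_ h2] := dominated_series D0 (hb _ (@Im_le_cmod R)) cv.
have pE (g : {additive R[i] -> R}) : g (psum a N) =
    series (fun n => oapp (fun k => g (a k)) 0 (@pickle_inv K n)) N.
  rewrite /series /= big_mkord raddf_sum; apply: eq_bigr => n _.
  by case: pickle_inv => [k|] //=; rewrite raddf0.
have ReE : complex.Re (psum a N) =
    series (fun n => oapp (fun k => complex.Re (a k)) 0 (@pickle_inv K n)) N.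
  rewrite /series /= big_mkord /psum; elim/big_ind2 : _ => // [x1 x2 y1 y2 <- <-|n _].
    by rewrite cReD.
  by case: pickle_inv.
have ImE : complex.Im (psum a N) =
    series (fun n => oapp (fun k => complex.Im (a k)) 0 (@pickle_inv K n)) N.
  rewrite /series /= big_mkord /psum; elim/big_ind2 : _ => // [x1 x2 y1 y2 <- <-|n _].
    by rewrite cImD.
  by case: pickle_inv.
apply: le_trans (cmod_le_ReIm _) _; rewrite cReD cImD cReN cImN ReE ImE.
rewrite -mulrA mulr_natl mulr2n; apply: lerD; [exact: h1|exact: h2].
Qed.

Lemma csum_norm (a : K -> R[i]) d D : 0 < d -> (forall k, cmod (a k) <= D * om d k) ->
  cmod (csum a) <= 2 * D * tot d.
Proof. by move=> d0 h; have := csumP d0 h 0; rewrite /psum big_ord0 subr0. Qed.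

Lemma psumD (a b : K -> R[i]) N : psum (fun k => a k + b k) N = psum a N + psum b N.
Proof. by rewrite !psumE big_split. Qed.

Lemma psumZ c (a : K -> R[i]) N : psum (fun k => c * a k) N = c * psum a N.
Proof. by rewrite !psumE mulr_sumr. Qed.

(** Main tool for identities between series: it suffices that the partial sums approximate [S] at
    the rate of the tail. Linearity of [csum] and its exchange with [coef] and with
    ultradistributions are obtained in this way. *)
Lemma csum_unique (a : K -> R[i]) d D S B : 0 < d -> 0 <= B -> (forall k, cmod (a k) <= D * om d k) ->
  (forall N, cmod (S - psum a N) <= B * tl d N) -> S = csum a.
Proof.
move=> d0 B0 h hS; apply/eqP; rewrite -subr_eq0; apply/eqP.
have D0 : 0 <= D.
  by have := le_trans (cmod_ge0 _) (h 0); rewrite pmulr_lge0// om_gt0.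
apply: (@cmod_eps _ _ (B + 2 * D)); first by rewrite addr_ge0 ?mulr_ge0.
move=> t t0 _; have [N /(_ N (leqnn N)) hN] := tl_cvg0 d0 t0.
apply: le_trans (cmod_triangle (psum a N) _ _) _.
rewrite (cmod_distC (psum a N)) mulrC; apply: le_trans (lerD (hS N) (csumP d0 h N)) _.
by rewrite -mulrDl ler_wpM2l// addr_ge0 ?mulr_ge0.
Qed.

End LatticeSums.

(** * Fourier coefficients of Gevrey functions *)

Section FourierSynthesis.
Variables (R : realType) (s : R) (m : nat).
Hypothesis s1 : 1 < s.
Local Notation K := 'rV[int]_m.
Local Notation om := (expweight s).
Local Notation rt := (sroot s).
Implicit Types (a b : K -> R[i]) (k l : K) (y z : 'rV[R]_m) (f g : 'rV[R]_m -> R[i]).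

(** A negative [d] expresses growth: the coefficients of an ultradistribution satisfy [dec (- d) D]
    for every [d > 0], with [D] depending on [d]. *)
Definition dec (d D : R) a := forall k, cmod (a k) <= D * om d k.

Lemma dec_ge0 d D a : dec d D a -> 0 <= D.
Proof. by move=> h; have := le_trans (cmod_ge0 _) (h 0); rewrite pmulr_lge0// om_gt0. Qed.

Lemma dec_weaken d d' D a : d' <= d -> dec d D a -> dec d' D a.
Proof.
move=> dd h k; apply: le_trans (h k) _; rewrite ler_wpM2l ?(dec_ge0 h)//.
exact: om_le.
Qed.

Lemma decD d D D' a b : dec d D a -> dec d D' b -> dec d (D + D') (fun k => a k + b k).
Proof. by move=> h h' k; rewrite mulrDl; apply: le_trans (cmodD _ _) (lerD (h k) (h' k)). Qed.

Lemma decZ d D c a : dec d D a -> dec d (cmod c * D) (fun k => c * a k).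
Proof. by move=> h k; rewrite cmodM -mulrA ler_wpM2l ?cmod_ge0. Qed.

Lemma csumD d D D' a b : 0 < d -> dec d D a -> dec d D' b ->
  csum (fun k => a k + b k) = csum a + csum b.
Proof.
move=> d0 ha hb; symmetry.
apply: (csum_unique s1 (d := d) (D := D + D') (B := 2 * D + 2 * D') d0).
- by rewrite addr_ge0 ?mulr_ge0 ?(dec_ge0 ha) ?(dec_ge0 hb).
- exact: decD.
move=> N; rewrite psumD opprD addrACA mulrDl; apply: le_trans (cmodD _ _) _.
by apply: lerD; exact: csumP.
Qed.

Lemma csumZ d D c a : 0 < d -> dec d D a -> csum (fun k => c * a k) = c * csum a.
Proof.
move=> d0 ha; symmetry.
apply: (csum_unique s1 (d := d) (D := cmod c * D) (B := cmod c * (2 * D)) d0).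
- by rewrite !mulr_ge0 ?cmod_ge0 ?(dec_ge0 ha).
- exact: decZ.
move=> N; rewrite psumZ -mulrBr cmodM -[leRHS]mulrA ler_wpM2l ?cmod_ge0//.
exact: csumP.
Qed.

Definition Fsum a y := csum (fun k => a k * ek k y).

Lemma dec_ek d D a y : dec d D a -> dec d D (fun k => a k * ek k y).
Proof. by move=> h k; rewrite cmodM cmod_ek mulr1. Qed.

Lemma Fsum_norm d D a y : 0 < d -> dec d D a -> cmod (Fsum a y) <= 2 * D * tot s m d.
Proof. by move=> d0 h; apply: csum_norm => //; exact: dec_ek. Qed.

Lemma intr_om d : 0 < d -> forall k j,
  `|(k 0 j)%:~R| * om d k <= (s / (d / 2)) `^ s * om (d / 2) k.
Proof.
move=> d0 k j; rewrite {1}(splitr d) omD mulrA ler_wpM2r ?om_ge0//.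
have d20 : 0 < d / 2 by rewrite divr_gt0.
apply: le_trans (rt_absorb s1 (k 0 j)%:~R d20).
by rewrite ler_wpM2l// ler_expR ler_wnM2l ?oppr_le0 ?(ltW d20)// pw_ge.
Qed.

Lemma l1_om d : 0 < d -> forall k,
  l1 R k * om d k <= m%:R * (s / (d / 2)) `^ s * om (d / 2) k.
Proof.
move=> d0 k; rewrite /l1 mulr_suml.
apply: (@le_trans _ _ (\sum_(j < m) ((s / (d / 2)) `^ s * om (d / 2) k))).
  by apply: ler_sum => j _; exact: intr_om.
by rewrite sumr_const card_ord -[leLHS]mulr_natl mulrA.
Qed.

Lemma dec_deriv d D a j : 0 < d -> dec d D a ->
  dec (d / 2) (D * (s / (d / 2)) `^ s) (fun k => (k 0 j)%:~R%:C * 'i * a k).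
Proof.
move=> d0 h k; rewrite !cmodM cmodi mulr1 cmodR mulrC.
have D0 := dec_ge0 h.
apply: (@le_trans _ _ (D * (`|(k 0 j)%:~R| * om d k))).
  by rewrite mulrCA mulrC ler_wpM2l.
by rewrite -mulrA ler_wpM2l// intr_om.
Qed.

Lemma BL_Fsum d D a : 0 < d -> dec d D a -> BL (Fsum a).
Proof.
move=> d0 h; have D0 := dec_ge0 h; have d20 : 0 < d / 2 by rewrite divr_gt0.
pose C := m%:R * (s / (d / 2)) `^ s.
apply: (@BLP _ _ _ (2 * D * tot s m d) (2 * (2 * D * C) * tot s m (d / 2))) => [y|y z].
  exact: Fsum_norm.
have -> : Fsum a y - Fsum a z = csum (fun k => a k * ek k y + -1 * (a k * ek k z)).
  rewrite (csumD d0 (dec_ek y h) (decZ (-1) (dec_ek z h))).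
  by rewrite (csumZ (-1) d0 (dec_ek z h)) mulN1r.
rewrite [leRHS](_ : _ = 2 * (2 * D * C * `|y - z|) * tot s m (d / 2)); last by ring.
apply: csum_norm => // k; rewrite mulN1r -mulrBr cmodM.
apply: (@le_trans _ _ (D * om d k * (2 * l1 R k * `|y - z|))).
  by rewrite ler_pM ?cmod_ge0 ?ek_lip.
rewrite (_ : D * om d k * _ = 2 * D * `|y - z| * (l1 R k * om d k)); last by ring.
rewrite (_ : 2 * D * C * _ * _ = 2 * D * `|y - z| * (C * om (d / 2) k)); last by ring.
by rewrite ler_wpM2l ?mulr_ge0// l1_om.
Qed.

Lemma periodic_Fsum a : periodic (Fsum a).
Proof. by move=> j y; congr csum; apply/funext => k; rewrite periodic_ek. Qed.

Lemma psum_coef a l N :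
  coef (fun y => psum (fun k => a k * ek k y) N) l = if l \in enumK m N then a l else 0.
Proof.
rewrite (_ : (fun y => _) = fun y => \sum_(k <- enumK m N) a k * ek k y); last first.
  by apply/funext => y; rewrite psumE.
rewrite coef_sum; last by move=> k; apply: BLZ; exact: BL_ek.
rewrite (eq_bigr (fun k => if k == l then a k else 0)); last first.
  by move=> k _; rewrite coefZ ?coef_ek; [case: eqP; rewrite ?mulr1 ?mulr0|exact: BL_ek].
rewrite -big_mkcond /=; case: ifP => lN.
  by rewrite -big_filter filter_pred1_uniq ?enumK_uniq// big_seq1.
rewrite big_seq_cond big1// => k /andP[kN /eqP kl].
by rewrite -kl kN in lN.
Qed.

Lemma coef_Fsum d D a l : 0 < d -> dec d D a -> coef (Fsum a) l = a l.
Proof.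
move=> d0 h; have D0 := dec_ge0 h; apply/eqP; rewrite -subr_eq0; apply/eqP.
apply: (@cmod_eps _ _ (2 ^+ m * (2 * D))); first by rewrite !mulr_ge0 ?exprn_ge0.
move=> t t0 _; have [N0 hN] := tl_cvg0 s1 m d0 t0.
(* [N] is large enough for the tail to be below [t] and for the code of [l] to be below [N]. *)
pose N := maxn N0 (pickle l).+1.
have := psum_coef a l N; rewrite mem_enumK ?leq_max ?ltnSn ?orbT// => <-.
have BLp : BL (fun y => psum (fun k => a k * ek k y) N).
  rewrite (_ : (fun y => _) = fun y => \sum_(k <- enumK m N) a k * ek k y).
    by apply: BL_sum => k; apply: BLZ; exact: BL_ek.
  by apply/funext => y; rewrite psumE.
rewrite -coefB//; last exact: BL_Fsum d0 h.
apply: (@le_trans _ _ (2 ^+ m * (2 * D * tl s m d N))).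
  apply: coef_norm => [|y]; first by apply: BLB => //; exact: BL_Fsum d0 h.
  by apply: csumP => //; exact: dec_ek.
rewrite mulrA [leRHS]mulrC ler_wpM2l ?mulr_ge0 ?exprn_ge0//.
by apply: hN; rewrite leq_maxl.
Qed.

Theorem fourier_inversion d D f : 0 < d -> BL f -> periodic f -> dec d D (coef f) ->
  f = Fsum (coef f).
Proof.
move=> d0 hf pf h.
have BF := BL_Fsum d0 h.
have e : (fun y => f y - Fsum (coef f) y) = fun=> 0.
  apply: fourier_uniqueness; first exact: BLB.
    by move=> j y; rewrite pf periodic_Fsum.
  by move=> k; rewrite coefB// (coef_Fsum k d0 h) subrr.
apply/funext => y; apply/eqP; rewrite -subr_eq0; apply/eqP.
exact: (congr1 (fun g => g y) e).
Qed.

Lemma derivable_of_taylor (g : 'rV[R]_m -> R) y v (L C : R) :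
  (forall t, `|g (y + t *: v) - g y - t * L| <= C * t ^+ 2) ->
  derivable g y v /\ 'D_v g y = L.
Proof.
move=> h.
have cv : (fun t => t^-1 *: ((g \o shift y) (t *: v) - g y)) @ 0^' --> (L : R^o).
  apply/cvgrPdist_le => e e0.
  have C1 : 0 < `|C| + 1 by rewrite ltr_wpDl.
  near=> t.
  have t0 : t != 0 by near: t; exact: nbhs_dnbhs_neq.
  have tn : 0 < `|t| by rewrite normr_gt0.
  have te : `|t| <= e / (`|C| + 1).
    near: t; apply: nbhs_dnbhs.
    apply/nbhs_ballP; exists (e / (`|C| + 1)) => [|t]; first by rewrite /= divr_gt0.
    by rewrite /ball/= sub0r normrN => /ltW.
  rewrite /= (addrC (t *: v)) -[_ *: _]/(t^-1 * _).
  have -> : L - t^-1 * (g (y + t *: v) - g y) = - t^-1 * (g (y + t *: v) - g y - t * L).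
    by field.
  rewrite normrM normrN normfV mulrC ler_pdivrMr//; apply: le_trans (h t) _.
  rewrite -(real_normK (num_real t)) expr2 mulrA ler_wpM2r//.
  move: te; rewrite ler_pdivlMr// => te; apply: le_trans te; rewrite mulrC ler_wpM2l//.
  by rewrite (le_trans (ler_norm C))// lerDl.
split; first by apply/cvg_ex; exists L.
exact: cvg_lim.
Unshelve. all: by end_near. Qed.

(** The remainder of each term is quadratic in the frequency; each of the two factors costs half of
    the available rate, whence [d / 2 / 2]. *)
Lemma Fsum_taylor d D a j y (t : R) : 0 < d -> dec d D a ->
  cmod (Fsum a (y + t *: basis_vec R j) - Fsum a y
        - t%:C * Fsum (fun k => (k 0 j)%:~R%:C * 'i * a k) y)
  <= 2 * (2 * (D * (s / (d / 2)) `^ s * (s / (d / 2 / 2)) `^ s)) * tot s m (d / 2 / 2) * t ^+ 2.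
Proof.
move=> d0 h; have D0 := dec_ge0 h.
have d20 : 0 < d / 2 by rewrite divr_gt0.
have d40 : 0 < d / 2 / 2 by rewrite divr_gt0.
have hw : dec (d / 2) D a by apply: dec_weaken h; lra.
have hy := dec_ek y hw; have hz := dec_ek (y + t *: basis_vec R j) hw.
have hd := dec_ek y (dec_deriv j d0 h).
rewrite [Fsum]/Fsum; set S := (X in cmod X <= _).
have -> : S = csum (fun k => a k * (ek k (y + t *: basis_vec R j) - ek k y
     - (t * (k 0 j)%:~R)%:C * 'i * ek k y)).
  have e3 (u v w : R[i]) : u - v - w = u + -1 * v + -1 * w by ring.
  rewrite /S -(csumZ _ d20 hd) e3.
  rewrite -(csumZ (-1) d20 hy) -(csumZ (-1) d20 (decZ _ hd)).
  rewrite -(csumD d20 hz (decZ _ hy)) -(csumD d20 (decD hz (decZ _ hy)) (decZ _ (decZ _ hd))).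
  by congr csum; apply/funext => k; rewrite rmorphM /=; ring.
rewrite [leRHS](_ : _ = 2 * (2 * (D * (s / (d / 2)) `^ s * (s / (d / 2 / 2)) `^ s) * t ^+ 2) * tot s m (d / 2 / 2)); last by ring.
apply: csum_norm => // k.
have -> : ek k (y + t *: basis_vec R j) - ek k y - (t * (k 0 j)%:~R)%:C * 'i * ek k y =
   (cis ((k 0 j)%:~R * t) - 1 - ((k 0 j)%:~R * t)%:C * 'i) * ek k y.
  by rewrite ek_translate (mulrC t); ring.
rewrite !cmodM cmod_ek mulr1.
apply: (@le_trans _ _ (D * om d k * (2 * ((k 0 j)%:~R * t) ^+ 2))).
  by rewrite ler_pM ?cmod_ge0 ?cis_taylor.
have e1 := intr_om d0 k j; have e2 := intr_om d20 k j.
have P0 : 0 <= (s / (d / 2)) `^ s by exact: powR_ge0.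
have e3 : `|(k 0 j)%:~R| ^+ 2 * om d k <= (s / (d / 2)) `^ s * ((s / (d / 2 / 2)) `^ s * om (d / 2 / 2) k).
  rewrite expr2 -mulrA; apply: (@le_trans _ _ (`|(k 0 j)%:~R| * ((s / (d / 2)) `^ s * om (d / 2) k))).
    by rewrite ler_wpM2l.
  by rewrite mulrCA ler_wpM2l.
rewrite exprMn -(real_normK (num_real ((k 0 j)%:~R))).
rewrite (_ : D * om d k * _ = 2 * D * t ^+ 2 * (`|(k 0 j)%:~R| ^+ 2 * om d k)); last by ring.
rewrite [leRHS](_ : _ = 2 * D * t ^+ 2 * ((s / (d / 2)) `^ s * ((s / (d / 2 / 2)) `^ s * om (d / 2 / 2) k))); last by ring.
by apply: ler_wpM2l => //; apply: mulr_ge0; [apply: mulr_ge0|exact: sqr_ge0].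
Qed.

Lemma partial_Fsum d D a j : 0 < d -> dec d D a ->
  has_partial j (Fsum a) /\
  partial j (Fsum a) = Fsum (fun k => (k 0 j)%:~R%:C * 'i * a k).
Proof.
move=> d0 h.
set L := Fsum (fun k : K => (k 0 j)%:~R%:C * 'i * a k); set C := 2 * (2 * (D * (s / (d / 2)) `^ s * (s / (d / 2 / 2)) `^ s)) * tot s m (d / 2 / 2).
have hR y : derivable (fun z => complex.Re (Fsum a z)) y (basis_vec R j) /\
    'D_(basis_vec R j) (fun z => complex.Re (Fsum a z)) y = complex.Re (L y).
  apply: (@derivable_of_taylor _ _ _ _ C) => t.
  apply: le_trans (Fsum_taylor j y t d0 h).
  have := Re_le_cmod (Fsum a (y + t *: basis_vec R j) - Fsum a y - t%:C * L y).
  by rewrite !ReIm mul0r subr0.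
have hI y : derivable (fun z => complex.Im (Fsum a z)) y (basis_vec R j) /\
    'D_(basis_vec R j) (fun z => complex.Im (Fsum a z)) y = complex.Im (L y).
  apply: (@derivable_of_taylor _ _ _ _ C) => t.
  apply: le_trans (Fsum_taylor j y t d0 h).
  have := Im_le_cmod (Fsum a (y + t *: basis_vec R j) - Fsum a y - t%:C * L y).
  by rewrite !ReIm mul0r addr0.
split; first by move=> y; split; [exact: (hR y).1|exact: (hI y).1].
by apply/funext => y; rewrite /partial (hR y).2 (hI y).2; case: (L y).
Qed.

Lemma foldr_partial_Fsum (w : seq 'I_m) d D a : 0 < d -> dec d D a ->
  (exists d' D', 0 < d' /\ dec d' D' (fun k => (\prod_(j <- w) ((k 0 j)%:~R%:C * 'i)) * a k)) /\
  foldr (@partial R m) (Fsum a) w = Fsum (fun k => (\prod_(j <- w) ((k 0 j)%:~R%:C * 'i)) * a k).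
Proof.
move=> d0 h; elim: w => [|j w [[d' [D' [d'0 h']]] IH]].
  rewrite /= (_ : (fun k => _ * a k) = a); first by split => //; exists d, D.
  by apply/funext => k; rewrite big_nil mul1r.
have -> : (fun k => (\prod_(i <- j :: w) ((k 0 i)%:~R%:C * 'i)) * a k) =
    fun k => (k 0 j)%:~R%:C * 'i * ((\prod_(i <- w) ((k 0 i)%:~R%:C * 'i)) * a k).
  by apply/funext => k; rewrite big_cons mulrA.
split; last by rewrite /= IH; exact: (partial_Fsum j d'0 h').2.
by exists (d' / 2), (D' * (s / (d' / 2)) `^ s); split; [rewrite divr_gt0|exact: dec_deriv].
Qed.

Lemma smooth_Fsum d D a : 0 < d -> dec d D a -> smooth (Fsum a).
Proof.
move=> d0 h w; have [[d' [D' [d'0 h']]] ->] := foldr_partial_Fsum w d0 h.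
split; first by apply: BL_ccontinuous; exact: BL_Fsum d'0 h'.
by move=> k; have [] := partial_Fsum k d'0 h'.
Qed.

Definition word_of (al : 'I_m -> nat) (r : seq 'I_m) : seq 'I_m :=
  flatten [seq nseq (al j) j | j <- r].

Lemma mpartial_word al f : mpartial al f = foldr (@partial R m) f (word_of al (enum 'I_m)).
Proof.
rewrite /mpartial /word_of; elim: (enum 'I_m) => //= j r ->.
by rewrite foldr_cat; elim: (al j) => //= n ->.
Qed.

Lemma mpartial_Fsum al d D a : 0 < d -> dec d D a ->
  mpartial al (Fsum a) = Fsum (fun k => (\prod_j ((k 0 j)%:~R%:C * 'i) ^+ al j) * a k).
Proof.
move=> d0 h; rewrite mpartial_word (foldr_partial_Fsum _ d0 h).2.
congr Fsum; apply/funext => k; congr (_ * _).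
rewrite /word_of big_flatten big_map /= big_enum /=; apply: eq_bigr => j _.
by elim: (al j) => [|n IH] /=; rewrite ?big_nil ?expr0// big_cons IH exprS.
Qed.

(** Half of the decay absorbs the powers of the frequencies, coordinate by coordinate, and yields
    [(al!)^s]; the other half sums the series. *)
Lemma mpartial_Fsum_norm al d D a y : 0 < d -> dec d D a ->
  cmod (mpartial al (Fsum a) y) <=
  2 * D * tot s m (d / 2) * ((s / (d / 2)) `^ s) ^+ mlength al * ((mfact al)%:R `^ s).
Proof.
move=> d0 h; have D0 := dec_ge0 h; have d20 : 0 < d / 2 by rewrite divr_gt0.
rewrite (mpartial_Fsum al d0 h).
rewrite [leRHS](_ : _ = 2 * (D * (((s / (d / 2)) `^ s) ^+ mlength al * ((mfact al)%:R `^ s))) * tot s m (d / 2)); last by ring.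
apply: Fsum_norm => // k; rewrite cmodM cmod_prod mulrC.
apply: (@le_trans _ _ (D * om d k * \prod_j (`|(k 0 j)%:~R| ^+ al j))).
  apply: ler_pM; rewrite ?cmod_ge0//; first by apply: prodr_ge0 => j _; exact: cmod_ge0.
  by apply: ler_prod => j _; rewrite cmod_ge0 /= cmodX cmodM cmodi mulr1 cmodR.
rewrite {1}(splitr d) omD.
rewrite (_ : D * _ * _ = D * (om (d / 2) k * \prod_j (`|(k 0 j)%:~R| ^+ al j)) * om (d / 2) k); last by ring.
rewrite ler_wpM2r ?om_ge0// ler_wpM2l// om_prod -big_split /=.
have -> : ((s / (d / 2)) `^ s) ^+ mlength al * (mfact al)%:R `^ s =
    \prod_(j < m) (((s / (d / 2)) `^ s) ^+ al j * (al j)`!%:R `^ s).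
  rewrite big_split /= prodrXr /mlength; congr (_ * _); rewrite /mfact.
  elim/big_ind2 : _ => [|x1 x2 y1 y2|//]; first by rewrite powR1.
  by move=> <- <-; rewrite natrM powRM.
apply: ler_prod => j _; rewrite mulr_ge0 ?expR_ge0 ?exprn_ge0//= mulrC.
exact: weight_absorb.
Qed.

Lemma gevrey_norm_le (h : R) f (B : R) : 0 < h ->
  (forall al y, cmod (mpartial al f y) <= B * h ^+ mlength al * (mfact al)%:R `^ s) ->
  (gevrey_norm s h f <= B%:E)%E.
Proof.
move=> h0 hB; apply: ub_ereal_sup => _ [al [y ->]]; rewrite lee_fin.
have F0 : 0 < (mfact al)%:R `^ s :> R.
  by rewrite powR_gt0// ltr0n /mfact prodn_gt0// => j; exact: fact_gt0.
rewrite ler_pdivrMr// ler_pdivrMr ?exprn_gt0//.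
by rewrite (mulrAC B); exact: hB.
Qed.

Lemma gevrey_step_Fsum d D a : 0 < d -> dec d D a ->
  gevrey_step s ((s / (d / 2)) `^ s) (Fsum a) /\
  (gevrey_norm s ((s / (d / 2)) `^ s) (Fsum a) <= (2 * D * tot s m (d / 2))%:E)%E.
Proof.
move=> d0 h.
have s0 : 0 < s by exact: lt_trans s1.
have n : (gevrey_norm s ((s / (d / 2)) `^ s) (Fsum a) <= (2 * D * tot s m (d / 2))%:E)%E.
  apply: gevrey_norm_le; first by rewrite powR_gt0// !divr_gt0.
  by move=> al y; exact: mpartial_Fsum_norm.
split=> //; split; [exact: periodic_Fsum|exact: smooth_Fsum d0 h|].
by apply: le_lt_trans n _; rewrite ltey.
Qed.

Lemma gevrey_Fsum d D a : 0 < d -> dec d D a -> gevrey s (Fsum a).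
Proof.
move=> d0 h; exists ((s / (d / 2)) `^ s); last by have [] := gevrey_step_Fsum d0 h.
by rewrite powR_gt0// !divr_gt0// (lt_trans _ s1).
Qed.

Lemma gevrey_of_coef d D f : 0 < d -> BL f -> periodic f -> dec d D (coef f) -> gevrey s f.
Proof.
by move=> d0 hf pf h; rewrite (fourier_inversion d0 hf pf h); exact: gevrey_Fsum d0 h.
Qed.

End FourierSynthesis.

(** * Decay of the Fourier coefficients of a Gevrey function *)

Section FourierAnalysis.
Variables (R : realType) (m : nat).
Local Notation K := 'rV[int]_m.
Implicit Types (k l : K) (y z : 'rV[R]_m) (f g : 'rV[R]_m -> R[i]).

Lemma line_is_derive (g : 'rV[R]_m -> R) y j x :
  derivable g (set_coord y j x) (basis_vec R j) ->
  is_derive x 1 (fun x => g (set_coord y j x)) ('D_(basis_vec R j) g (set_coord y j x)).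
Proof.
have e : (fun h => h^-1 *: (((fun x => g (set_coord y j x)) \o shift x) (h *: 1) - g (set_coord y j x))) =
   (fun h => h^-1 *: ((g \o shift (set_coord y j x)) (h *: basis_vec R j) - g (set_coord y j x))).
  apply/funext => h; congr (_ *: (_ - _)); rewrite /= addrC set_coord_add addrC.
  by rewrite -[h *: 1]/(h * 1) mulr1.
move=> d; split; first by rewrite /derivable e.
by rewrite /derive e.
Qed.

Lemma has_partial_cder f j y x : has_partial j f ->
  cder (fun x => f (set_coord y j x)) x (partial j f (set_coord y j x)).
Proof.
move=> h; have [hR hI] := h (set_coord y j x).
by split; [exact: (line_is_derive hR)|exact: (line_is_derive hI)].
Qed.

Lemma partial_step f j (B : R) y x : has_partial j f -> (forall y, cmod (partial j f y) <= B) ->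
  cmod (f (set_coord y j x) - f y) <= 2 * B * `|x - y 0 j|.
Proof.
move=> hp hB; rewrite -{2}(set_coord_id y j).
wlog xy : x y / y 0 j <= x.
  move=> H; case/orP: (le_total (y 0 j) x) => xy; first exact: H.
  have := H (y 0 j) (set_coord y j x).
  by rewrite !set_coordE eqxx !set_coord_set (cmod_distC (f _)) distrC; apply.
rewrite ger0_norm ?subr_ge0//.
apply: (@cder_lip _ (fun x => f (set_coord y j x)) (fun x => partial j f (set_coord y j x))) => //.
by move=> t _; exact: has_partial_cder.
Qed.

(** The points [y] and [z] are joined by segments parallel to the axes: [mix r] replaces the
    coordinates of [y] listed in [r] by those of [z], one at a time. *)
Lemma BL_of_partials f (M B : R) : (forall j, has_partial j f) ->
  (forall y, cmod (f y) <= M) -> (forall j y, cmod (partial j f y) <= B) -> BL f.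
Proof.
move=> hp hM hB; apply: (@BLP _ _ _ M (2 * B * m%:R)) => // y z.
pose mix (r : seq 'I_m) := foldr (fun j v => set_coord v j (z 0 j)) y r.
have mixE r i : mix r 0 i = if i \in r then z 0 i else y 0 i.
  elim: r => //= j r IH; rewrite set_coordE inE; case: eqP => [->//|_] /=.
  exact: IH.
have key r : uniq r -> cmod (f (mix r) - f y) <= 2 * B * (size r)%:R * `|y - z|.
  elim: r => [|j r IH] /=; first by rewrite subrr cmod0 mulr0 mul0r.
  move=> /andP[jr ur]; apply: le_trans (cmod_triangle (f (mix r)) _ _) _.
  have e : (size r).+1%:R = (size r)%:R + 1 :> R by rewrite natr1.
  rewrite e mulrDr mulr1 mulrDl addrC; apply: lerD; first exact: IH.
  apply: le_trans (partial_step _ _ (hp j) (hB j)) _.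
  rewrite mixE (negbTE jr); apply: ler_wpM2l.
    by rewrite mulr_ge0// (le_trans (cmod_ge0 _) (hB j 0)).
  by rewrite distrC; have := le_norm_rV (y - z) j; rewrite !mxE.
have := key _ (enum_uniq 'I_m); rewrite size_enum_ord.
have -> : mix (enum 'I_m) = z by apply/rowP => i; rewrite mixE mem_enum.
by rewrite cmod_distC.
Qed.

Lemma periodic_partial f j : periodic f -> periodic (partial j f).
Proof.
move=> pf i y; rewrite /partial /derive.
have e (g : R[i] -> R) : (fun h : R => h^-1 *: (((fun z => g (f z)) \o shift (y + (2 * pi) *: basis_vec R i))
      (h *: basis_vec R j) - g (f (y + (2 * pi) *: basis_vec R i)))) =
   (fun h : R => h^-1 *: (((fun z => g (f z)) \o shift y) (h *: basis_vec R j) - g (f y))).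
  by apply/funext => h; rewrite /= addrA !pf.
by rewrite !e.
Qed.

Lemma periodic_int f (k : int) j y : periodic f ->
  f (y + (k%:~R * (2 * pi)) *: basis_vec R j) = f y.
Proof.
move=> pf.
have pn (n : nat) z : f (z + (n%:R * (2 * pi)) *: basis_vec R j) = f z.
  elim: n z => [|n IH] z; first by rewrite mul0r scale0r addr0.
  by rewrite -natr1 mulrDl mul1r scalerDl addrA pf IH.
case: k => n; first exact: pn.
by rewrite NegzE mulrNz mulNr -(pn n.+1) scaleNr addrNK.
Qed.

Lemma periodic_bounded f : ccontinuous f -> periodic f ->
  exists M, forall y, cmod (f y) <= M.
Proof.
move=> [cR cI] pf.
pose A := [set v : 'rV[R]_m | forall i, `[0, 2 * pi]%classic (v ord0 i)].
have cA : compact A by apply: (@rV_compact R m (fun=> `[0, 2 * pi]%classic)) => i; exact: segment_compact.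
have A0 : A !=set0.
  by exists 0 => i; rewrite /= mxE in_itv/= lexx ltW ?pi2_gt0.
have bnd (g : 'rV[R]_m -> R) : continuous g -> exists M, forall y, A y -> g y <= M.
  move=> cg; have [c _ hc] := EVT_max_rV A0 cA (continuous_subspaceT cg).
  by exists (g c) => y Ay; apply: hc; rewrite inE.
have cN (g : 'rV[R]_m -> R) : continuous g -> continuous (fun y => - g y).
  by move=> cg y; exact: (cvgN (cg y)).
have [M1 h1] := bnd _ cR; have [M2 h2] := bnd _ (cN _ cR).
have [M3 h3] := bnd _ cI; have [M4 h4] := bnd _ (cN _ cI).
exists (Num.max M1 M2 + Num.max M3 M4) => y.
have [z Az ->] : exists2 z, A z & f y = f z.
  have step (r : seq 'I_m) : exists2 z : 'rV[R]_m, (forall i, i \in r -> 0 <= z 0 i <= 2 * pi) & f y = f z.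
    elim: r => [|j r [z hz ->]]; first by exists y.
    pose q := Num.floor (z 0 j / (2 * pi)).
    exists (z + ((- q)%:~R * (2 * pi)) *: basis_vec R j); last by rewrite periodic_int.
    move=> i; rewrite inE add_basisE; case: eqP => [-> _|_ /= /hz]; last by rewrite addr0.
    have /andP[] := floor_itv (z 0 j / (2 * pi)).
    rewrite -/q ler_pdivlMr ?pi2_gt0// ltr_pdivrMr ?pi2_gt0// rmorphD rmorphN /=.
    by move=> ? ?; apply/andP; split; lra.
  have [z hz e] := step (enum 'I_m); exists z => // i.
  by rewrite /= in_itv /=; apply: hz; rewrite mem_enum.
apply: le_trans (cmod_le_ReIm _) _; apply: lerD; rewrite le_max.
  by case: (ger0P (complex.Re (f z))) => _; rewrite ?h1 ?h2 ?orbT.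
by case: (ger0P (complex.Im (f z))) => _; rewrite ?h3 ?h4 ?orbT.
Qed.

Lemma smooth_partial f j : smooth f -> smooth (partial j f).
Proof. by move=> h w; have := h (rcons w j); rewrite foldr_rcons. Qed.

Lemma smooth_periodic_BL f : smooth f -> periodic f -> BL f.
Proof.
move=> hs pf.
have [M hM] := periodic_bounded (hs [::]).1 pf.
have bp j : exists B, forall y, cmod (partial j f y) <= B.
  apply: periodic_bounded; last exact: periodic_partial.
  exact: (hs [:: j]).1.
have [B hB] : exists B, forall j y, cmod (partial j f y) <= B.
  have [b hb] := choice bp; exists (\big[Num.max/0]_j b j) => j y.
  by apply: le_trans (hb j y) _; exact: le_bigmax.
by apply: BL_of_partials hM hB => j; exact: (hs [::]).2.
Qed.

Lemma iter_partial f j r : smooth f -> periodic f ->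
  smooth (iter r (partial j) f) /\ periodic (iter r (partial j) f).
Proof.
move=> hs pf; elim: r => [//|r [IHs IHp]] /=.
by split; [exact: smooth_partial|exact: periodic_partial].
Qed.

(* Differentiating under [coef] is avoided: the difference quotient of a
   translate has coefficient [(cis (k_j t) - 1) / t * coef f k]. *)
Lemma coef_partial f j k : BL f -> periodic f -> has_partial j f -> BL (partial j f) ->
  coef (partial j f) k = (k 0 j)%:~R%:C * 'i * coef f k.
Proof.
move=> hf pf hp hd; have [M hM hL] := hd.
have M0 : 0 <= M by apply: le_trans (hM 0); exact: cmod_ge0.
apply/eqP; rewrite -subr_eq0; apply/eqP.
set X := _ - _.
apply: (@cmod_eps _ _ (2 ^+ m * (2 * M) + 2 * (k 0 j)%:~R ^+ 2 * cmod (coef f k))).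
  apply: addr_ge0; apply: mulr_ge0; rewrite ?exprn_ge0 ?cmod_ge0//; first exact: mulr_ge0.
  by apply: mulr_ge0 => //; exact: sqr_ge0.
move=> t t0 _.
pose q y := f (y + t *: basis_vec R j) + -1 * f y + (- t%:C) * partial j f y.
have Bq1 := BL_translate (t *: basis_vec R j) hf.
have Bq : BL q by apply: BLD; [apply: BLD => //; exact: BLZ|exact: BLZ].
(* [M] is also a Lipschitz constant of the partial derivative, so the derivative of [F] below is at
   most [M * t] on [[0, t]]. *)
have qn y : cmod (q y) <= 2 * (M * t) * t.
  pose F x := f (set_coord y j (x + y 0 j)) + (- (x%:C * partial j f y)).
  have e : q y = F t - F 0.
    by rewrite /F /q !(addrC _ (y 0 j)) !set_coord_add set_coord_id scale0r addr0; ring.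
  rewrite e -{3}(subr0 t).
  apply: (@cder_lip _ F (fun x => partial j f (set_coord y j (x + y 0 j)) + - partial j f y)).
  - exact: ltW.
  - move=> x _; apply: cderD.
      apply: (@cder_periodic _ (fun x => f (set_coord y j x))).
      exact: has_partial_cder.
    have := cderZ (- partial j f y) (cder_id x); rewrite mulr1.
    by congr cder; apply/funext => u; rewrite mulNr mulrC.
  move=> x /andP[x0 xt]; apply: le_trans (hL _ _) _; rewrite ler_wpM2l//.
  have -> : set_coord y j (x + y 0 j) - y = set_coord y j (x + y 0 j) - set_coord y j (y 0 j).
    by rewrite set_coord_id.
  apply: le_trans (set_coord_lip1 _ _ _ _) _.
  by rewrite addrK ger0_norm.
have cq : coef q k = cis ((k 0 j)%:~R * t) * coef f k - coef f k - t%:C * coef (partial j f) k.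
  rewrite /q !coefD ?coefZ ?coef_translate//; try exact: BLZ; last first.
    by apply: BLD => //; exact: BLZ.
  by ring.
have eX : t%:C * X = (cis ((k 0 j)%:~R * t) - 1 - ((k 0 j)%:~R * t)%:C * 'i) * coef f k - coef q k.
  by rewrite cq /X rmorphM /=; ring.
rewrite -(ler_pM2l t0).
have -> : t * cmod X = cmod (t%:C * X) by rewrite cmodM cmodR gtr0_norm.
rewrite eX; apply: le_trans (cmodB _ _) _.
apply: (@le_trans _ _ (2 * ((k 0 j)%:~R * t) ^+ 2 * cmod (coef f k) + 2 ^+ m * (2 * (M * t) * t))).
  apply: lerD; last exact: coef_norm.
  by rewrite cmodM ler_wpM2r ?cmod_ge0 ?cis_taylor.
by rewrite le_eqVlt; apply/orP; left; apply/eqP; ring.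
Qed.

Lemma coef_iter_partial f j k r : smooth f -> periodic f ->
  cmod (coef (iter r (partial j) f) k) = `|(k 0 j)%:~R| ^+ r * cmod (coef f k).
Proof.
move=> hs pf; elim: r => [|r IH]; first by rewrite expr0 mul1r.
have [hs' pf'] := iter_partial j r hs pf; rewrite /= coef_partial//.
- by rewrite [LHS]cmodM cmodM cmodi mulr1 cmodR IH exprS mulrA.
- exact: smooth_periodic_BL.
- exact: (hs' [::]).2.
- by apply: smooth_periodic_BL; [exact: smooth_partial|exact: periodic_partial].
Qed.

Variable s : R.
Hypothesis s1 : 1 < s.
Local Notation rt := (sroot s).

(** Some coordinate carries at least the share [1 / (m + 1)] of the weight, unless the weight is
    zero, in which case [a <= X] is enough. The denominator [m.+1] covers [m = 0] as well. *)
Lemma dec_of_coords (a X c : R) k : 0 < c -> 0 <= X -> a <= X ->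
  (forall j, a <= X * expR (- c * rt (k 0 j)%:~R)) ->
  a <= X * expweight s (c / m.+1%:R) k.
Proof.
move=> c0 X0 aX h.
have [/existsP[j hj]|/existsPn hn] := boolP [exists j, weight s k <= m.+1%:R * rt (k 0 j)%:~R].
  apply: le_trans (h j) _; rewrite ler_wpM2l// ler_expR !mulNr lerN2.
  by rewrite mulrAC -mulrA mulrC ler_wpM2l ?(ltW c0)// mulrC ler_pdivrMl ?ltr0n || rewrite -mulrA ler_wpM2l ?(ltW c0)// ler_pdivrMl ?ltr0n.
have p0 : weight s k <= 0.
  have : m.+1%:R * weight s k <= m%:R * weight s k.
    rewrite /weight mulr_sumr -/(weight s k); apply: (@le_trans _ _ (\sum_(j < m) weight s k)).
      by apply: ler_sum => j _; have := hn j; rewrite -ltNge => /ltW.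
    by rewrite sumr_const card_ord mulr_natl.
  by rewrite -natr1 mulrDl mul1r; lra.
by rewrite /expweight (_ : weight s k = 0) ?mulr0 ?expR0 ?mulr1//; apply/eqP; rewrite eq_le p0 pw_ge0.
Qed.

Lemma mpartial_single f j r : mpartial (fun i => if i == j then r else 0%N) f = iter r (partial j) f.
Proof.
rewrite /mpartial.
have key (e : seq 'I_m) : uniq e ->
  foldr (fun (i : 'I_m) g => iter (if i == j then r else 0%N) (partial i) g) f e =
  if j \in e then iter r (partial j) f else f.
  elim: e => //= i e IH /andP[ie ue]; rewrite IH// inE.
  case: (eqVneq i j) => [ij|//] /=.
    by rewrite -ij (negbTE ie).
by rewrite key ?enum_uniq// mem_enum.
Qed.

(** Constant and rate of decay for the step [G^{s,h}]: they are the same for all functions of the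
    step, as continuity on an inductive limit requires. *)
Definition gconst (h : R) : R := 2 `^ s * 2 ^+ m.
Definition grate (h : R) : R := s / 2 * rt h^-1 / m.+1%:R.

Lemma grate_gt0 h : 0 < h -> 0 < grate h.
Proof.
move=> h0; have s0 : 0 < s by exact: lt_trans s1.
rewrite !divr_gt0 ?ltr0n// mulr_gt0 ?divr_gt0// powR_gt0//.
by rewrite normr_gt0 invr_eq0 gt_eqF.
Qed.

(** The pure derivatives in one direction multiply the modulus of the coefficients by [|k_j|^r], so
    that [root_decay] gives decay in each coordinate and [dec_of_coords] combines the results. *)
Lemma gevrey_step_coef (h N : R) f : 0 < h -> gevrey_step s h f ->
  (gevrey_norm s h f <= N%:E)%E -> dec s (grate h) (gconst h * N) (coef f).
Proof.
move=> h0 [pf hs _] hN k.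
have s0 : 0 < s by exact: lt_trans s1.
have bnd al y : cmod (mpartial al f y) <= N * h ^+ mlength al * (mfact al)%:R `^ s.
  have F0 : 0 < (mfact al)%:R `^ s :> R.
    by rewrite powR_gt0// ltr0n /mfact prodn_gt0// => j; exact: fact_gt0.
  have : ((cmod (mpartial al f y) * h ^- mlength al * ((mfact al)%:R `^ s)^-1)%:E <= N%:E)%E.
    by apply: le_trans hN; apply: ereal_sup_ubound; exists al, y.
  by rewrite lee_fin ler_pdivrMr// ler_pdivrMr ?exprn_gt0// (mulrAC N).
have bj j r y : cmod (iter r (partial j) f y) <= N * h ^+ r * r`!%:R `^ s.
  have := bnd (fun i => if i == j then r else 0%N) y; rewrite mpartial_single.
  rewrite /mlength -big_mkcond big_pred1_eq /mfact (bigD1 j)//= eqxx big1 ?muln1//.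
  by move=> i /negbTE ->.
have N0 : 0 <= N.
  have := bnd (fun=> 0%N) 0; rewrite /mlength /mfact big1// big1// expr0 mulr1 powR1 mulr1.
  exact: le_trans (cmod_ge0 _).
have T0 : 1 <= 2 `^ s :> R.
  have e : (2 : R) `^ 0 = 1 by rewrite powRr0.
  by rewrite -[leLHS]e ler_powR ?ler1n// ltW.
have Bf := smooth_periodic_BL hs pf.
apply: dec_of_coords.
- by rewrite mulr_gt0 ?divr_gt0// powR_gt0// normr_gt0 invr_eq0 gt_eqF.
- by rewrite !mulr_ge0 ?powR_ge0 ?exprn_ge0.
- apply: (@le_trans _ _ (2 ^+ m * N)).
    apply: coef_norm => // y.
    have := bnd (fun=> 0%N) y; rewrite /mlength /mfact big1// big1// expr0 mulr1 powR1 mulr1.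
    rewrite /mpartial; have -> : foldr (fun (i : 'I_m) g => iter 0 (partial i) g) f (enum 'I_m) = f.
      by elim: (enum 'I_m).
    by [].
  by rewrite /gconst -mulrA ler_peMl// mulr_ge0 ?exprn_ge0.
move=> j; rewrite /gconst -(mulrA (2 `^ s)); apply: root_decay => //.
- exact: cmod_ge0.
- by rewrite mulr_ge0 ?exprn_ge0.
move=> r; rewrite mulrC -coef_iter_partial// -!mulrA.
apply: coef_norm; last by move=> y; rewrite mulrA; exact: bj.
have [hs' pf'] := iter_partial j r hs pf; exact: smooth_periodic_BL.
Qed.

Lemma gevrey_norm_ge0 (h : R) f : 0 < h -> (0 <= gevrey_norm s h f)%E.
Proof.
move=> h0; apply: (@le_trans _ _ (cmod (mpartial (fun=> 0%N) f 0) * h ^- mlength (fun _ : 'I_m => 0%N)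
   * ((mfact (fun _ : 'I_m => 0%N))%:R `^ s)^-1)%:E).
  by rewrite lee_fin !mulr_ge0 ?cmod_ge0 ?invr_ge0 ?exprn_ge0 ?powR_ge0 ?(ltW h0).
by apply: ereal_sup_ubound; exists (fun=> 0%N), 0.
Qed.

Lemma gevrey_BL f : gevrey s f -> BL f.
Proof. by move=> [h h0 [pf hs _]]; exact: smooth_periodic_BL. Qed.

Lemma gevrey_periodic f : gevrey s f -> periodic f.
Proof. by move=> [h h0 []]. Qed.

Lemma gevrey_coef f : gevrey s f -> exists d D, 0 < d /\ dec s d D (coef f).
Proof.
move=> [h h0 hf]; have [pf hs hn] := hf.
have /fineK e : gevrey_norm s h f \is a fin_num.
  by rewrite ge0_fin_numE ?gevrey_norm_ge0.
exists (grate h), (gconst h * fine (gevrey_norm s h f)); split; first exact: grate_gt0.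
by apply: gevrey_step_coef => //; rewrite e.
Qed.

Lemma gevreyP f : gevrey s f <->
  [/\ BL f, periodic f & exists d D, 0 < d /\ dec s d D (coef f)].
Proof.
split=> [h|[hf pf [d [D [d0 h]]]]]; last exact: gevrey_of_coef d0 hf pf h.
by split; [exact: gevrey_BL|exact: gevrey_periodic|exact: gevrey_coef].
Qed.

Lemma gevrey_inversion f : gevrey s f -> f = Fsum (coef f).
Proof.
move=> h; have [d [D [d0 hd]]] := gevrey_coef h.
by apply: fourier_inversion d0 _ _ hd => //; [exact: gevrey_BL|exact: gevrey_periodic].
Qed.

End FourierAnalysis.

(** * Fourier coefficients of ultradistributions *)

Section WeightFacts.
Variables (R : realType) (s : R) (m : nat).
Hypothesis s1 : 1 < s.
Local Notation K := 'rV[int]_m.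
Local Notation om := (expweight s).
Local Notation pw := (weight s).

Lemma om_shift (d : R) (k l : K) : om d (k - l) <= om d k * om (- `|d|) l.
Proof.
rewrite /expweight -expRD ler_expR opprK.
have a := pwD s1 (k - l) l; rewrite subrK in a.
have b := pwD s1 k (- l); rewrite pwN in b.
by case: (ger0P d) => d0; nra.
Qed.

Lemma om_le_tl d (k : K) N : 0 < d -> (N <= pickle k)%N -> om d k <= tl s m d N.
Proof.
move=> d0 Nk; apply: (@le_trans _ _ (omseries s m d (pickle k).+1 - omseries s m d N)).
  have e : omseries s m d (pickle k).+1 = omseries s m d (pickle k) + om d k.
    by rewrite /omseries seriesSr pickleK_inv.
  by have := omseries_nd s m d Nk; rewrite e; lra.
by rewrite lerB// nondecreasing_cvgn_le//; [exact: omseries_nd|exact: omseries_cvg].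
Qed.

(** When the code of [l] is not below [N], the only nonzero term is missing from the partial sum,
    but then [om d l] is part of the tail. *)
Lemma csum_single d D (a : K -> R[i]) l : 0 < d -> dec s d D a ->
  (forall k, k != l -> a k = 0) -> csum a = a l.
Proof.
move=> d0 h z; symmetry.
apply: (csum_unique s1 (d := d) (D := D) (B := D) d0) => [||N]; rewrite ?(dec_ge0 h)//.
rewrite psumE; have [lN|lN] := ltnP (pickle l) N.
  rewrite (bigD1_seq l) ?mem_enumK ?enumK_uniq//= big1 => [|k kl]; last exact: z.
  by rewrite addr0 subrr cmod0 mulr_ge0 ?(dec_ge0 h) ?tl_ge0.
have -> : \sum_(k <- enumK m N) a k = 0.
  rewrite big_seq big1// => k; rewrite /enumK mem_pmap => /mapP[n].
  rewrite mem_iota => /andP[_ nN] e; apply: z; apply/eqP => kl.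
  have := @pickle_invK K n; rewrite /ocancel -e /= kl => ne.
  by move: nN; rewrite -ne add0n ltnNge lN.
by rewrite subr0; apply: le_trans (h l) _; rewrite ler_wpM2l ?(dec_ge0 h)// om_le_tl.
Qed.

End WeightFacts.

Section Ultradistributions.
Variables (R : realType) (s : R) (m : nat).
Hypothesis s1 : 1 < s.
Local Notation K := 'rV[int]_m.
Local Notation om := (expweight s).
Local Notation pw := (weight s).
Local Notation dec := (dec s).
Implicit Types (k l : K) (y z : 'rV[R]_m) (f g phi : 'rV[R]_m -> R[i]) (u v w : functional R m).

Lemma BL_ext_coef f g : gevrey s f -> gevrey s g -> (forall k, coef f k = coef g k) -> f = g.
Proof.
move=> hf hg e; rewrite (gevrey_inversion s1 hf) (gevrey_inversion s1 hg).
by congr Fsum; apply/funext.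
Qed.

Lemma dec_two d d' D D' (a b : K -> R[i]) : 0 < d -> 0 < d' -> dec d D a -> dec d' D' b ->
  exists e, [/\ 0 < e, dec e D a & dec e D' b].
Proof.
move=> d0 d'0 ha hb; exists (Num.min d d'); split.
- by rewrite lt_min d0.
- by apply: dec_weaken ha; rewrite ge_min lexx.
- by apply: dec_weaken hb; rewrite ge_min lexx orbT.
Qed.

Lemma gevrey_lin (c : R[i]) f g : gevrey s f -> gevrey s g -> gevrey s (fun y => c * f y + g y).
Proof.
move=> /(gevreyP s1)[bf pf [d [D [d0 hd]]]] /(gevreyP s1)[bg pg [d' [D' [d'0 hd']]]].
apply/(gevreyP s1); split.
- by apply: BLD => //; exact: BLZ.
- by move=> j y; rewrite pf pg.
have [e [e0 h h']] := dec_two d0 d'0 hd hd'.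
exists e, (cmod c * D + D'); split => // k.
by rewrite coefD ?coefZ//; [exact: (decD (decZ c h) h')|exact: BLZ].
Qed.

Lemma dec_ek1 l : dec 1 (expR (pw l)) (coef (ek l)).
Proof.
move=> k; rewrite coef_ek; case: eqP => [->|_].
  by rewrite cmod1 /expweight -expRD mulN1r addrN expR0.
by rewrite cmod0 mulr_ge0 ?expR_ge0 ?om_ge0.
Qed.

Lemma gevrey_ek l : gevrey s (ek l).
Proof.
apply/(gevreyP s1); split; [exact: BL_ek|exact: periodic_ek|].
by exists 1, (expR (pw l)); split => //; exact: dec_ek1.
Qed.

Lemma gevrey_cst0 : gevrey s (fun _ : 'rV[R]_m => 0).
Proof.
have -> : (fun _ : 'rV[R]_m => 0) = (fun y : 'rV[R]_m => (-1) * ek 0 y + ek 0 y) :> ('rV[R]_m -> R[i]).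
  by apply/funext => y; rewrite mulN1r addNr.
exact: gevrey_lin (gevrey_ek 0) (gevrey_ek 0).
Qed.

Definition linearG u := forall (c : R[i]) f g, gevrey s f -> gevrey s g ->
  u (fun y => c * f y + g y) = c * u f + u g.

Lemma linearG0 u : linearG u -> u (fun=> 0) = 0.
Proof.
move=> h; have := h (-1) _ _ gevrey_cst0 gevrey_cst0.
have e : (fun _ : 'rV[R]_m => -1 * 0 + 0 : R[i]) = fun=> 0.
  by apply/funext => y; rewrite mulr0 addr0.
by rewrite e mulN1r addNr.
Qed.

Lemma linearGZ u c f : linearG u -> gevrey s f -> u (fun y => c * f y) = c * u f.
Proof.
move=> h hf; have := h c _ _ hf gevrey_cst0; rewrite linearG0// addr0 => <-.
by congr u; apply/funext => y; rewrite addr0.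
Qed.

Lemma gevrey_sumG (I : Type) (r : seq I) (c : I -> R[i]) (F : I -> 'rV[R]_m -> R[i]) :
  (forall i, gevrey s (F i)) -> gevrey s (fun y => \sum_(i <- r) c i * F i y).
Proof.
move=> hF; elim: r => [|i r IH].
  rewrite (_ : (fun y => _) = fun=> 0); first exact: gevrey_cst0.
  by apply/funext => y; rewrite big_nil.
rewrite (_ : (fun y => _) = fun y => c i * F i y + \sum_(j <- r) c j * F j y).
  exact: gevrey_lin.
by apply/funext => y; rewrite big_cons.
Qed.

Lemma linearG_sum u (I : Type) (r : seq I) (c : I -> R[i]) (F : I -> 'rV[R]_m -> R[i]) :
  linearG u -> (forall i, gevrey s (F i)) ->
  u (fun y => \sum_(i <- r) c i * F i y) = \sum_(i <- r) c i * u (F i).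
Proof.
move=> hu hF; elim: r => [|i r IH].
  rewrite big_nil -[RHS](linearG0 hu); congr u; apply/funext => y; by rewrite big_nil.
rewrite big_cons -IH -hu//; last exact: gevrey_sumG.
by congr u; apply/funext => y; rewrite big_cons.
Qed.

(** Continuity read on Fourier coefficients: one bound for each rate of decay. For linear
    functionals, [ultra_bounded] and [bounded_ultra] identify it with continuity for the inductive
    limit topology. *)
Definition boundedG u := forall d, 0 < d -> exists2 C, 0 <= C &
  forall f D, gevrey s f -> dec d D (coef f) -> cmod (u f) <= C * D.

Lemma ultra_bounded u : ultradistribution s u -> linearG u /\ boundedG u.
Proof.
move=> [lin cont]; split=> // d d0.
have s0 : 0 < s by exact: lt_trans s1.
have [V [Vg VU _ Vn]] := cont _ gevrey_cst0 1 ltr01.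
have h0 : 0 < (s / (d / 2)) `^ s by rewrite powR_gt0// !divr_gt0.
have [del del0 hdel] := Vn _ h0.
pose T := 2 * tot s m (d / 2).
have T0 : 0 <= T by rewrite mulr_ge0// tot_ge0// divr_gt0.
(* With this constant the synthesized function has norm below [del], so it lies in [V]; homogeneity
   then gives the general bound with constant [c^-1]. *)
pose c := del / (2 * (T + 1)).
have c0 : 0 < c by rewrite divr_gt0// mulr_gt0// ltr_wpDl.
have key a : dec d c a -> cmod (u (Fsum a)) <= 1.
  move=> ha; have [gs gn] := gevrey_step_Fsum s1 d0 ha.
  have : V (Fsum a).
    apply: hdel => //; apply: le_lt_trans gn _; rewrite lte_fin.
    rewrite -mulrA mulrCA (mulrC c) -/T mulrC /c mulrAC ltr_pdivrMr ?mulr_gt0 ?ltr_wpDl//.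
    by rewrite ltr_pM2l//; lra.
  move=> /VU /=; rewrite (linearG0 lin) subr0 => /ltW.
  by rewrite (_ : (fun y => 0 + Fsum a y) = Fsum a)//; apply/funext => y; rewrite add0r.
exists c^-1 => [|f D gf hD]; first by rewrite invr_ge0 ltW.
rewrite (gevrey_inversion s1 gf).
have D0 := dec_ge0 hD.
have [D00|Dn] := eqVneq D 0.
  rewrite (_ : Fsum (coef f) = fun=> 0) ?(linearG0 lin) ?cmod0 ?mulr_ge0 ?invr_ge0 ?(ltW c0)//.
  apply/funext => y; apply: cmod_eq0; apply/eqP; rewrite eq_le cmod_ge0 andbT.
  by have := Fsum_norm s1 y d0 hD; rewrite D00 mulr0 mul0r.
have Dp : 0 < D by rewrite lt0r Dn.
have cD0 : 0 < c / D by apply: divr_gt0.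
have hZ : dec d c (fun k => (c / D)%:C * coef f k).
  move=> k; rewrite cmodM cmodR (gtr0_norm cD0).
  rewrite -[X in _ <= X * _](divfK Dn c) -[leRHS]mulrA.
  by apply: ler_wpM2l => //; exact: ltW.
have := key _ hZ.
have -> : Fsum (fun k => (c / D)%:C * coef f k) = fun y => (c / D)%:C * Fsum (coef f) y.
  apply/funext => y; rewrite /Fsum -(csumZ s1 _ d0 (dec_ek y hD)).
  by congr csum; apply/funext => k; rewrite mulrA.
rewrite (linearGZ _ lin) -?(gevrey_inversion s1 gf)// cmodM cmodR (gtr0_norm cD0).
rewrite mulrAC ler_pdivrMr// mul1r => ucD.
by rewrite -(ler_pM2l c0) mulrA divff ?gt_eqF// mul1r.
Qed.

(** The set where [|u| <= eps / 2] is itself the required absolutely convex neighbourhood: on each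
    step, a small norm gives small coefficients at the common rate [grate]. *)
Lemma bounded_ultra u : linearG u -> boundedG u -> ultradistribution s u.
Proof.
move=> lin bnd; split=> // f gf eps eps0.
exists [set g | gevrey s g /\ cmod (u g) <= eps / 2]; split.
- by move=> g [].
- move=> g [gg ug] /=; rewrite (_ : (fun y => f y + g y) = fun y => 1 * g y + f y); last first.
    by apply/funext => y; rewrite mul1r addrC.
  rewrite lin// mul1r addrK; apply: le_lt_trans ug _.
  by rewrite ltr_pdivrMr// ltr_pMr// ltr1n.
- move=> f1 f2 c1 c2 [g1 u1] [g2 u2] c12; have g2' := gevrey_lin c2 g2 gevrey_cst0.
  have e : (fun y => c1 * f1 y + c2 * f2 y) = fun y => c1 * f1 y + (c2 * f2 y + 0).
    by apply/funext => y; rewrite addr0.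
  rewrite /= e; split; first exact: gevrey_lin.
  rewrite lin// lin ?(linearG0 lin) ?addr0//; last exact: gevrey_cst0.
  apply: le_trans (cmodD _ _) _; rewrite !cmodM.
  apply: (@le_trans _ _ (cmod c1 * (eps / 2) + cmod c2 * (eps / 2))).
    by apply: lerD; rewrite ler_wpM2l ?cmod_ge0.
  by rewrite -mulrDl ler_piMl// divr_ge0// ltW.
move=> h h0; have [C C0 hC] := bnd _ (grate_gt0 m s1 h0).
have [G G0 eG] : exists2 G, 0 <= G & gconst m s h = G.
  by exists (gconst m s h) => //; rewrite mulr_ge0 ?powR_ge0 ?exprn_ge0.
have CG1 : 0 < 2 * (C * G + 1) by rewrite mulr_gt0// ltr_wpDl// mulr_ge0.
exists (eps / (2 * (C * G + 1))) => [|g gs gn]; first by rewrite divr_gt0.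
have gg : gevrey s g by exists h.
split=> //; have hd := gevrey_step_coef s1 h0 gs (ltW gn).
apply: le_trans (hC _ _ gg hd) _.
rewrite eG !mulrA ler_pdivrMr//.
have -> : eps / 2 * (2 * (C * G + 1)) = (C * G + 1) * eps by field.
by rewrite ler_wpM2r ?(ltW eps0)// lerDl.
Qed.

(** [coef] is bounded by the uniform norm, and the partial sums converge uniformly at the rate
    [tl]. *)
Lemma coef_csum m' d D B (c : 'rV[int]_m' -> R[i]) (F : 'rV[int]_m' -> 'rV[R]_m -> R[i]) k :
  0 < d -> dec d D c -> 0 <= B -> (forall r, BL (F r)) -> (forall r y, cmod (F r y) <= B) ->
  BL (fun y => csum (fun r => c r * F r y)) ->
  coef (fun y => csum (fun r => c r * F r y)) k = csum (fun r => c r * coef (F r) k).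
Proof.
move=> d0 hc B0 hF hB hG; have D0 := dec_ge0 hc.
have hcF y : dec d (D * B) (fun r => c r * F r y).
  by move=> r; rewrite cmodM mulrAC ler_pM ?cmod_ge0.
apply: (csum_unique s1 (d := d) (D := D * (2 ^+ m * B)) (B := 2 ^+ m * (2 * (D * B))) d0).
- by rewrite !mulr_ge0 ?exprn_ge0.
- by move=> r; rewrite cmodM mulrAC ler_pM ?cmod_ge0//; exact: coef_norm.
move=> N.
have -> : psum (fun r => c r * coef (F r) k) N =
    coef (fun y => psum (fun r => c r * F r y) N) k.
  rewrite (_ : (fun y => psum _ N) = fun y => \sum_(r <- enumK m' N) c r * F r y).
    rewrite coef_sum => [|r]; last exact: BLZ.
    by rewrite psumE; apply: eq_bigr => r _; rewrite coefZ.
  by apply/funext => y; rewrite psumE.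
have BLp : BL (fun y => psum (fun r => c r * F r y) N).
  rewrite (_ : (fun y => _) = fun y => \sum_(r <- enumK m' N) c r * F r y).
    by apply: BL_sum => r; exact: BLZ.
  by apply/funext => y; rewrite psumE.
rewrite -coefB// -mulrA; apply: coef_norm => [|y]; first exact: BLB.
exact: (csumP s1 d0 (hcF y)).
Qed.

(** Half of the decay of [c] controls the coefficients of the sum, the other half sums over [r]. The
    remainder after [N] terms then has coefficients bounded by a multiple of [tl N] with decay
    [d / 2], and [boundedG] sends it to 0. *)
Lemma ultra_series u m' d D (c : 'rV[int]_m' -> R[i]) (e : 'rV[int]_m' -> K) (P : R) :
  ultradistribution s u -> 0 < d -> dec d D c -> 0 <= P ->
  (forall r, pw (e r) <= pw r + P) ->
  BL (fun y => csum (fun r => c r * ek (e r) y)) ->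
  gevrey s (fun y => csum (fun r => c r * ek (e r) y)) /\
  u (fun y => csum (fun r => c r * ek (e r) y)) = csum (fun r => c r * u (ek (e r))).
Proof.
move=> hu d0 hc P0 he hG; have [lin bnd] := ultra_bounded hu.
have D0 := dec_ge0 hc; have d20 : 0 < d / 2 by rewrite divr_gt0.
have [C C0 hC] := bnd _ d20.
set G := fun y => _ in hG *.
pose E := D * expR (d / 2 * P).
have E0 : 0 <= E by rewrite mulr_ge0 ?expR_ge0.
have termE r k : cmod (c r * coef (ek (e r)) k) <= E * om (d / 2) k * om (d / 2) r.
  rewrite coef_ek; case: eqP => [<-|_]; last first.
    by rewrite mulr0 cmod0; apply: mulr_ge0; [apply: mulr_ge0 => //|]; exact: om_ge0.
  rewrite mulr1; apply: le_trans (hc r) _.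
  rewrite /E -!mulrA ler_wpM2l// /expweight -!expRD ler_expR.
  by have := he r; nra.
have cG k : coef G k = csum (fun r => c r * coef (ek (e r)) k).
  by apply: (@coef_csum m' d D 1 c (fun r => ek (e r)) k) => // [r|r y]; [exact: BL_ek|rewrite cmod_ek].
have pG : periodic G by move=> j y; congr csum; apply/funext => r; rewrite periodic_ek.
have gG : gevrey s G.
  apply/(gevreyP s1); split => //; exists (d / 2), (2 * E * tot s m' (d / 2)); split => // k.
  rewrite cG [leRHS](_ : _ = 2 * (E * om (d / 2) k) * tot s m' (d / 2)); last by ring.
  exact: (csum_norm s1 d20 (fun r => termE r k)).
have up r : cmod (u (ek (e r))) <= C * expR (d / 2 * (pw r + P)).
  apply: hC; first exact: gevrey_ek.
  move=> k; rewrite coef_ek; case: eqP => [<-|_]; last first.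
    by rewrite cmod0 mulr_ge0 ?expR_ge0.
  by rewrite cmod1 /expweight -expRD -[leLHS]expR0 ler_expR; have := he r; nra.
split=> //; apply: (csum_unique s1 (d := d / 2) (D := D * (C * expR (d / 2 * P))) (B := C * (2 * E)) d20).
- by rewrite !mulr_ge0.
- move=> r; rewrite cmodM.
  apply: (@le_trans _ _ (D * om d r * (C * expR (d / 2 * (pw r + P))))).
    by rewrite ler_pM ?cmod_ge0.
  rewrite (_ : D * om d r * _ = D * C * (om d r * expR (d / 2 * (pw r + P)))); last by ring.
  rewrite (_ : D * (_ * _) * _ = D * C * (expR (d / 2 * P) * om (d / 2) r)); last by ring.
  rewrite ler_wpM2l ?mulr_ge0// /expweight -!expRD ler_expR le_eqVlt; apply/orP; left.
  by apply/eqP; field.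
move=> N.
have -> : psum (fun r => c r * u (ek (e r))) N = u (fun y => \sum_(r <- enumK m' N) c r * ek (e r) y).
  by rewrite linearG_sum// ?psumE// => r; exact: gevrey_ek.
have gp : gevrey s (fun y => \sum_(r <- enumK m' N) c r * ek (e r) y).
  by apply: gevrey_sumG => r; exact: gevrey_ek.
have -> : u G - u (fun y => \sum_(r <- enumK m' N) c r * ek (e r) y) =
    u (fun y => -1 * \sum_(r <- enumK m' N) c r * ek (e r) y + G y).
  by rewrite lin// mulN1r addrC.
rewrite -mulrA; apply: hC; first exact: gevrey_lin.
have bp := gevrey_BL gp.
move=> k; rewrite (coefD k (BLZ (-1) bp) hG) (coefZ (-1) k bp).
rewrite mulN1r addrC cG.
have -> : coef (fun y => \sum_(r <- enumK m' N) c r * ek (e r) y) k =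
    psum (fun r => c r * coef (ek (e r)) k) N.
  rewrite coef_sum ?psumE; last by move=> r; apply: BLZ; exact: BL_ek.
  by apply: eq_bigr => r _; rewrite coefZ//; exact: BL_ek.
rewrite [leRHS](_ : _ = 2 * (E * om (d / 2) k) * tl s m' (d / 2) N); last by ring.
exact: (csumP s1 d20 (fun r => termE r k)).
Qed.

Lemma ultra_csum u f : ultradistribution s u -> gevrey s f ->
  u f = csum (fun k => coef f k * u (ek k)).
Proof.
move=> hu gf; have [d [D [d0 hd]]] := gevrey_coef s1 gf.
rewrite {1}(gevrey_inversion s1 gf).
apply: (ultra_series (e := id) hu d0 hd (lexx 0) _ _).2; first by move=> r; rewrite addr0.
exact: BL_Fsum d0 hd.
Qed.

Lemma ultra_ext u v : ultradistribution s u -> ultradistribution s v ->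
  (forall k, u (ek k) = v (ek k)) -> forall f, gevrey s f -> u f = v f.
Proof.
move=> hu hv e f gf; rewrite (ultra_csum hu gf) (ultra_csum hv gf).
by congr csum; apply/funext => k; rewrite e.
Qed.

Lemma ultra_TI g : gevrey s g -> ultradistribution s (fun phi => torus_integral (fun y => g y * phi y)).
Proof.
move=> gg; have bg := gevrey_BL gg; have [M hM _] := bg.
have M0 : 0 <= M by apply: le_trans (hM 0); exact: cmod_ge0.
apply: bounded_ultra.
  move=> c f h gf gh; have bf := gevrey_BL gf; have bh := gevrey_BL gh.
  rewrite -TIZ -?TID; try exact: BLM; last by apply: BLZ; exact: BLM.
  by congr torus_integral; apply/funext => y; ring.
move=> d d0; exists ((4 * pi) ^+ m * (M * (2 * tot s m d))).
  by rewrite !mulr_ge0 ?exprn_ge0 ?mulr_ge0 ?pi_ge0 ?tot_ge0.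
move=> f D gf hD; rewrite -!mulrA; apply: TI_norm; first by apply: BLM => //; exact: gevrey_BL gf.
move=> y; rewrite cmodM ler_pM ?cmod_ge0// (gevrey_inversion s1 gf) mulrA mulrAC.
exact: Fsum_norm.
Qed.

(** Up to the factor [(2 * pi) ^+ m], the value [w (ek (- k))] is the [k]-th Fourier coefficient of
    the function that represents [w]. *)
Lemma in_gevreyP w : ultradistribution s w ->
  (in_gevrey s w <-> exists d D, 0 < d /\ dec d D (fun k => w (ek (- k)))).
Proof.
move=> hw; pose P := ((2 * pi) ^+ m : R).
have P0 : 0 < P by rewrite exprn_gt0// pi2_gt0.
have TIc g k : torus_integral (fun y => g y * ek (- k) y) = P%:C * coef g k.
  by rewrite /coef mulrA -rmorphM /= divff ?mul1r// gt_eqF.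
split=> [[g gg hg]|[d [D [d0 hd]]]].
  have [d [D [d0 hd]]] := gevrey_coef s1 gg; exists d, (cmod P%:C * D); split => // k.
  by rewrite hg ?TIc; [exact: decZ|exact: gevrey_ek].
have hd' := decZ (P^-1)%:C hd.
have gg := gevrey_Fsum s1 d0 hd'.
exists (Fsum (fun k => (P^-1)%:C * w (ek (- k)))) => // phi gphi.
apply: (ultra_ext hw (ultra_TI gg)) gphi => k.
rewrite -{2}(opprK k) TIc (coef_Fsum s1 _ d0 hd') opprK mulrA -rmorphM /=.
by rewrite divff ?mul1r// gt_eqF.
Qed.

Lemma ultra_growth u : ultradistribution s u -> forall d, 0 < d ->
  exists2 C, 0 <= C & forall k, cmod (u (ek (- k))) <= C * om (- d) k.
Proof.
move=> hu d d0; have [_ bnd] := ultra_bounded hu; have [C C0 hC] := bnd _ d0.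
exists C => // k; apply: hC; first exact: gevrey_ek.
move=> l; rewrite coef_ek; case: eqP => [<-|_]; last by rewrite cmod0 mulr_ge0 ?om_ge0.
by rewrite cmod1 /expweight pwN opprK -expRD mulNr addrN expR0.
Qed.

(** The functional is the pairing of [a] with the coefficients of the test function; growth at rate
    [d / 2] is dominated by decay at rate [d]. *)
Lemma ultra_of_growth (a : K -> R[i]) :
  (forall d, 0 < d -> exists2 C, 0 <= C & forall k, cmod (a k) <= C * om (- d) k) ->
  exists2 u, ultradistribution s u & forall k, u (ek (- k)) = a k.
Proof.
move=> ha.
have half (d : R) : 0 < d -> 0 < d / 2 by move=> d0; rewrite divr_gt0.
have prod d D (f : 'rV[R]_m -> R[i]) C : 0 < d -> dec d D (coef f) ->
    (forall k, cmod (a k) <= C * om (- (d / 2)) k) -> dec (d / 2) (D * C) (fun k => coef f k * a (- k)).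
  move=> d0 hf hC k; rewrite cmodM.
  apply: (@le_trans _ _ (D * om d k * (C * om (- (d / 2)) (- k)))).
    by rewrite ler_pM ?cmod_ge0.
  rewrite (_ : D * om d k * _ = D * C * (om d k * om (- (d / 2)) (- k))); last by ring.
  rewrite le_eqVlt; apply/orP; left; apply/eqP; congr (_ * _).
  by rewrite /expweight pwN -expRD; congr expR; field.
exists (fun f => csum (fun k => coef f k * a (- k))).
  apply: bounded_ultra.
    move=> c f g gf gg.
    have [d1 [D1 [d10 h1]]] := gevrey_coef s1 gf; have [d2 [D2 [d20 h2]]] := gevrey_coef s1 gg.
    have [d [d0 h1' h2']] := dec_two d10 d20 h1 h2.
    have [C C0 hC] := ha _ (half _ d0).
    have p1 := prod _ _ _ _ d0 h1' hC; have p2 := prod _ _ _ _ d0 h2' hC.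
    rewrite -(csumZ s1 _ (half _ d0) p1) -(csumD s1 (half _ d0) (decZ c p1) p2).
    congr csum; apply/funext => k; rewrite coefD ?coefZ//; try exact: gevrey_BL gf; try exact: gevrey_BL gg.
      by ring.
    by apply: BLZ; exact: gevrey_BL gf.
  move=> d d0; have [C C0 hC] := ha _ (half _ d0).
  exists (2 * (C * tot s m (d / 2))); first by rewrite !mulr_ge0 ?tot_ge0 ?half.
  move=> f D gf hD.
  rewrite [leRHS](_ : _ = 2 * (D * C) * tot s m (d / 2)); last by ring.
  exact: (csum_norm s1 (half _ d0) (prod _ _ _ _ d0 hD hC)).
move=> k; have [C C0 hC] := ha _ (half _ ltr01).
rewrite (csum_single s1 (half _ ltr01) (prod _ _ _ _ ltr01 (dec_ek1 (- k)) hC) (l := - k)).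
  by rewrite coef_ek eqxx mul1r opprK.
by move=> l lk; rewrite coef_ek eq_sym (negbTE lk) mul0r.
Qed.

End Ultradistributions.

(** * The system on Fourier coefficients *)

Section Convolution.
Variables (R : realType) (s : R) (m : nat).
Hypothesis s1 : 1 < s.
Local Notation K := 'rV[int]_m.
Local Notation K1 := 'rV[int]_1.
Local Notation om := (expweight s).
Local Notation pw := (weight s).
Local Notation dec := (dec s).
Implicit Types (k l : K) (y z : 'rV[R]_m) (f g phi : 'rV[R]_m -> R[i]) (u v w : functional R m).

Definition emb (j : 'I_m) (r : K1) : K := \row_i (if i == j then r 0 0 else 0).

Lemma pw_emb j (r : K1) : pw (emb j r) = pw r.
Proof.
rewrite /weight big_ord1 (bigD1 j)//= mxE eqxx big1 ?addr0// => i /negbTE ij.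
by rewrite mxE ij rt0.
Qed.

Lemma ek_emb j (r : K1) y : ek (emb j r) y = ek r (const_mx (y 0 j)).
Proof.
rewrite /ek /kdot big_ord1 (bigD1 j)//= !mxE eqxx big1 ?addr0// => i /negbTE ij.
by rewrite mxE ij mul0r.
Qed.

(** Multiplication by a function of the single coordinate [y_j], seen on the Fourier side. *)
Definition conv j (c : K1 -> R[i]) (a : K -> R[i]) k :=
  csum (fun r => c r * a (k - emb j r)).

Lemma dec_conv_term j dc Dc d D (c : K1 -> R[i]) (a : K -> R[i]) k :
  dec dc Dc c -> dec d D a -> dec (dc - `|d|) (Dc * D * om d k) (fun r => c r * a (k - emb j r)).
Proof.
move=> hc ha r; rewrite cmodM.
apply: (@le_trans _ _ (Dc * om dc r * (D * (om d k * om (- `|d|) (emb j r))))).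
  apply: ler_pM; rewrite ?cmod_ge0//; apply: le_trans (ha _) _.
  by rewrite ler_wpM2l ?(dec_ge0 ha)// om_shift.
rewrite le_eqVlt; apply/orP; left; apply/eqP.
rewrite (_ : om (dc - `|d|) r = om dc r * om (- `|d|) (emb j r)); first by ring.
by rewrite /expweight pw_emb -expRD; congr expR; ring.
Qed.

(** The rate [d] may be negative, so growth is preserved like decay; the surplus [dc - |d|] sums the
    series. *)
Lemma conv_norm j dc Dc d D (c : K1 -> R[i]) (a : K -> R[i]) :
  `|d| < dc -> dec dc Dc c -> dec d D a ->
  dec d (2 * (Dc * D) * tot s 1 (dc - `|d|)) (conv j c a).
Proof.
move=> ddc hc ha k.
rewrite [leRHS](_ : _ = 2 * (Dc * D * om d k) * tot s 1 (dc - `|d|)); last by ring.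
by apply: csum_norm; [|rewrite subr_gt0|exact: dec_conv_term].
Qed.

Definition cfun j (c : K1 -> R[i]) y := Fsum c (const_mx (y 0 j)).

Lemma cfunE j c y : cfun j c y = csum (fun r => c r * ek (emb j r) y).
Proof. by congr csum; apply/funext => r; rewrite ek_emb. Qed.

Lemma BL_cfun j dc Dc c : 0 < dc -> dec dc Dc c -> BL (cfun j c).
Proof.
move=> d0 hc; have [M hM hL] := BL_Fsum s1 d0 hc.
exists M => [y|y z]; first exact: hM.
apply: le_trans (hL _ _) _; rewrite ler_wpM2l ?(le_trans (cmod_ge0 _) (hM 0))//.
apply: norm_rV_le => // i; rewrite !mxE.
by have := le_norm_rV (y - z) j; rewrite !mxE.
Qed.

Lemma periodic_cfun j c : periodic (cfun j c).
Proof. by move=> i y; rewrite !cfunE; congr csum; apply/funext => r; rewrite periodic_ek. Qed.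

Lemma coef_mul_ek f l k : coef (fun y => ek l y * f y) k = coef f (k - l).
Proof.
rewrite /coef; congr (_ * torus_integral _); apply/funext => y.
by rewrite opprB ekD; ring.
Qed.

Lemma coef_mulc j dc Dc c f k : 0 < dc -> dec dc Dc c -> BL f ->
  coef (fun y => cfun j c y * f y) k = conv j c (coef f) k.
Proof.
move=> d0 hc hf; have [M hM _] := hf.
have M0 : 0 <= M by apply: le_trans (hM 0); exact: cmod_ge0.
have e y : cfun j c y * f y = csum (fun r => c r * (ek (emb j r) y * f y)).
  rewrite cfunE mulrC -(csumZ s1 (f y) d0 (D := Dc)).
    by congr csum; apply/funext => r; ring.
  by move=> r; rewrite cmodM cmod_ek mulr1.
have bG : BL (fun y => csum (fun r => c r * (ek (emb j r) y * f y))).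
  by rewrite -(funext e); apply: BLM => //; exact: BL_cfun d0 hc.
rewrite (funext e) (coef_csum s1 k d0 hc M0 _ _ bG).
- by congr csum; apply/funext => r; rewrite coef_mul_ek.
- by move=> r; apply: BLM => //; exact: BL_ek.
- by move=> r y; rewrite cmodM cmod_ek mul1r.
Qed.

Lemma gevrey_mulc j dc Dc c f : 0 < dc -> dec dc Dc c -> gevrey s f ->
  gevrey s (fun y => cfun j c y * f y).
Proof.
move=> d0 hc gf; have bf := gevrey_BL gf.
have [d [D [dd0 hd]]] := gevrey_coef s1 gf.
apply/(gevreyP s1); split.
- by apply: BLM => //; exact: BL_cfun d0 hc.
- by move=> i y; rewrite periodic_cfun (gevrey_periodic gf).
pose e := Num.min d (dc / 2).
have e0 : 0 < e by rewrite lt_min dd0 divr_gt0.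
have edc : `|e| < dc.
  rewrite gtr0_norm// gt_min; apply/orP; right.
  by rewrite ltr_pdivrMr// ltr_pMr// ltr1n.
have he : dec e D (coef f) by apply: dec_weaken hd; rewrite ge_min lexx.
exists e, (2 * (Dc * D) * tot s 1 (dc - `|e|)); split => // k.
by rewrite (coef_mulc j k d0 hc bf); exact: (conv_norm j edc hc he k).
Qed.

Lemma coef_partialG f j k : gevrey s f -> coef (partial j f) k = (k 0 j)%:~R%:C * 'i * coef f k.
Proof.
move=> gf; have [d [D [d0 hd]]] := gevrey_coef s1 gf.
rewrite {1}(gevrey_inversion s1 gf) (partial_Fsum s1 j d0 hd).2.
by rewrite (coef_Fsum s1 _ _ (dec_deriv s1 j d0 hd)) ?divr_gt0.
Qed.

Lemma gevrey_partial f j : gevrey s f -> gevrey s (partial j f).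
Proof.
move=> gf; have [d [D [d0 hd]]] := gevrey_coef s1 gf.
rewrite (gevrey_inversion s1 gf) (partial_Fsum s1 j d0 hd).2.
by apply: (gevrey_Fsum s1 _ (dec_deriv s1 j d0 hd)); rewrite divr_gt0.
Qed.

Lemma ultra_dpartial u j : ultradistribution s u -> ultradistribution s (dpartial j u).
Proof.
move=> hu; have [lin bnd] := ultra_bounded s1 hu; apply: (bounded_ultra s1).
  move=> c f g gf gg; rewrite /dpartial.
  have -> : partial j (fun y => c * f y + g y) = fun y => c * partial j f y + partial j g y.
    have gl := gevrey_lin s1 c gf gg.
    have gp := gevrey_partial j gf; have gq := gevrey_partial j gg.
    apply: (BL_ext_coef s1 (gevrey_partial j gl) (gevrey_lin s1 c gp gq)) => k.
    rewrite coef_partialG//.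
    rewrite (coefD k (BLZ c (gevrey_BL gf)) (gevrey_BL gg)) (coefZ c k (gevrey_BL gf)).
    rewrite (coefD k (BLZ c (gevrey_BL gp)) (gevrey_BL gq)) (coefZ c k (gevrey_BL gp)).
    by rewrite !coef_partialG//; ring.
  by rewrite (lin _ _ _ (gevrey_partial j gf) (gevrey_partial j gg)); ring.
move=> d d0; have d20 : 0 < d / 2 by rewrite divr_gt0.
have [C C0 hC] := bnd _ d20.
exists (C * (s / (d / 2)) `^ s); first by rewrite mulr_ge0 ?powR_ge0.
move=> f D gf hD; rewrite cmodN -mulrA (mulrC _ D); apply: hC; first exact: gevrey_partial.
by move=> k; rewrite coef_partialG//; exact: (dec_deriv s1 j d0 hD k).
Qed.

Lemma ultra_dmul u j dc Dc c : 0 < dc -> dec dc Dc c -> ultradistribution s u ->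
  ultradistribution s (dmul (cfun j c) u).
Proof.
move=> dc0 hc hu; have [lin bnd] := ultra_bounded s1 hu; apply: (bounded_ultra s1).
  move=> e f g gf gg; rewrite /dmul -lin; try exact: gevrey_mulc dc0 hc _.
  by congr u; apply/funext => y; ring.
move=> d d0; pose e := Num.min d (dc / 2).
have e0 : 0 < e by rewrite lt_min d0 divr_gt0.
have edc : `|e| < dc.
  rewrite gtr0_norm// gt_min; apply/orP; right.
  by rewrite ltr_pdivrMr// ltr_pMr// ltr1n.
have [C C0 hC] := bnd _ e0.
exists (C * (2 * Dc * tot s 1 (dc - `|e|))).
  by rewrite !mulr_ge0 ?(dec_ge0 hc)// tot_ge0// subr_gt0.
move=> f D gf hD; rewrite -mulrA; apply: hC; first exact: gevrey_mulc dc0 hc _.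
have he : dec e D (coef f) by apply: dec_weaken hD; rewrite ge_min lexx.
move=> k; rewrite (coef_mulc j k dc0 hc (gevrey_BL gf)).
rewrite [X in _ <= X * _](_ : _ = 2 * (Dc * D) * tot s 1 (dc - `|e|)); last by ring.
exact: (conv_norm j edc hc he k).
Qed.

Lemma ultra_dadd u v : ultradistribution s u -> ultradistribution s v ->
  ultradistribution s (dadd u v).
Proof.
move=> hu hv; have [lu bu] := ultra_bounded s1 hu; have [lv bv] := ultra_bounded s1 hv.
apply: (bounded_ultra s1); first by move=> c f g gf gg; rewrite /dadd lu// lv//; ring.
move=> d d0; have [C C0 hC] := bu _ d0; have [C' C'0 hC'] := bv _ d0.
exists (C + C') => [|f D gf hD]; first by rewrite addr_ge0.
by rewrite mulrDl; apply: le_trans (cmodD _ _) (lerD (hC _ _ gf hD) (hC' _ _ gf hD)).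
Qed.

Lemma partial_ek j l : partial j (ek l) = fun y => (l 0 j)%:~R%:C * 'i * ek l y.
Proof.
have gZ : gevrey s (fun y => (l 0 j)%:~R%:C * 'i * ek l y).
  have := gevrey_lin s1 ((l 0 j)%:~R%:C * 'i) (gevrey_ek s1 l) (gevrey_cst0 m s1).
  by congr (gevrey s _); apply/funext => y; rewrite addr0.
apply: (BL_ext_coef s1 (gevrey_partial j (gevrey_ek s1 l)) gZ) => k.
rewrite (coef_partialG j k (gevrey_ek s1 l)).
have -> := coefZ ((l 0 j)%:~R%:C * 'i) k (BL_ek R l).
by rewrite coef_ek; case: eqP => [->|_]; rewrite ?mulr0.
Qed.

(** All frequencies of the product have the same [i]-th entry as [l], since the factor [cfun j c]
    depends on [y_j] only. *)
Lemma partial_mulc_ek j i dc Dc c l : i != j -> 0 < dc -> dec dc Dc c ->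
  partial i (fun y => cfun j c y * ek l y) =
  fun y => (l 0 i)%:~R%:C * 'i * (cfun j c y * ek l y).
Proof.
move=> ij dc0 hc.
have gG := gevrey_mulc j dc0 hc (gevrey_ek s1 l).
have gZ : gevrey s (fun y => (l 0 i)%:~R%:C * 'i * (cfun j c y * ek l y)).
  have := gevrey_lin s1 ((l 0 i)%:~R%:C * 'i) gG (gevrey_cst0 m s1).
  by congr (gevrey s _); apply/funext => y; rewrite addr0.
apply: (BL_ext_coef s1 (gevrey_partial i gG) gZ) => k.
rewrite coef_partialG// (coefZ _ k (gevrey_BL gG)) (coef_mulc j k dc0 hc (BL_ek R l)).
have [->//|kl] := eqVneq (k 0 i) (l 0 i).
suff -> : conv j c (coef (ek l)) k = 0 by rewrite !mulr0.
rewrite /conv (_ : (fun r => _) = fun r => 0 * 0 :> R[i]).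
  have h0 : dec 1 0 (fun _ : K1 => 0 : R[i]) by move=> r; rewrite cmod0 mul0r.
  by rewrite (csumZ s1 0 ltr01 h0) mul0r.
apply/funext => r; rewrite coef_ek mul0r; case: eqP => [e|_]; last by rewrite mulr0.
move: kl; rewrite e !mxE (negbTE ij) subr0 eqxx //.
Qed.

Lemma ultra_conv u j dc Dc c k : ultradistribution s u -> 0 < dc -> dec dc Dc c ->
  u (fun y => cfun j c y * ek (- k) y) = conv j c (fun k => u (ek (- k))) k.
Proof.
move=> hu dc0 hc.
have e y : cfun j c y * ek (- k) y = csum (fun r => c r * ek (emb j r - k) y).
  rewrite cfunE mulrC -(csumZ s1 _ dc0 (D := Dc)).
    by congr csum; apply/funext => r; rewrite ekD; ring.
  by move=> r; rewrite cmodM cmod_ek mulr1.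
rewrite (funext e).
have bG : BL (fun y => csum (fun r => c r * ek (emb j r - k) y)).
  by rewrite -(funext e); apply: BLM; [exact: BL_cfun dc0 hc|exact: BL_ek].
have he (r : K1) : pw (emb j r - k) <= pw r + pw k.
  by apply: le_trans (pwD s1 _ _) _; rewrite pw_emb pwN.
have [_ ->] := ultra_series s1 hu dc0 hc (pw_ge0 s k) he bG.
by congr csum; apply/funext => r; rewrite opprB.
Qed.

Lemma dec_uniform (n : nat) (a : 'I_n -> K -> R[i]) :
  (forall j, exists d D, 0 < d /\ dec d D (a j)) ->
  exists d D, [/\ 0 < d, 0 < D & forall j, dec d D (a j)].
Proof.
move=> H; have key j : exists p : R * R, [/\ 0 < p.1, 0 <= p.2 & dec p.1 p.2 (a j)].
  by have [d [D [d0 h]]] := H j; exists (d, D); split => //=; exact: dec_ge0 h.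
have [p hp] := choice key.
exists (\big[Num.min/1]_j (p j).1), (1 + \sum_j (p j).2); split.
- by elim/big_ind : _ => // [x y x0 y0|j _]; [rewrite lt_min x0|have [] := hp j].
- by rewrite ltr_wpDr// sumr_ge0// => j _; have [] := hp j.
move=> j; have [p0 q0 h] := hp j.
have h' : dec (\big[Num.min/1]_j (p j).1) (p j).2 (a j).
  by apply: dec_weaken h; exact: bigmin_le.
move=> r; apply: le_trans (h' r) _; rewrite ler_wpM2r ?om_ge0//.
rewrite (bigD1 j)//= addrCA lerDl addr_ge0// sumr_ge0// => i _.
by have [] := hp i.
Qed.

End Convolution.

(** * Hypoellipticity as a statement on sequences *)

Section SequenceForm.
Variables (R : realType) (s : R) (n : nat) (a b : 'I_n -> R -> R).
Hypothesis s1 : 1 < s.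
Hypothesis ha : forall j : 'I_n, gevrey_circle s (a j).
Hypothesis hb : forall j : 'I_n, gevrey_circle s (b j).
Local Notation K := 'rV[int]_n.+1.
Local Notation dec := (dec s).

Definition ccoef (f : R -> R) : 'rV[int]_1 -> R[i] :=
  coef (fun y : 'rV[R]_1 => (f (y 0 0))%:C).

Definition ch (j : 'I_n) : 'rV[int]_1 -> R[i] :=
  fun r => ccoef (a j) r + 'i * ccoef (b j) r.

Lemma dec_ch : exists dc Dc, [/\ 0 < dc, 0 < Dc & forall j, dec dc Dc (ch j)].
Proof.
apply: dec_uniform => j.
have [d1 [D1 [d10 h1]]] := gevrey_coef s1 (ha j).
have [d2 [D2 [d20 h2]]] := gevrey_coef s1 (hb j).
have [d [d0 h1' h2']] := dec_two d10 d20 h1 h2.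
by exists d, (D1 + cmod ('i : R[i]) * D2); split => //; exact: decD h1' (decZ 'i h2').
Qed.

Lemma coefficient_cfun (j : 'I_n) (i : 'I_n.+1) :
  (fun y : 'rV[R]_n.+1 => a j (y 0 i) +i* b j (y 0 i)) = cfun i (ch j).
Proof.
have [d1 [D1 [d10 h1]]] := gevrey_coef s1 (ha j).
have [d2 [D2 [d20 h2]]] := gevrey_coef s1 (hb j).
have [d [d0 h1' h2']] := dec_two d10 d20 h1 h2.
apply/funext => y; rewrite /cfun /Fsum.
set z := const_mx _.
have -> : csum (fun k => ch j k * ek k z) =
    csum (fun k => ccoef (a j) k * ek k z + 'i * (ccoef (b j) k * ek k z)).
  by congr csum; apply/funext => k; rewrite /ch; ring.
rewrite (csumD s1 d0 (dec_ek z h1') (decZ _ (dec_ek z h2'))) (csumZ s1 _ d0 (dec_ek z h2')).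
have ea := congr1 (fun F => F z) (gevrey_inversion s1 (ha j)).
have eb := congr1 (fun F => F z) (gevrey_inversion s1 (hb j)).
rewrite /= mxE in ea; rewrite /= mxE in eb.
rewrite -[csum (fun k => ccoef (a j) k * _)]ea -[csum (fun k => ccoef (b j) k * _)]eb.
by apply: complexP; rewrite !ReIm /=; ring.
Qed.

Definition Lhat (j : 'I_n) (v : K -> R[i]) (k : K) : R[i] :=
  (k 0 (t_idx j))%:~R%:C * 'i * v k
  + (k 0 (x_idx n))%:~R%:C * 'i * conv (t_idx j) (ch j) v k.

Lemma vfield_cfun j u : vfield a b j u =
  dadd (dpartial (t_idx j) u) (dmul (cfun (t_idx j) (ch j)) (dpartial (x_idx n) u)).
Proof. by rewrite /vfield coefficient_cfun. Qed.

Lemma x_neq_t (j : 'I_n) : x_idx n != t_idx j.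
Proof. exact: neq_lift. Qed.

Lemma ultra_vfield j u : ultradistribution s u -> ultradistribution s (vfield a b j u).
Proof.
have [dc [Dc [dc0 _ hc]]] := dec_ch; move=> hu; rewrite vfield_cfun.
apply: (ultra_dadd s1); first exact: ultra_dpartial.
by apply: (ultra_dmul s1 _ dc0 (hc j)); exact: ultra_dpartial.
Qed.

Lemma vfield_seq j u k : ultradistribution s u ->
  vfield a b j u (ek (- k)) = Lhat j (fun k => u (ek (- k))) k.
Proof.
move=> hu; have [dc [Dc [dc0 _ hc]]] := dec_ch; have [lin _] := ultra_bounded s1 hu.
rewrite vfield_cfun /dadd /dmul /dpartial.
rewrite (partial_mulc_ek s1 _ (x_neq_t j) dc0 (hc j)) (partial_ek s1).
rewrite (linearGZ s1 _ lin); last exact: gevrey_ek.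
rewrite (linearGZ s1 _ lin); last exact: (gevrey_mulc s1 _ dc0 (hc j) (gevrey_ek s1 _)).
rewrite (ultra_conv s1 _ k hu dc0 (hc j)) /Lhat !mxE !rmorphN /=.
by rewrite !mulNr !opprK.
Qed.

Theorem hypo_seq : globally_hypoelliptic s (vfield a b) <->
  forall v : K -> R[i],
    (forall d, 0 < d -> exists D, dec (- d) D v) ->
    (forall j, exists d D, 0 < d /\ dec d D (Lhat j v)) ->
    exists d D, 0 < d /\ dec d D v.
Proof.
split=> [H v hv hL|H u hu hL].
  have [u hu eu] : exists2 u, ultradistribution s u & forall k, u (ek (- k)) = v k.
    apply: (ultra_of_growth s1) => d d0; have [D hD] := hv d d0.
    by exists D => //; exact: dec_ge0 hD.
  have : in_gevrey s u.
    apply: H => // j; apply/(in_gevreyP s1 (ultra_vfield j hu)).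
    have [d [D [d0 hd]]] := hL j; exists d, D; split => // k.
    by rewrite vfield_seq// (funext eu).
  move=> /(in_gevreyP s1 hu)[d [D [d0 hd]]]; exists d, D; split => // k.
  by rewrite -eu.
apply/(in_gevreyP s1 hu); apply: H.
  by move=> d d0; have [C C0 hC] := ultra_growth s1 hu d0; exists C.
move=> j; have /(in_gevreyP s1 (ultra_vfield j hu))[d [D [d0 hd]]] := hL j.
by exists d, D; split => // k; rewrite -vfield_seq.
Qed.

End SequenceForm.

(** * Equations on the circle *)

Section Bootstrap.
Variables (R : realType) (s : R).
Hypothesis s1 : 1 < s.
Local Notation K1 := 'rV[int]_1.
Local Notation om := (expweight s).
Local Notation pw := (weight s).
Local Notation rt := (sroot s).
Local Notation dec := (dec s).

Lemma pw1E (r : K1) : pw r = rt (r 0 0)%:~R.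
Proof. by rewrite /weight big_ord1. Qed.

Definition conv1 (c w : K1 -> R[i]) (r : K1) : R[i] := csum (fun q => c q * w (r - q)).

Lemma emb1 (r : K1) : emb ord0 r = r.
Proof. by apply/rowP => i; rewrite (ord1 i) mxE eqxx. Qed.

Lemma conv1E c w : conv1 c w = conv ord0 c w.
Proof. by apply/funext => r; congr csum; apply/funext => q; rewrite emb1. Qed.

(* Truncated weight used to absorb the convolution: [conv1 c] costs a factor
   [2 Dc tot (d0 / 2)], which division by [|r| > R0] reduces to [1 / 2]. *)
Lemma bootstrap (c w g : K1 -> R[i]) (d0 Dc d eta H X S G : R) :
  0 < d0 -> dec d0 Dc c -> 0 < d -> d <= d0 / 2 -> 0 <= eta -> eta <= d0 / 2 ->
  dec (- eta) H w -> dec d G g -> 0 <= S ->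
  (forall r : K1, `|(r 0 0)%:~R| * cmod (w r) <= cmod (g r) + `|X| * cmod (conv1 c w r)) ->
  forall R0 : R, R0 = 2 * (`|X| * (2 * Dc * tot s 1 (d0 / 2))) + 1 ->
  (forall r : K1, `|(r 0 0)%:~R| <= R0 -> cmod (w r) <= S) ->
  dec d (2 * (S * expR (d * rt R0) + G)) w.
Proof.
move=> d00 hc dpos dd0 eta0 etad0 hw hg S0 heq R0 R0E hS.
have Dc0 := dec_ge0 hc; have H0 := dec_ge0 hw; have G0 := dec_ge0 hg.
have d02 : 0 < d0 / 2 by rewrite divr_gt0.
set Kc := 2 * Dc * tot s 1 (d0 / 2) in R0E.
have Kc0 : 0 <= Kc by apply: mulr_ge0; [exact: mulr_ge0|exact: tot_ge0].
have R01 : 1 <= R0 by rewrite R0E lerDr; apply: mulr_ge0 => //; apply: mulr_ge0.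
set B := S * expR (d * rt R0) + G.
have B0 : 0 <= B by rewrite addr_ge0 ?mulr_ge0 ?expR_ge0.
move=> r1.
(* [vT] is the wanted weight [exp (d pw)], replaced at high frequencies by a multiple of
   [exp (- eta pw)], so that the a priori growth makes the supremum of [vT |w|] finite. [T] is
   chosen so that the two expressions coincide at [r1], the point where the bound is proved. *)
pose T := expR ((d + eta) * pw r1).
have T0 : 0 < T by exact: expR_gt0.
pose vT (r : K1) := Num.min (expR (d * pw r)) (T * expR (- eta * pw r)).
have vT0 r : 0 < vT r by rewrite lt_min expR_gt0 mulr_gt0 ?expR_gt0.
have vTle r : vT r <= expR (d * pw r) by rewrite ge_min lexx.
(* Submultiplicativity lets the convolution act on the weighted supremum; it is here that [d] and
   [eta] must not exceed [d0 / 2]. *)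
have vTs r q : vT r <= expR (d0 / 2 * pw q) * vT (r - q).
  have a := pwD s1 (r - q) q; rewrite subrK in a.
  have b := pwD s1 r (- q); rewrite pwN in b.
  have p0 := pw_ge0 s q.
  rewrite minr_pMr ?expR_ge0// le_min; apply/andP; split; rewrite ge_min; apply/orP.
    by left; rewrite -expRD ler_expR; nra.
  right; rewrite mulrCA ler_wpM2l ?(ltW T0)// -expRD ler_expR; nra.
pose E := [set x | exists r, x = vT r * cmod (w r)].
have Eub r : vT r * cmod (w r) <= T * H.
  apply: (@le_trans _ _ (T * expR (- eta * pw r) * (H * om (- eta) r))).
    by apply: ler_pM => //; rewrite ?cmod_ge0 ?ge_min ?lexx ?orbT//; exact: ltW.
  rewrite le_eqVlt; apply/orP; left; apply/eqP.
  rewrite (_ : T * _ * _ = T * H * (expR (- eta * pw r) * om (- eta) r)); last by ring.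
  by rewrite /expweight -expRD -mulrDl addrN mul0r expR0 mulr1.
have Esup : has_sup E.
  split; first by exists (vT 0 * cmod (w 0)); exists 0.
  by exists (T * H) => _ [r ->].
pose A := sup E.
have AE r : vT r * cmod (w r) <= A by apply: sup_upper_bound => //; exists r.
have A0 : 0 <= A by apply: le_trans (AE 0); rewrite mulr_ge0 ?cmod_ge0 ?ltW.
have convA r : vT r * cmod (conv1 c w r) <= Kc * A.
  have : cmod (conv1 c w r) <= 2 * (Dc * A / vT r) * tot s 1 (d0 / 2).
    apply: csum_norm => // q; rewrite cmodM.
    rewrite (_ : Dc * A / vT r * om (d0 / 2) q = Dc * A * om (d0 / 2) q / vT r); last by ring.
    rewrite ler_pdivlMr//.
    apply: (@le_trans _ _ (Dc * om d0 q * cmod (w (r - q)) * (expR (d0 / 2 * pw q) * vT (r - q)))).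
      apply: ler_pM => //; rewrite ?mulr_ge0 ?cmod_ge0 ?(ltW (vT0 _))//.
      by rewrite ler_wpM2r ?cmod_ge0.
    rewrite (_ : _ * _ * _ = Dc * (om d0 q * expR (d0 / 2 * pw q)) * (vT (r - q) * cmod (w (r - q)))); last by ring.
    have -> : om d0 q * expR (d0 / 2 * pw q) = om (d0 / 2) q.
      by rewrite /expweight -expRD; congr expR; field.
    rewrite (mulrAC Dc A) ler_wpM2l ?mulr_ge0 ?om_ge0//.
  move=> h; apply: (@le_trans _ _ (vT r * (2 * (Dc * A / vT r) * tot s 1 (d0 / 2)))).
    by rewrite ler_pM2l.
  rewrite le_eqVlt; apply/orP; left; apply/eqP; rewrite /Kc; field.
  by rewrite gt_eqF.
(* As [A] is finite, this inequality can be solved for it. *)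
have AB : A <= B + A / 2.
  apply: sup_le_ub; first by exists (vT 0 * cmod (w 0)); exists 0.
  move=> _ [r ->]; case: (lerP `|((r 0 0)%:~R : R)| R0) => rR.
    apply: (@le_trans _ _ (S * expR (d * rt R0))); last first.
      by rewrite /B -addrA lerDl addr_ge0 ?divr_ge0.
    rewrite mulrC; apply: ler_pM; rewrite ?cmod_ge0 ?(ltW (vT0 _)) ?hS//.
    apply: le_trans (vTle r) _; rewrite ler_expR ler_wpM2l ?(ltW dpos)// pw1E.
    by apply: rt_le => //; rewrite (ger0_norm (le_trans ler01 R01)).
  have r0 : 0 < `|((r 0 0)%:~R : R)| by apply: lt_trans rR; exact: lt_le_trans R01.
  rewrite -(ler_pM2l r0) mulrCA; apply: (@le_trans _ _ (vT r * (cmod (g r) + `|X| * cmod (conv1 c w r)))).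
    by rewrite ler_wpM2l ?(ltW (vT0 _)).
  have gG : vT r * cmod (g r) <= G.
    apply: (@le_trans _ _ (expR (d * pw r) * (G * om d r))).
      by apply: ler_pM => //; rewrite ?cmod_ge0//; exact: ltW.
    by rewrite mulrCA /expweight -expRD mulNr addrN expR0 mulr1.
  have cA : vT r * (`|X| * cmod (conv1 c w r)) <= `|X| * (Kc * A).
    by rewrite mulrCA ler_wpM2l.
  rewrite mulrDr; apply: (le_trans (lerD gG cA)).
  have GB : G <= B by rewrite /B lerDr mulr_ge0 ?expR_ge0.
  have XK : `|X| * Kc <= `|((r 0 0)%:~R : R)| / 2.
    by rewrite ler_pdivlMr//; move: rR; rewrite R0E; lra.
  have r1' : 1 <= `|((r 0 0)%:~R : R)| by apply: le_trans R01 (ltW rR).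
  rewrite mulrDr; apply: lerD.
    by apply: le_trans GB _; rewrite ler_peMl.
  by rewrite mulrA (mulrCA _ A) (mulrC A) ler_wpM2r.
have AB' : A <= 2 * B by lra.
have := AE r1.
have -> : vT r1 = expR (d * pw r1).
  by rewrite /vT /T -expRD mulNr mulrDl addrK minxx.
by rewrite -ler_pdivlMl ?expR_gt0// => h; apply: le_trans h _; rewrite -expRN -mulNr mulrC ler_wpM2r ?expR_ge0.
Qed.

End Bootstrap.

(** * Fourier series on the circle and the periodic equation *)

Section CircleSeries.
Variables (R : realType) (s : R).
Hypothesis s1 : 1 < s.
Local Notation K1 := 'rV[int]_1.
Local Notation om := (expweight s).
Local Notation pw := (weight s).
Local Notation rt := (sroot s).
Local Notation dec := (dec s).

Definition fn (c : K1 -> R[i]) (t : R) : R[i] := Fsum c (const_mx t).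

Lemma const_mx_coord (y : 'rV[R]_1) : const_mx (y 0 0) = y.
Proof. by apply/rowP => i; rewrite mxE (ord1 i). Qed.

Lemma fn_norm d D c t : 0 < d -> dec d D c -> cmod (fn c t) <= 2 * D * tot s 1 d.
Proof. exact: Fsum_norm. Qed.

Lemma fn_periodic c t : fn c (t + 2 * pi) = fn c t.
Proof.
have := periodic_Fsum c ord0 (const_mx t : 'rV[R]_1); rewrite /fn => <-.
by congr Fsum; apply/rowP => i; rewrite add_basisE !mxE (ord1 i) eqxx.
Qed.

Lemma fn_cder d D c t : 0 < d -> dec d D c ->
  cder (fn c) t (fn (fun r => (r 0 0)%:~R%:C * 'i * c r) t).
Proof.
move=> d0 hc; have [hp e] := partial_Fsum s1 ord0 d0 hc.
have := has_partial_cder (0 : 'rV[R]_1) t hp; rewrite e.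
have E x : set_coord (0 : 'rV[R]_1) ord0 x = const_mx x.
  by apply/rowP => i; rewrite set_coordE (ord1 i) eqxx mxE.
by under eq_fun do rewrite E; rewrite E.
Qed.

Lemma fn_mul d D d' D' c v t : 0 < d -> dec d D c -> 0 < d' -> dec d' D' v ->
  fn c t * fn v t = fn (conv1 c v) t.
Proof.
move=> d0 hc d'0 hv.
have gv := gevrey_Fsum s1 d'0 hv.
have gcv := gevrey_mulc s1 ord0 d0 hc gv.
have cv : coef (Fsum v) = v by apply/funext => q; apply: (coef_Fsum s1 q d'0 hv).
have ec r : coef (fun y => cfun (ord0 : 'I_1) c y * Fsum v y) r = conv1 c v r.
  rewrite conv1E -{2}cv; exact: (coef_mulc s1 ord0 r d0 hc (gevrey_BL gv)).
have h := gevrey_inversion s1 gcv; rewrite (funext ec) in h.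
have {}h := congr1 (fun F => F (const_mx t)) h.
by rewrite /fn -h /cfun mxE.
Qed.

Lemma coef_fn_norm d D v M r : 0 < d -> dec d D v -> (forall t, cmod (fn v t) <= M) ->
  cmod (v r) <= 2 * M.
Proof.
move=> d0 hv hM; rewrite -(coef_Fsum s1 r d0 hv) -(expr1 2).
apply: coef_norm; first exact: BL_Fsum d0 hv.
by move=> y; rewrite -(const_mx_coord y); exact: hM.
Qed.

(* The primitive [t c_0 + sum_(r <> 0) c_r exp (i r t) / (i r)] of [fn c]. *)
Definition prim (c : K1 -> R[i]) (t : R) : R[i] :=
  t%:C * c 0 + fn (fun r => if r 0 0 == 0 then 0 else c r * (- 'i) * ((r 0 0)%:~R^-1)%:C) t.

Lemma fn_const z t : fn (fun r : K1 => if r == 0 then z else 0) t = z.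
Proof.
rewrite /fn /Fsum (@csum_single R s 1 s1 1 (cmod z) _ 0) ?ltr01//.
- by rewrite eqxx ek0 mulr1.
- move=> r; rewrite cmodM cmod_ek mulr1; case: eqP => [->|_].
    by rewrite /expweight /weight big_ord1 mxE rt0// mulr0 expR0 mulr1.
  by rewrite cmod0 mulr_ge0 ?cmod_ge0 ?om_ge0.
- by move=> r /negbTE ->; rewrite mul0r.
Qed.

Lemma K1_eq0 (r : K1) : (r == 0) = (r 0 0 == 0).
Proof.
apply/eqP/eqP => [->|h]; first by rewrite mxE.
by apply/rowP => i; rewrite (ord1 i) mxE.
Qed.

Lemma prim_cder d D c t : 0 < d -> dec d D c -> cder (prim c) t (fn c t).
Proof.
move=> d0 hc; have D0 := dec_ge0 hc.
set q := (fun r : K1 => if r 0 0 == 0 then 0 else c r * (- 'i) * ((r 0 0)%:~R^-1)%:C).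
have hq : dec d D q.
  move=> r; rewrite /q; case: eqP => [_|/eqP r0]; first by rewrite cmod0 mulr_ge0 ?om_ge0.
  rewrite !cmodM cmodN cmodi mulr1 cmodR; apply: le_trans (hc r); rewrite ler_piMr ?cmod_ge0//.
  rewrite normfV invf_le1 ?normr_gt0 ?intr_eq0// -intr_norm ler1z.
  by rewrite -gtz0_ge1 normr_gt0.
have h0 : dec d (cmod (c 0)) (fun r : K1 => if r == 0 then c 0 else 0).
  move=> r; case: eqP => [->|_]; last by rewrite cmod0 mulr_ge0 ?cmod_ge0 ?om_ge0.
  by rewrite /expweight /weight big_ord1 mxE rt0// mulr0 expR0 mulr1.
have hdq := dec_deriv s1 ord0 d0 hq.
have d20 : 0 < d / 2 by rewrite divr_gt0.
have h0' : dec (d / 2) (cmod (c 0)) (fun r : K1 => if r == 0 then c 0 else 0).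
  by apply: dec_weaken h0; lra.
have -> : fn c t = c 0 + fn (fun r => (r 0 0)%:~R%:C * 'i * q r) t.
  rewrite -{1}(fn_const (c 0) t) /fn /Fsum -(csumD s1 d20 (dec_ek _ h0') (dec_ek _ hdq)).
  congr csum; apply/funext => r; rewrite -mulrDl K1_eq0 /q; congr (_ * _).
  case: eqP => [r0|/eqP r0].
    by rewrite mulr0 addr0; congr c; apply/eqP; rewrite K1_eq0 r0.
  rewrite add0r; apply: complexP; rewrite !ReIm; field; by rewrite intr_eq0.
apply: cderD; last exact: fn_cder d0 hq.
have := cderZ (c 0) (cder_id t); rewrite mulr1.
by congr cder; apply/funext => x; rewrite mulrC.
Qed.

Lemma prim_period c t : prim c (t + 2 * pi) = prim c t + (2 * pi)%:C * c 0.
Proof. by rewrite /prim fn_periodic rmorphD /=; ring. Qed.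

Lemma cmod_cexp_i (X : R) z : cmod (cexp (X%:C * 'i * z)) = expR (- (X * complex.Im z)).
Proof. by rewrite cmod_cexp !ReIm; congr expR; ring. Qed.

(* Variation of constants over one period. *)
Lemma apriori (c v g : K1 -> R[i]) (X d D d' D' e G M : R) :
  0 < d -> dec d D c -> 0 < d' -> dec d' D' v -> 0 < e -> dec e G g ->
  (forall r : K1, (r 0 0)%:~R%:C * 'i * v r + X%:C * 'i * conv1 c v r = g r) ->
  (forall t, cmod (fn g t) <= M) ->
  (forall t, 0 <= X * complex.Im (fn c t)) \/ (forall t, X * complex.Im (fn c t) <= 0) ->
  exists2 sg : R, sg = 1 \/ sg = -1 & (sg = 1 -> forall t, 0 <= X * complex.Im (fn c t)) /\
    (sg = -1 -> forall t, X * complex.Im (fn c t) <= 0) /\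
    forall t, cmod (fn v t) * cmod (cexp ((sg * (2 * pi) * X)%:C * 'i * c 0) - 1) <= 4 * pi * M.
Proof.
move=> d0 hc d'0 hv e0 hg heq hM hsg.
(* Integrating factor: the derivative of [Z] is [g] times the exponential, and over one period [Z]
   is multiplied by [exp (2 pi i X c_0)]. *)
pose Z t := fn v t * cexp (X%:C * 'i * prim c t).
have cZ t : cder Z t (fn g t * cexp (X%:C * 'i * prim c t)).
  have h1 := fn_cder t d'0 hv.
  have h2 := cder_cexp (cderZ (X%:C * 'i) (prim_cder t d0 hc)).
  have := cderM h1 h2; congr cder.
  have -> : fn g t = fn (fun r => (r 0 0)%:~R%:C * 'i * v r) t + X%:C * 'i * (fn c t * fn v t).
    rewrite (fn_mul t d0 hc d'0 hv).
    have hd := dec_deriv s1 ord0 d'0 hv.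
    pose ee := Num.min (d' / 2) (Num.min (d / 2) d').
    have ee0 : 0 < ee by rewrite !lt_min !divr_gt0.
    have ed : `|ee| < d.
      rewrite gtr0_norm// !gt_min; apply/orP; right; apply/orP; left.
      by rewrite ltr_pdivrMr// ltr_pMr// ltr1n.
    have hve : dec ee D' v by apply: dec_weaken hv; rewrite !ge_min lexx !orbT.
    have hcv := conv_norm s1 ord0 ed hc hve; rewrite -conv1E in hcv.
    have hde : dec ee (D' * (s / (d' / 2)) `^ s) (fun r => (r 0 0)%:~R%:C * 'i * v r).
      by apply: dec_weaken hd; rewrite ge_min lexx.
    rewrite /fn /Fsum -(csumZ s1 _ ee0 (dec_ek _ hcv)) -(csumD s1 ee0 (dec_ek _ hde) (decZ _ (dec_ek _ hcv))).
    by congr csum; apply/funext => r; rewrite -heq; ring.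
  by ring.
have dIm (t : R) : is_derive t 1 (fun x => complex.Im (prim c x)) (complex.Im (fn c t)).
  exact: (prim_cder t d0 hc).2.
have dX (t : R) : is_derive t 1 (fun x => X * complex.Im (prim c x)) (X * complex.Im (fn c t)).
  by have := is_deriveZ X (dIm t).
have M0 : 0 <= M by apply: le_trans (hM 0); exact: cmod_ge0.
have pi20 : 0 <= 2 * pi :> R by rewrite ltW ?pi2_gt0.
have cper t : cexp (X%:C * 'i * prim c (t + 2 * pi)) =
   cexp (X%:C * 'i * prim c t) * cexp ((1 * (2 * pi) * X)%:C * 'i * c 0).
  by rewrite -cexpD prim_period; congr cexp; rewrite mul1r rmorphM /=; ring.
(* The modulus of the exponential is [exp (- X Im (prim c))]. If [X Im c >= 0] it is largest at the
   left end, so the interval is [[t, t + 2 * pi]] and [sg = 1]; otherwise the interval is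
   [[t - 2 * pi, t]] and [sg = -1]. *)
case: hsg => hs; [exists 1; first by left|exists (-1); first by right].
  split=> //; split=> [h1|t]; first by lra.
  have bnd x : t <= x <= t + 2 * pi -> cmod (fn g x * cexp (X%:C * 'i * prim c x)) <=
      M * cmod (cexp (X%:C * 'i * prim c t)).
    move=> /andP[tx _]; rewrite cmodM; apply: ler_pM => //; try exact: cmod_ge0.
    rewrite !cmod_cexp_i ler_expR lerN2 -subr_ge0.
    have := @mvt_ge R (fun x => X * complex.Im (prim c x)) _ 0 t x tx (fun y _ => dX y).
    by rewrite mul0r; apply=> y _; exact: hs.
  have tt : t <= t + 2 * pi by rewrite lerDl.
  have := cder_lip tt (fun x _ => cZ x) bnd.
  rewrite /Z fn_periodic cper (_ : _ - _ = fn v t * (cexp ((1 * (2 * pi) * X)%:C * 'i * c 0) - 1) * cexp (X%:C * 'i * prim c t)); last by ring.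
  have ce : 0 < cmod (cexp (X%:C * 'i * prim c t)) by rewrite cmod_cexp expR_gt0.
  move: (cexp (X%:C * 'i * prim c t)) ce (cexp _ - 1) => E ce E1; rewrite !cmodM => h; rewrite -(ler_pM2r ce); apply: le_trans h _; rewrite le_eqVlt; apply/orP; left; apply/eqP.
  by ring.
split; first by move=> h1; exfalso; lra.
split=> // t.
have bnd x : t - 2 * pi <= x <= t -> cmod (fn g x * cexp (X%:C * 'i * prim c x)) <=
    M * cmod (cexp (X%:C * 'i * prim c t)).
  move=> /andP[_ xt]; rewrite cmodM; apply: ler_pM => //; try exact: cmod_ge0.
  rewrite !cmod_cexp_i ler_expR lerN2 -subr_ge0.
  have dX' (y : R) : is_derive y 1 (fun x => - (X * complex.Im (prim c x))) (- (X * complex.Im (fn c y))).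
    exact: is_deriveN.
  have := @mvt_ge R (fun x => - (X * complex.Im (prim c x))) _ 0 x t xt (fun y _ => dX' y).
  rewrite mul0r => /(_ _); rewrite opprK addrC; apply.
  by move=> y _; rewrite oppr_ge0.
have tt : t - 2 * pi <= t by rewrite gerBl.
have := cder_lip tt (fun x _ => cZ x) bnd.
have e1 := fn_periodic v (t - 2 * pi); rewrite subrK in e1.
have e2 := cper (t - 2 * pi); rewrite subrK in e2.
have e3 : cexp (X%:C * 'i * prim c (t - 2 * pi)) =
    cexp (X%:C * 'i * prim c t) * cexp ((-1 * (2 * pi) * X)%:C * 'i * c 0).
  have z (p q : R[i]) : p = - q -> cexp p * cexp q = 1.
    by move=> ->; rewrite -cexpD addNr cexp0.
  rewrite e2 -(mulrA (cexp _)) z ?mulr1//.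
  rewrite (_ : -1 * (2 * pi) * X = - (1 * (2 * pi) * X)); last by ring.
  by rewrite rmorphN /= !mulNr opprK.
rewrite /Z -e1 e3 (_ : _ - _ = - (fn v t * (cexp ((-1 * (2 * pi) * X)%:C * 'i * c 0) - 1) * cexp (X%:C * 'i * prim c t))); last by ring.
have ce : 0 < cmod (cexp (X%:C * 'i * prim c t)) by rewrite cmod_cexp expR_gt0.
move: (cexp (X%:C * 'i * prim c t)) ce (cexp _ - 1) => E ce E1; rewrite cmodN !cmodM => h; rewrite -(ler_pM2r ce); apply: le_trans h _; rewrite le_eqVlt; apply/orP; left; apply/eqP.
by ring.
Qed.

End CircleSeries.

(** * Sufficiency *)

Section Lines.
Variables (R : realType) (s : R) (m : nat).
Hypothesis s1 : 1 < s.
Local Notation K := 'rV[int]_m.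
Local Notation K1 := 'rV[int]_1.
Local Notation om := (expweight s).
Local Notation pw := (weight s).
Local Notation rt := (sroot s).
Local Notation dec := (dec s).

(** The lattice line through [k] in direction [i]. [L_j] couples only coefficients on such a line,
    with [xi] as a parameter, which reduces it to an equation on the circle. *)
Definition upd (k : K) (i : 'I_m) (r : K1) : K :=
  \row_l (if l == i then r 0 0 else k 0 l).

Lemma upd_id k i : upd k i (const_mx (k 0 i)) = k.
Proof. by apply/rowP => l; rewrite !mxE; case: eqP => [->|]. Qed.

Lemma updE k i r : upd k i r 0 i = r 0 0.
Proof. by rewrite mxE eqxx. Qed.

Lemma upd_neq k i l r : l != i -> upd k i r 0 l = k 0 l.
Proof. by move=> /negbTE h; rewrite mxE h. Qed.

Lemma conv_upd i (c : K1 -> R[i]) (v : K -> R[i]) k r :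
  conv i c v (upd k i r) = conv1 c (fun r => v (upd k i r)) r.
Proof.
congr csum; apply/funext => q; congr (_ * v _); apply/rowP => l; rewrite !mxE.
by case: eqP => // _; rewrite subr0.
Qed.

Lemma pw_upd_le k i r : pw (upd k i r) <= pw k + pw r.
Proof.
rewrite pw1E /weight (bigD1 i)//= [X in _ <= X + _](bigD1 i)//= updE addrC.
rewrite lerD2r; apply: ler_wpDl; first exact: rt_ge0.
by apply: ler_sum => l li; rewrite upd_neq.
Qed.

Lemma om_upd d k i l r : 0 <= d -> l != i ->
  om d (upd k i r) <= expR (- d * rt (k 0 l)%:~R) * om d r.
Proof.
move=> d0 li; rewrite -expRD -mulrDr ler_expR !mulNr lerN2 ler_wpM2l// pw1E.
rewrite /weight (bigD1 l)//= upd_neq// lerD2l (bigD1 i) 1?eq_sym//= updE lerDl.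
by rewrite sumr_ge0// => j _; exact: rt_ge0.
Qed.

Lemma om_upd1 d k i r : 0 <= d -> om d (upd k i r) <= om d r.
Proof.
move=> d0; rewrite ler_expR !mulNr lerN2 ler_wpM2l// pw1E.
by rewrite -{1}(updE k i r); exact: pw_ge.
Qed.

End Lines.

Section RealData.
Variables (R : realType) (s : R) (n : nat) (a b : 'I_n -> R -> R).
Hypothesis s1 : 1 < s.
Hypothesis ha : forall j : 'I_n, gevrey_circle s (a j).
Hypothesis hb : forall j : 'I_n, gevrey_circle s (b j).

Lemma fn_ch j t : fn (ch a b j) t = a j t +i* b j t.
Proof.
have := congr1 (fun F => F (const_mx t)) (coefficient_cfun s1 ha hb j ord0).
by rewrite /fn /cfun /= !mxE => <-.
Qed.

Lemma ccoef0 (f : R -> R) : gevrey_circle s f -> ccoef f 0 = (mean f)%:C.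
Proof.
move=> hf; rewrite /ccoef /coef oppr0 expr1.
have -> : (fun y : 'rV[R]_1 => (f (y 0 0))%:C * ek 0 y) = fun y => (f (y 0 0))%:C.
  by apply/funext => y; rewrite ek0 mulr1.
rewrite torus_integralE enum_ordSl (_ : enum 'I_0 = [::]) /=; last first.
  by apply: size0nil; rewrite size_enum_ord.
rewrite /Iop /mean.
have -> : cintegral (fun x => (f (set_coord (0 : 'rV[R]_1) ord0 x 0 0))%:C) = (RI f)%:C.
  rewrite cintegralE (_ : RI (fun x => _) = RI f); last first.
    by apply: eq_RI => x; rewrite set_coordE eqxx.
  by congr (_ +i* _); apply: etrans (RI_cst 0) _; rewrite mulr0.
by rewrite -rmorphM.
Qed.

Lemma ch0E j : ch a b j 0 = mean (a j) +i* mean (b j).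
Proof.
rewrite /ch !ccoef0//; move: (mean (a j)) (mean (b j)) => p q.
by apply: complexP; rewrite !ReIm [RHS]/=; ring.
Qed.

End RealData.

Section Sufficiency.
Variables (R : realType) (s : R) (n : nat) (a b : 'I_n -> R -> R).
Hypothesis s1 : 1 < s.
Hypothesis ha : forall j : 'I_n, gevrey_circle s (a j).
Hypothesis hb : forall j : 'I_n, gevrey_circle s (b j).
Local Notation K := 'rV[int]_n.+1.
Local Notation K1 := 'rV[int]_1.
Local Notation om := (expweight s).
Local Notation pw := (weight s).
Local Notation rt := (sroot s).
Local Notation dec := (dec s).
Local Notation ch := (ch a b).
Local Notation Lseq := (Lhat a b).

Lemma Lseq_upd j (v : K -> R[i]) k r :
  Lseq j v (upd k (t_idx j) r) = (r 0 0)%:~R%:C * 'i * v (upd k (t_idx j) r) +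
    (k 0 (x_idx n))%:~R%:C * 'i * conv1 (ch j) (fun r => v (upd k (t_idx j) r)) r.
Proof. by rewrite /Lhat conv_upd updE upd_neq ?x_neq_t. Qed.

(** Qualitative only: the constant depends on [k]. The lemma makes the coefficients on a line those
    of a genuine function of [t_j], to which the estimate over one period applies. *)
Lemma line_decay (v : K -> R[i]) j k d D :
  (forall d, 0 < d -> exists D, dec (- d) D v) -> 0 < d -> dec d D (Lseq j v) ->
  exists e E, 0 < e /\ dec e E (fun r => v (upd k (t_idx j) r)).
Proof.
move=> hv d0 hL; have D0 := dec_ge0 hL.
have [dc [Dc [dc0 Dc0 hc]]] := dec_ch s1 ha hb.
pose dd := Num.min d (dc / 2).
have dc2 : 0 < dc / 2 by rewrite divr_gt0.
have dd0 : 0 < dd by rewrite lt_min d0.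
have [H hH] := hv _ dc2; have H0 := dec_ge0 hH.
pose H1 := H * expR (dc / 2 * pw k).
have H10 : 0 <= H1 by rewrite mulr_ge0 ?expR_ge0.
have hw : dec (- (dc / 2)) H1 (fun r => v (upd k (t_idx j) r)).
  move=> r; apply: le_trans (hH _) _; rewrite -mulrA ler_wpM2l// -expRD ler_expR opprK.
  by rewrite -mulrDr ler_wpM2l ?(ltW dc2)// pw_upd_le.
have hg : dec dd D (fun r => Lseq j v (upd k (t_idx j) r)).
  move=> r; apply: le_trans (hL _) _; rewrite ler_wpM2l//.
  by apply: le_trans (om_upd1 _ _ _ _ (ltW d0)) _ => //; apply: om_le; rewrite ge_min lexx.
pose R0 : R := 2 * (`|(k 0 (x_idx n))%:~R| * (2 * Dc * tot s 1 (dc / 2))) + 1.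
exists dd; eexists; split=> //.
apply: (@bootstrap R s s1 (ch j) _ _ dc Dc dd (dc / 2) H1 (k 0 (x_idx n))%:~R
  (H1 * expR (dc / 2 * rt R0)) D dc0 (hc j) dd0 _ (ltW dc2) _ hw hg _ _ R0 erefl) => //.
- by rewrite ge_min lexx orbT.
- by rewrite mulr_ge0 ?expR_ge0.
- move=> r; rewrite Lseq_upd -[`|_ r| * _]mulr1.
  set c := conv1 _ _ _; set w := v _.
  have := cmodB ((r 0 0)%:~R%:C * 'i * w + (k 0 (x_idx n))%:~R%:C * 'i * c) ((k 0 (x_idx n))%:~R%:C * 'i * c).
  by rewrite addrK !cmodM cmodi !cmodR !mulr1.
move=> r rR; apply: le_trans (hw r) _; rewrite ler_wpM2l// ler_expR opprK ler_wpM2l ?(ltW dc2)//.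
by rewrite pw1E; apply: rt_le => //; apply: le_trans rR (ler_norm _).
Qed.

(* [sg] is the sign of [X b_j]; it tells on which side of a point the equation
   is integrated over one period, and hence which small divisor occurs. *)
Definition nonresonant := forall e : R, 0 < e -> exists2 c : R, 0 < c &
  forall X : int, X != 0 -> exists2 j : 'I_n,
    (forall t, 0 <= b j t) \/ (forall t, b j t <= 0) &
    forall sg : R, sg = 1 \/ sg = -1 ->
      (sg = 1 -> forall t, 0 <= X%:~R * b j t) -> (sg = -1 -> forall t, X%:~R * b j t <= 0) ->
      c * expR (- e * rt X%:~R) <= cmod (cexp ((sg * (2 * pi) * X%:~R)%:C * 'i * ch j 0) - 1).

(** The data decay at the rate [d] in [xi]; nonresonance is used with [e = d / 2], so that half of
    that rate survives the division. *)
Lemma uniform_decay (v : K -> R[i]) d D :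
  (forall d, 0 < d -> exists D, dec (- d) D v) -> 0 < d -> (forall j, dec d D (Lseq j v)) ->
  nonresonant -> exists2 C : R, 0 <= C & forall k : K, k 0 (x_idx n) != 0 ->
    cmod (v k) <= C * expR (- (d / 2) * rt (k 0 (x_idx n))%:~R).
Proof.
move=> hv d0 hL nr; have d20 : 0 < d / 2 by rewrite divr_gt0.
have [c c0 H] := nr _ d20.
have [D0|] := lerP 0 D; last first.
  move=> Dn; exists 0 => // k k0; have [j _ _] := H _ k0.
  by have := dec_ge0 (hL j); rewrite leNgt Dn.
have T0 := @tot_ge0 R s s1 1 d d0.
exists (2 * (4 * pi * (2 * D * tot s 1 d)) / c).
  apply: divr_ge0; last exact: ltW.
  by apply: mulr_ge0 => //; apply: mulr_ge0; [rewrite mulr_ge0 ?pi_ge0|apply: mulr_ge0 => //; apply: mulr_ge0].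
move=> k k0; have [j bj hj] := H _ k0.
set X : int := k 0 (x_idx n) in k0 hj *.
have [e [E [e0 hw]]] := line_decay k hv d0 (hL j).
set w := fun r => _ in hw.
pose g r := Lseq j v (upd k (t_idx j) r).
pose G := D * expR (- d * rt X%:~R).
have hg : dec d G g.
  move=> r; apply: le_trans (hL _ _) _; rewrite -mulrA ler_wpM2l//.
  by apply: om_upd; rewrite ?x_neq_t// ltW.
have [dc [Dc [dc0 Dc0 hc]]] := dec_ch s1 ha hb.
pose M := 2 * G * tot s 1 d.
have hM t : cmod (fn g t) <= M by exact: fn_norm.
have eq (r : K1) : (r 0 0)%:~R%:C * 'i * w r + (X%:~R : R)%:C * 'i * conv1 (ch j) w r = g r.
  by rewrite /g Lseq_upd.
have sgn : (forall t, 0 <= X%:~R * complex.Im (fn (ch j) t)) \/ (forall t, X%:~R * complex.Im (fn (ch j) t) <= 0).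
  have fb t : complex.Im (fn (ch j) t) = b j t by rewrite (fn_ch s1 ha hb).
  case: (lerP 0 (X%:~R : R)) => X0; case: bj => bj.
  - by left=> t; rewrite fb mulr_ge0.
  - by right=> t; rewrite fb mulr_ge0_le0.
  - by right=> t; rewrite fb mulr_le0_ge0// ltW.
  - by left=> t; rewrite fb mulr_le0// ltW.
have [sg hsg [p1 [p2 ap]]] := apriori s1 dc0 (hc j) e0 hw d0 hg eq hM sgn.
have fb t : complex.Im (fn (ch j) t) = b j t by rewrite (fn_ch s1 ha hb).
have hQ : c * expR (- (d / 2) * rt X%:~R) <= cmod (cexp ((sg * (2 * pi) * X%:~R)%:C * 'i * ch j 0) - 1).
  by apply: hj => // h t; rewrite -fb; [exact: p1|exact: p2].
have B0 : 0 < c * expR (- (d / 2) * rt X%:~R) by rewrite mulr_gt0 ?expR_gt0.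
have wb t : cmod (fn w t) <= 4 * pi * M / (c * expR (- (d / 2) * rt X%:~R)).
  rewrite ler_pdivlMr//; apply: le_trans (ap t); rewrite ler_wpM2l ?cmod_ge0//.
have := coef_fn_norm s1 (const_mx (k 0 (t_idx j))) e0 hw wb; rewrite /w upd_id => h.
apply: le_trans h _; rewrite le_eqVlt; apply/orP; left; apply/eqP.
have -> : M = 2 * D * tot s 1 d * (expR (- (d / 2) * rt X%:~R) * expR (- (d / 2) * rt X%:~R)).
  by rewrite -expRD -mulrDl -opprD -splitr /M /G; ring.
by field; rewrite !gt_eqF ?expR_gt0.
Qed.

(** At [xi = 0] each [L_j] is multiplication by [i tau_j], and some [|tau_j|] is at least 1 unless
    [k = 0]; the term [cmod (v 0)] accounts for this exception. *)
Lemma zero_mode_decay (v : K -> R[i]) d D : 0 < d -> (forall j, dec d D (Lseq j v)) -> 0 <= D ->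
  forall k : K, k 0 (x_idx n) = 0 -> cmod (v k) <= (D + cmod (v 0)) * om d k.
Proof.
move=> d0 hL D0 k k0; have [->|kn] := eqVneq k 0.
  rewrite /expweight (_ : pw 0 = 0) ?mulr0 ?expR0 ?mulr1 ?lerDr//.
  by rewrite /weight big1// => l _; rewrite mxE rt0.
have [j kj] : exists j : 'I_n, k 0 (t_idx j) != 0.
  apply/existsP; apply: contra_neqT kn => /existsPn h; apply/rowP => l; rewrite mxE.
  by case: (unliftP (x_idx n) l) => [j|] -> //; apply/eqP; have := h j; rewrite negbK.
apply: (@le_trans _ _ (D * om d k)); last by rewrite ler_wpM2r ?om_ge0// lerDl cmod_ge0.
apply: le_trans (hL j k); rewrite /Lhat k0 mul0r mul0r addr0 !cmodM cmodi mulr1 cmodR.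
by rewrite ler_peMl ?cmod_ge0// -intr_norm ler1z -gtz0_ge1 normr_gt0.
Qed.

Theorem nonresonant_decay (v : K -> R[i]) :
  (forall d, 0 < d -> exists D, dec (- d) D v) ->
  (forall j, exists d D, 0 < d /\ dec d D (Lseq j v)) ->
  nonresonant -> exists d D, 0 < d /\ dec d D v.
Proof.
move=> hv /(dec_uniform)[d [D [d0 D0 hL]]] nr.
have [C C0 hC] := uniform_decay hv d0 hL nr.
have [dc [Dc [dc0 Dc0 hc]]] := dec_ch s1 ha hb.
pose Kc := 2 * Dc * tot s 1 (dc / 2).
have dc2 : 0 < dc / 2 by rewrite divr_gt0.
have Kc0 : 0 <= Kc by apply: mulr_ge0; [rewrite mulr_ge0 ?ltW|exact: tot_ge0].
(* Rate of decay in [tau_j]. The last bound gives [f * rt R0 <= (d / 4) |xi|^(1/s) + f] for the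
   threshold [R0] of the bootstrap, so that the factor [exp (- (d / 2) |xi|^(1/s))] already gained
   pays for it. *)
pose f := Num.min (d / 4) (Num.min (dc / 2) (d / 4 / (rt (2 * Kc) + 1))).
have rK0 : 0 < rt (2 * Kc) + 1 by rewrite ltr_wpDl ?rt_ge0.
have f0 : 0 < f by rewrite !lt_min dc2 !divr_gt0.
have fd4 : f <= d / 4 by rewrite ge_min lexx.
have fdc : f <= dc / 2 by rewrite !ge_min lexx orbT.
have frK : f * (rt (2 * Kc) + 1) <= d / 4.
  by rewrite -ler_pdivlMr// !ge_min lexx !orbT.
pose Y := 2 * (C * expR f + D) + (D + cmod (v 0)).
have Y1 : 0 <= 2 * (C * expR f + D).
  by apply: mulr_ge0 => //; apply: addr_ge0; [rewrite mulr_ge0 ?expR_ge0|exact: ltW].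
have Y2 : 0 <= D + cmod (v 0) by rewrite addr_ge0 ?cmod_ge0 ?ltW.
have Y0 : 0 <= Y by exact: addr_ge0.
suff H k : cmod (v k) <= Y * om (f / n.+2%:R) k.
  by exists (f / n.+2%:R), Y; split => //; rewrite divr_gt0.
have [k0|k0] := eqVneq (k 0 (x_idx n)) 0.
  apply: le_trans (zero_mode_decay d0 hL (ltW D0) k0) _.
  apply: ler_pM => //; rewrite ?om_ge0 ?lerDr//; apply: om_le.
  apply: (@le_trans _ _ f); first by rewrite ler_pdivrMr//; apply: ler_peMr; [exact: ltW|rewrite ler1n].
  by apply: le_trans fd4 _; lra.
have e1 : cmod (v k) <= C * expR (- (d / 2) * rt (k 0 (x_idx n))%:~R) by exact: hC.
have CY : C <= Y.
  apply: (@le_trans _ _ (2 * (C * expR f + D))); last by rewrite lerDl.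
  have : C <= C * expR f by rewrite ler_peMr// -[leLHS]expR0 ler_expR ltW.
  by lra.
(* Decay at rate [f] in each coordinate separately suffices: in [xi] it comes from [uniform_decay],
   in each [tau_j] from the bootstrap. *)
have Yk := @dec_of_coords R n.+1 s (cmod (v k)) Y f k f0 Y0; apply: Yk => [|l].
  apply: le_trans e1 (le_trans _ CY); rewrite ler_piMr// -[leRHS]expR0 ler_expR.
  by rewrite mulNr oppr_le0 mulr_ge0 ?rt_ge0// divr_ge0 ?ltW.
case: (unliftP (x_idx n) l) => [j|] ->; last first.
  apply: le_trans e1 _; apply: ler_pM; rewrite ?expR_ge0// ler_expR !mulNr lerN2.
  rewrite ler_wpM2r ?rt_ge0//; lra.
rewrite -/(t_idx j).
set X : int := k 0 (x_idx n) in k0 e1 *.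
have X1 : 1 <= `|(X%:~R : R)| by rewrite -intr_norm ler1z -gtz0_ge1 normr_gt0.
pose R0 : R := 2 * (`|X%:~R| * Kc) + 1.
pose S := C * expR (- (d / 2) * rt X%:~R).
pose G := D * expR (- d * rt X%:~R).
have hw : dec (- (dc / 2)) S (fun r => v (upd k (t_idx j) r)).
  move=> r; apply: le_trans (hC _ _) _; first by rewrite upd_neq ?x_neq_t.
  rewrite upd_neq ?x_neq_t// -/X -/S ler_peMr ?mulr_ge0 ?expR_ge0//.
  by rewrite -[leLHS]expR0 ler_expR opprK mulr_ge0 ?pw_ge0 ?ltW.
have hg : dec f G (fun r => Lseq j v (upd k (t_idx j) r)).
  move=> r; apply: le_trans (hL _ _) _; rewrite -mulrA ler_wpM2l ?(ltW D0)//.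
  apply: le_trans (om_upd s _ _ (ltW d0) (x_neq_t j)) _; rewrite ler_wpM2l ?expR_ge0//.
  by apply: om_le; lra.
have := @bootstrap R s s1 (ch j) _ _ dc Dc f (dc / 2) S X%:~R S G dc0 (hc j) f0 fdc (ltW dc2) (lexx _) hw hg.
have S0 : 0 <= S by apply: mulr_ge0 => //; exact: expR_ge0.
move=> /(_ S0).
have eqn (r : K1) : `|(r 0 0)%:~R : R| * cmod (v (upd k (t_idx j) r)) <= cmod (Lseq j v (upd k (t_idx j) r)) +
    `|X%:~R| * cmod (conv1 (ch j) (fun r => v (upd k (t_idx j) r)) r).
  rewrite Lseq_upd -/X -[`|_ r| * _]mulr1.
  set c := conv1 _ _ _; set w := v _.
  have := cmodB ((r 0 0)%:~R%:C * 'i * w + X%:~R%:C * 'i * c) (X%:~R%:C * 'i * c).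
  by rewrite addrK !cmodM cmodi !cmodR !mulr1.
move=> /(_ eqn R0 erefl) bs.
have {bs} := bs _ (const_mx (k 0 (t_idx j))).
rewrite upd_id /expweight pw1E mxE => bs; apply: (le_trans (bs _)) => {bs} [r _|].
  by apply: le_trans (hC _ _) _; rewrite upd_neq ?x_neq_t.
rewrite ler_wpM2r ?expR_ge0//; apply: (@le_trans _ _ (2 * (C * expR f + D))); last by rewrite lerDl.
have rX : 0 <= rt X%:~R by exact: rt_ge0.
have rR : rt R0 <= rt X%:~R * rt (2 * Kc) + 1.
  have rt1 : rt 1 = 1 by rewrite /sroot normr1 powR1.
  have -> : R0 = `|X%:~R| * (2 * Kc) + 1 by rewrite /R0; ring.
  by apply: le_trans (rtD s1 _ _) _; rewrite rtM rt_norm rt1.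
rewrite ler_pM2l//; apply: lerD; last first.
  rewrite /G ler_piMr ?(ltW D0)// -[leRHS]expR0 ler_expR mulNr oppr_le0.
  by apply: mulr_ge0 => //; exact: ltW.
rewrite /S -mulrA -expRD ler_wpM2l// ler_expR.
have fR : f * rt R0 <= f * (rt X%:~R * rt (2 * Kc) + 1) by apply: ler_wpM2l => //; exact: ltW.
have fX : f * (rt (2 * Kc) + 1) * rt X%:~R <= d / 4 * rt X%:~R by rewrite ler_wpM2r.
have f1 : 0 <= f * rt X%:~R by apply: mulr_ge0 => //; exact: ltW.
have d1 : 0 <= d * rt X%:~R by apply: mulr_ge0 => //; exact: ltW.
have e : f * (rt X%:~R * rt (2 * Kc) + 1) = f * (rt (2 * Kc) + 1) * rt X%:~R - f * rt X%:~R + f by ring.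
move: fR fX f1 d1; rewrite {}e; move: (f * rt R0) (f * (_ + 1) * _) (f * _) => p q r.
move=> h1 h2 h3 h4; have e2 : - (d / 2) * rt X%:~R = - (2 * (d / 4 * rt X%:~R)) by field.
have e3 : d * rt X%:~R = 4 * (d / 4 * rt X%:~R) by field.
move: h2 h4; rewrite {}e2 {}e3; move: (d / 4 * _) => z; lra.
Qed.

End Sufficiency.

(** * Small divisors *)

Section Nonresonance.
Variable R : realType.

Lemma periodic_monotone (f df : R -> R) : (forall x : R, is_derive x (1 : R) f (df x)) ->
  (forall x, f (x + 2 * pi) = f x) -> (forall x, 0 <= df x) -> forall x, df x = 0.
Proof.
move=> hd hp h0 x.
have mono (y z : R) : y <= z -> f y <= f z.
  move=> yz; rewrite -subr_ge0 -[leLHS](mul0r (z - y)).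
  by apply: (mvt_ge yz (fun t _ => hd t)) => t _; exact: h0.
have fE (y : R) : x - pi <= y <= x + pi -> f y = f (x - pi).
  move=> /andP[h1 h2]; apply/eqP; rewrite eq_le; apply/andP; split; last exact: mono.
  have := hp (x - pi); rewrite (_ : x - pi + 2 * pi = x + pi); last by ring.
  by move=> <-; exact: mono.
have hx : is_derive x (1 : R) (cst (f (x - pi))) (df x).
  apply: near_eq_is_derive (hd x); apply/nbhs_normP; exists 1 => //= y /= h.
  apply: fE; have := pi_ge2 R; move: h; rewrite ltr_norml; lra.
by case: hx => _ <-; rewrite derive_cst.
Qed.

(** Up to 1/2 the cosine is at least 1/2; afterwards [sin] increases from a value of at least 1/4,
    while [y / 8 <= 1/4] because [pi / 2 <= 2]. *)
Lemma sin_ge (y : R) : 0 <= y <= pi / 2 -> y / 8 <= sin y.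
Proof.
move=> /andP[y0 yp].
have half (z : R) : 0 <= z <= 1 / 2 -> z / 2 <= sin z.
  move=> /andP[z0 z2].
  have := @mvt_ge R sin cos (1 / 2) 0 z z0 (fun t _ => is_derive_sin t).
  rewrite sin0 !subr0 mul1r mulrC; apply => t /andP[t0 tz].
  have := cos_lip t 0; rewrite cos0 subr0 (ger0_norm t0) ler_norml => /andP[h _]; lra.
have [y2|y2] := lerP y (1 / 2).
  by apply: le_trans (half y _); [lra|rewrite y0].
have s4 : 1 / 4 <= sin (1 / 2 : R) by apply: le_trans (half _ _); [lra|apply/andP; split; lra].
have := @mvt_ge R sin cos 0 (1 / 2) y (ltW y2) (fun t _ => is_derive_sin t).
rewrite mul0r subr_ge0 => H.
have p4 : pi / 2 <= 2 :> R by have [/andP[_ h] _] := pihalf_02_cos_pihalf R.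
apply: le_trans (le_trans s4 _); first by lra.
apply: H => t /andP[t1 t2]; apply: cos_ge0_pihalf; apply/andP; split; lra.
Qed.

Lemma cmod_cis_sub1 (x : R) : cmod (cis x - 1) = 2 * `|sin (x / 2)|.
Proof.
have -> : cis x - 1 = cis (x / 2) * ((2 * sin (x / 2))%:C * 'i).
  have -> : (1 : R[i]) = cis (x / 2) * cis (- (x / 2)) by rewrite cisN.
  rewrite {1}(splitr x) cisD -mulrBr; congr (_ * _).
  by rewrite /cis cosN sinN; apply: complexP; rewrite !ReIm /=; ring.
by rewrite !cmodM cmod_cis cmodi mul1r mulr1 cmodR normrM ger0_norm.
Qed.

Lemma cis_sub1_ge (x : R) : `|x| <= pi -> `|x| / 8 <= cmod (cis x - 1).
Proof.
move=> xp; rewrite cmod_cis_sub1.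
have -> : `|sin (x / 2)| = `|sin (`|x| / 2)|.
  by case: (ger0P x) => x0 //; rewrite mulNr sinN normrN.
have h : `|x| / 2 / 8 <= sin (`|x| / 2).
  by apply: sin_ge; rewrite divr_ge0//= ler_pM2r.
by have := ler_norm (sin (`|x| / 2)); lra.
Qed.

Lemma positive_min (T : eqType) (r : seq T) (P : pred T) (f : T -> R) :
  (forall x, P x -> 0 < f x) -> exists2 c, 0 < c & forall x, x \in r -> P x -> c <= f x.
Proof.
move=> fP; elim: r => [|y r [c c0 hc]]; first by exists 1.
have [Py|nPy] := boolP (P y); last first.
  exists c => // x; rewrite inE => /orP[/eqP ->|]; first by rewrite (negbTE nPy).
  exact: hc.
exists (Num.min c (f y)); first by rewrite lt_min c0 fP.
move=> x; rewrite inE => /orP[/eqP -> _|xr Px]; rewrite ge_min ?lexx ?orbT//.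
by rewrite hc.
Qed.

(** All but finitely many pairs violate the Liouville inequality; at each remaining pair with
    [q != 0] the distance is positive because the vector is not rational, so a minimum over a finite
    list gives [c]. *)
Lemma diophantine (s : R) m (v : 'rV[R]_m) : ~ rational_vector v -> ~ exp_liouville s v ->
  forall e : R, 0 < e -> exists2 c : R, 0 < c & forall (p : 'rV[int]_m) (q : int), q != 0 ->
    c * expR (- e * sroot s q%:~R) <= `|q%:~R *: v - map_mx intr p|.
Proof.
move=> nr nl e e0.
pose A := [set pq : 'rV[int]_m * int |
      `|pq.2%:~R *: v - map_mx intr pq.1| < expR (- e * sroot s pq.2%:~R)].
have fA : finite_set A.
  by apply: contrapT => h; apply: nl; split => //; exists e.
have [r rE] := (finite_seqP A).1 fA.
have [] := @positive_min _ r (fun pq => pq.2 != 0) (fun pq => `|pq.2%:~R *: v - map_mx intr pq.1|).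
  move=> [p q] /= q0; rewrite normr_gt0; apply/eqP => h; apply: nr.
  exists (\row_i ((p 0 i)%:~R / q%:~R)); apply/rowP => i; rewrite !mxE.
  have := congr1 (fun M : 'rV[R]_m => M 0 i) h; rewrite !mxE => hi.
  rewrite fmorph_div !rmorph_int; apply: (mulfI (x := q%:~R)); first by rewrite intr_eq0.
  rewrite mulrCA divff ?intr_eq0// mulr1; apply/eqP; rewrite -subr_eq0; exact/eqP.
move=> c c0 hc; exists (Num.min 1 c) => [|p q q0]; first by rewrite lt_min ltr01.
have rq : 0 <= sroot s q%:~R by exact: rt_ge0.
have eq1 : expR (- e * sroot s q%:~R) <= 1.
  by rewrite -[leRHS]expR0 ler_expR mulNr oppr_le0 mulr_ge0// ltW.
case: (ltrP `|q%:~R *: v - map_mx intr p| (expR (- e * sroot s q%:~R))) => h; last first.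
  by apply: le_trans h; rewrite ler_piMl ?expR_ge0// ge_min lexx.
have : (p, q) \in r by have : A (p, q) by []; rewrite rE.
move=> /hc /(_ q0) /=; apply: le_trans; apply: (@le_trans _ _ (Num.min 1 c)).
  by rewrite ler_piMr// le_min ler01 ltW.
by rewrite ge_min lexx orbT.
Qed.

End Nonresonance.

Section Conditions.
Variables (R : realType) (s : R) (n : nat) (a b : 'I_n -> R -> R).
Hypothesis s1 : 1 < s.
Hypothesis ha : forall j : 'I_n, gevrey_circle s (a j).
Hypothesis hb : forall j : 'I_n, gevrey_circle s (b j).

(** If the mean vanished, the primitive of [b_j] would be periodic and monotone, hence constant. *)
Lemma sign_mean_neq0 j : keeps_sign (b j) -> ~ (forall x, b j x = 0) -> mean (b j) != 0.
Proof.
move=> ks nz; apply/eqP => m0; apply: nz.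
have [dc [Dc [dc0 Dc0 hc]]] := dec_ch s1 ha hb.
pose P x := complex.Im (prim (ch a b j) x).
have dP (x : R) : is_derive x (1 : R) P (b j x).
  by have := (prim_cder s1 x dc0 (hc j)).2; rewrite (fn_ch s1 ha hb).
have pP x : P (x + 2 * pi) = P x.
  rewrite /P prim_period (ch0E ha hb) cImD cImM cReR cImR /= m0; ring.
case: ks => h; first exact: (periodic_monotone dP pP h).
have dP' (x : R) : is_derive x (1 : R) (fun x => - P x) (- b j x) by exact: is_deriveN.
move=> x; apply/eqP; rewrite -oppr_eq0; apply/eqP; move: x; apply: (periodic_monotone dP').
  by move=> y; rewrite pP.
by move=> y; rewrite oppr_ge0.
Qed.

(** The sign of [X b_j] makes the exponential in the divisor a contraction, of modulus at most
    [exp (- 2 pi |mean b_j|) < 1] for every [X != 0]: the divisor is bounded below without any loss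
    in [X]. *)
Lemma nonresonant_sign j : keeps_sign (b j) -> ~ (forall x, b j x = 0) -> nonresonant s a b.
Proof.
move=> ks nz e e0; have m0 := sign_mean_neq0 ks nz.
have [dc [Dc [dc0 Dc0 hc]]] := dec_ch s1 ha hb.
have pi2 := pi2_gt0 R.
have q1 : expR (- (2 * pi * `|mean (b j)|)) < 1.
  by rewrite -[ltRHS]expR0 ltr_expR oppr_lt0 mulr_gt0 ?normr_gt0.
exists (1 - expR (- (2 * pi * `|mean (b j)|))); first by rewrite subr_gt0.
move=> X X0; exists j => // sg hsg h1 h2.
have X1 : 1 <= `|(X%:~R : R)| by rewrite -intr_norm ler1z -gtz0_ge1 normr_gt0.
(* The sign condition is integrated over one period. *)
have sX : 0 <= sg * X%:~R * mean (b j).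
  pose P x := complex.Im (prim (ch a b j) x).
  have dP (x : R) : is_derive x (1 : R) (fun x => (sg * X%:~R) * P x) (sg * X%:~R * b j x).
    have h := (prim_cder s1 x dc0 (hc j)).2; rewrite (fn_ch s1 ha hb) /= in h.
    exact: (is_deriveZ _ h).
  have : 0 * (2 * pi - 0) <= sg * X%:~R * P (2 * pi) - sg * X%:~R * P 0.
    apply: (mvt_ge (ltW pi2) (fun x _ => dP x)) => x _; case: hsg => e1.
      by rewrite e1 mul1r h1.
    by rewrite e1 mulN1r mulNr oppr_ge0 h2.
  have pE : prim (ch a b j) (2 * pi) = prim (ch a b j) (0 + 2 * pi) by rewrite add0r.
  rewrite mul0r /P pE prim_period (ch0E ha hb) cImD cImM cReR cImR /=.
  set z := complex.Im _; rewrite (_ : _ - _ = 2 * pi * (sg * X%:~R * mean (b j))); last by ring.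
  by rewrite pmulr_rge0.
have hn : `|sg| = 1 by case: hsg => ->; rewrite ?normrN normr1.
have ce : cmod (cexp ((sg * (2 * pi) * X%:~R)%:C * 'i * ch a b j 0)) <= expR (- (2 * pi * `|mean (b j)|)).
  rewrite cmod_cexp_i (ch0E ha hb) /= ler_expR lerN2.
  rewrite (_ : sg * _ * _ * _ = 2 * pi * (sg * X%:~R * mean (b j))); last by ring.
  rewrite ler_pM2l// -(ger0_norm sX) !normrM hn mul1r ler_peMl//.
have := cmodB (cexp ((sg * (2 * pi) * X%:~R)%:C * 'i * ch a b j 0)) (cexp ((sg * (2 * pi) * X%:~R)%:C * 'i * ch a b j 0) - 1).
rewrite opprB addrCA subrr addr0 cmod1 => h.
set c := 1 - _; have c0 : 0 <= c by rewrite subr_ge0 ltW.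
apply: (@le_trans _ _ c).
  by rewrite ler_piMr// -[leRHS]expR0 ler_expR mulNr oppr_le0 mulr_ge0 ?rt_ge0 ?ltW.
by move: h ce; rewrite /c; lra.
Qed.

(** The index [j] depends on [X]: it is one where [X a_j0] is far from the integers, by at least
    half of the bound for the maximum norm. The constant 16 accounts for this half and for the
    factor 1/8 in [cis_sub1_ge]. *)
Lemma nonresonant_diophantine : ~ rational_vector (mean_vector a (real_indices b)) ->
  ~ exp_liouville s (mean_vector a (real_indices b)) -> nonresonant s a b.
Proof.
move=> nr nl e e0; have [c c0 hc] := diophantine nr nl e0.
exists (c / 16); first by rewrite divr_gt0.
move=> X X0.
(* Nearest integers to the entries of [X a_J0]. *)
pose p : 'rV[int]_#|real_indices b| := \row_i Num.floor (X%:~R * mean_vector a (real_indices b) 0 i + 1 / 2).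
have h := hc p X X0.
set B := c * expR _ in h; have B0 : 0 < B by rewrite mulr_gt0 ?expR_gt0.
have [i hi] : exists i, B / 2 < `|X%:~R * mean_vector a (real_indices b) 0 i - (p 0 i)%:~R|.
  apply: contrapT => hn.
  have : `|X%:~R *: mean_vector a (real_indices b) - map_mx intr p| <= B / 2.
    apply: norm_rV_le; first by rewrite divr_ge0// ltW.
    move=> i; rewrite !mxE leNgt; apply/negP => hi; apply: hn; exists i.
    by rewrite /p /mean_vector !mxE.
  by move=> h'; have := le_trans h h'; lra.
pose j := enum_val i.
have bj t : b j t = 0.
  by have := enum_valP i; rewrite inE => /asboolP.
exists j; first by left=> t; rewrite bj.
move=> sg hsg _ _.
have mb : mean (b j) = 0.
  by rewrite /mean -/(RI (b j)) (eq_RI (g := fun=> 0) bj) RI_cst !mulr0.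
rewrite (ch0E ha hb) mb.
set th := X%:~R * mean (a j) - (p 0 i)%:~R.
have hth : `|th| <= 1 / 2.
  rewrite /th /p !mxE -/j ler_norml.
  have := ge_floor (X%:~R * mean (a j) + 1 / 2); have := lt_succ_floor (X%:~R * mean (a j) + 1 / 2).
  rewrite intrD; lra.
have -> : cexp ((sg * (2 * pi) * X%:~R)%:C * 'i * (mean (a j) +i* 0)) = cis (sg * (2 * pi * th)).
  rewrite /cexp !ReIm /= (_ : expR _ = 1); last by rewrite -[RHS]expR0; congr expR; ring.
  rewrite mul1r (_ : _ + _ = sg * (2 * pi * th) + sg * ((p 0 i)%:~R * (2 * pi))); last first.
    by rewrite /th; ring.
  rewrite cisD; case: hsg => ->; first by rewrite !mul1r cis2piz mulr1.
  rewrite (_ : -1 * ((p 0 i)%:~R * _) = (- p 0 i)%:~R * (2 * pi)) ?cis2piz ?mulr1//.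
  by rewrite mulrNz; ring.
apply: le_trans (cis_sub1_ge _); last first.
  rewrite normrM (_ : `|sg| = 1) ?mul1r; last by case: hsg => ->; rewrite ?normrN normr1.
  rewrite normrM gtr0_norm ?pi2_gt0//.
  by have := pi_gt0 R; nra.
rewrite normrM (_ : `|sg| = 1) ?mul1r; last by case: hsg => ->; rewrite ?normrN normr1.
rewrite normrM gtr0_norm ?pi2_gt0//.
have hi' : B / 2 < `|th| by rewrite /th /p mxE; move: hi; rewrite !mxE.
have := pi_ge2 R; rewrite -/B (_ : c / 16 * _ = B / 16); last by rewrite /B; field.
by nra.
Qed.

End Conditions.

(** * Gevrey bump functions *)

Section Bump.
Variables (R : realType) (s : R).
Hypothesis s1 : 1 < s.
Local Notation rt := (sroot s).
Local Notation dec := (dec s).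
Implicit Types (g : R -> R) (M dl r h l : R).

(** Convolution with half masses at [l] and [- l]: it multiplies the [k]-th Fourier coefficient by
    [cos (k l)], widens the support by [l] and keeps nonnegativity. *)
Definition avg l g (t : R) : R := (g (t + l) + g (t - l)) / 2.

(** [M] bounds both the values and the Lipschitz constant, [r] is the radius of the support modulo
    [2 * pi], and the lower bound [dl] on [[-h, h]] keeps the limit of the averages from
    vanishing. *)
Definition bumpy M dl r h g : Prop :=
  [/\ forall t, 0 <= g t <= M,
      forall x y, `|g x - g y| <= M * `|x - y|,
      forall t, g (t + 2 * pi) = g t,
      forall t, r <= t <= 2 * pi - r -> g t = 0 &
      forall t, `|t| <= h -> dl <= g t].

Lemma bumpy_weaken M dl r r' h h' g : r <= r' -> h' <= h -> bumpy M dl r h g -> bumpy M dl r' h' g.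
Proof.
move=> rr hh [h1 h2 h3 h4 h5]; split => // t ht; first by apply: h4; lra.
by apply: h5; exact: le_trans hh.
Qed.

Lemma bumpy_avg M dl r h l g : 0 <= l -> bumpy M dl r h g -> bumpy M dl (r + l) (h - l) (avg l g).
Proof.
move=> l0 [h1 h2 h3 h4 h5]; rewrite /avg; split.
- by move=> t; have := h1 (t + l); have := h1 (t - l); lra.
- move=> x y; rewrite (_ : _ - _ = ((g (x + l) - g (y + l)) + (g (x - l) - g (y - l))) / 2); last by field.
  rewrite normrM (@ger0_norm _ 2^-1)// ler_pdivrMr//; apply: le_trans (ler_normD _ _) _.
  have := h2 (x + l) (y + l); have := h2 (x - l) (y - l).
  rewrite (_ : x + l - (y + l) = x - y); last by ring.
  rewrite (_ : x - l - (y - l) = x - y); last by ring.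
  by lra.
- by move=> t; rewrite addrAC h3 (addrAC t) h3.
- move=> t ht; rewrite !h4 ?addr0 ?mul0r//; lra.
move=> t; rewrite ler_norml => ht.
have : dl <= g (t + l) by apply: h5; rewrite ler_norml; lra.
have : dl <= g (t - l) by apply: h5; rewrite ler_norml; lra.
by lra.
Qed.

Lemma avg_close M dl r h l g t : 0 <= l -> bumpy M dl r h g -> `|avg l g t - g t| <= M * l.
Proof.
move=> l0 [_ h2 _ _ _].
rewrite /avg (_ : _ - _ = ((g (t + l) - g t) + (g (t - l) - g t)) / 2); last by field.
rewrite normrM (@ger0_norm _ 2^-1)// ler_pdivrMr//; apply: le_trans (ler_normD _ _) _.
have := h2 (t + l) t; have := h2 (t - l) t.
rewrite (_ : t + l - t = l); last by ring.
rewrite (_ : t - l - t = - l); last by ring.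
by rewrite normrN (ger0_norm l0); lra.
Qed.

Lemma iter_avg M dl r h l g m : 0 <= l -> bumpy M dl r h g ->
  bumpy M dl (r + m%:R * l) (h - m%:R * l) (iter m (avg l) g) /\
  forall t, `|iter m (avg l) g t - g t| <= M * (m%:R * l).
Proof.
move=> l0 hg; elim: m => [|m [IH1 IH2]] /=.
  by rewrite !mul0r addr0 subr0 mulr0; split => // t; rewrite subrr normr0.
split; first by apply: bumpy_weaken (bumpy_avg l0 IH1); rewrite -[m.+1]addn1 natrD; lra.
move=> t; rewrite (_ : _ - g t = (avg l (iter m (avg l) g) t - iter m (avg l) g t) + (iter m (avg l) g t - g t)); last by ring.
apply: le_trans (ler_normD _ _) _.
have := avg_close t l0 IH1; have := IH2 t; rewrite -[m.+1]addn1 natrD; lra.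
Qed.

Definition lift1 g (y : 'rV[R]_1) : R[i] := (g (y 0 0))%:C.

Lemma BL_lift M dl r h g : bumpy M dl r h g -> BL (lift1 g).
Proof.
move=> [h1 h2 _ _ _]; exists M => [y|y z].
  by have /andP[a0 aM] := h1 (y 0 0); rewrite cmodR ger0_norm.
have M0 : 0 <= M by have /andP[a b] := h1 0; exact: le_trans b.
rewrite /lift1 -rmorphB cmodR; apply: le_trans (h2 _ _) _; rewrite ler_wpM2l//.
by have := le_norm_rV (y - z) 0; rewrite !mxE.
Qed.

Lemma periodic_lift M dl r h g : bumpy M dl r h g -> periodic (lift1 g).
Proof.
by move=> [_ _ h3 _ _] k y; rewrite /lift1 add_basisE (ord1 k) eqxx h3.
Qed.

Lemma coef_avg M dl r h l g k : 0 <= l -> bumpy M dl r h g ->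
  coef (lift1 (avg l g)) k = (cos ((k 0 0)%:~R * l))%:C * coef (lift1 g) k.
Proof.
move=> l0 hg; have bl := BL_lift hg; have pl := periodic_lift hg.
have -> : lift1 (avg l g) = fun y => (1 / 2)%:C * (lift1 g (y + l *: basis_vec R ord0) + lift1 g (y + (- l) *: basis_vec R ord0)).
  apply/funext => y; rewrite /lift1 !add_basisE eqxx -rmorphD -rmorphM /avg.
  by congr (_%:C); field.
rewrite coefZ; last by apply: BLD; exact: BL_translate.
rewrite coefD; try exact: BL_translate.
rewrite !coef_translate// mulrN -mulrDl mulrA; congr (_ * _).
by rewrite /cis cosN sinN; apply: complexP; rewrite !ReIm /=; field.
Qed.

Lemma coef_iter_avg M dl r h l g m k : 0 <= l -> bumpy M dl r h g ->
  coef (lift1 (iter m (avg l) g)) k = ((cos ((k 0 0)%:~R * l)) ^+ m)%:C * coef (lift1 g) k.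
Proof.
move=> l0 hg; elim: m => [|m IH] /=; first by rewrite expr0 mul1r.
have [h1 _] := iter_avg m l0 hg.
by rewrite (coef_avg k l0 h1) IH mulrA -rmorphM exprS.
Qed.

Lemma ler_cos (x y : R) : 0 <= x -> x <= y -> y <= pi -> cos y <= cos x.
Proof.
move=> x0 xy yp; rewrite leNgt ltr_cos -?leNgt// in_itv/=; lra.
Qed.

Lemma base_bump r : 0 < r -> r <= pi ->
  exists dl, [/\ 0 < dl & bumpy 2 dl r (r / 2) (fun t => Num.max 0 (cos t - cos r))].
Proof.
move=> r0 rp; have r2 : cos r < cos (r / 2) by rewrite ltr_cos ?in_itv/=; lra.
exists (cos (r / 2) - cos r); rewrite subr_gt0; split => //; split.
- move=> t; rewrite le_max lexx/= ge_max; have := cos_le1 t; have := cos_geN1 r; lra.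
- move=> x y; have h := cos_lip x y.
  have : `|Num.max 0 (cos x - cos r) - Num.max 0 (cos y - cos r)| <= `|x - y|.
    move: h; move: (cos x) (cos y) (cos r) `|x - y| => p q u z; rewrite !ler_norml => /andP[h1 h2].
    rewrite /Num.max /Order.max; case: ltP => a1; case: ltP => a2; apply/andP; split; lra.
  have := normr_ge0 (x - y); lra.
- by move=> t; rewrite mulr_natl cosD2pi.
- move=> t /andP[t1 t2]; apply/max_idPl; rewrite subr_le0.
  have [tp|tp] := lerP t pi; first by apply: ler_cos => //; exact: ltW.
  have -> : cos t = cos (2 * pi - t) by rewrite addrC mulr_natl cosD2pi cosN.
  by apply: ler_cos; [exact: ltW|lra|lra].
move=> t th; rewrite le_max; apply/orP; right; rewrite lerD2r.
have -> : cos t = cos `|t| by case: (ger0P t) => // _; rewrite cosN.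
by apply: ler_cos => //; lra.
Qed.

(** The hypothesis [s > 1] enters the construction here: [2^(i/s)] averages of width [2^-i] for
    every [i] have a finite total width exactly when [2^(1/s) < 2]. *)
Lemma rt2_lt2 : rt 2 < 2.
Proof.
rewrite /sroot ger0_norm// /powR gt_eqF// -[ltRHS](@lnK R 2) ?posrE// ltr_expR.
by rewrite gtr_pMl ?ln_gt0 ?ltr1n// invf_lt1// (lt_trans _ s1).
Qed.

Lemma rtX (x : R) i : rt (x ^+ i) = rt x ^+ i.
Proof.
elim: i => [|i IH]; first by rewrite !expr0 /sroot normr1 powR1.
by rewrite !exprS rtM IH.
Qed.

Lemma le_geometric (x C th : R) : 0 < th -> th < 1 -> (forall N, x <= C * th ^+ N) -> x <= 0.
Proof.
move=> t0 t1 h; rewrite leNgt; apply/negP => x0.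
have : th^-1 - 1 <= 0.
  apply: (@bounded_powers _ _ (C / x)) => N.
  rewrite (_ : 1 + (th^-1 - 1) = th^-1); last by ring.
  rewrite exprVn ler_pdivlMr// mulrC ler_pdivrMr ?exprn_gt0//; exact: h.
by rewrite subr_le0 invf_le1// leNgt t1.
Qed.

(** Block [i] consists of about [2^(i/s)] averages of step [lam / 2^i]. On frequencies between [2^i]
    and [2^(i+1)] each of them contributes a factor at most [cos lam], which gives
    [exp (- c |k|^(1/s))] in total. *)
Fixpoint smoothing (lam : R) (f : R -> R) (N : nat) : R -> R :=
  if N is i.+1 then
    iter (Num.truncn (rt (2 ^+ i))).+1 (avg (lam / 2 ^+ i)) (smoothing lam f i)
  else f.

(* The total displacement of the averages of block [i] is at most [2 lam th ^ i]
   with [th = 2 ^ (1 / s - 1)]; they sum up to [A]. *)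
Lemma smoothing_bumpy M dl r h A f N (th := rt 2 / 2) (lam := A * (1 - th) / 2) : 0 <= A -> bumpy M dl r h f ->
  bumpy M dl (r + (A - A * th ^+ N)) (h - (A - A * th ^+ N)) (smoothing lam f N) /\
  forall t, `|smoothing lam f N.+1 t - smoothing lam f N t| <= M * (A * th ^+ N - A * th ^+ N.+1).
Proof.
move=> A0 hf.
have th0 : 0 < th by rewrite divr_gt0// (lt_le_trans ltr01)//; apply: rt_ge1 => //; rewrite ger0_norm// ler1n.
have th1 : th < 1 by rewrite ltr_pdivrMr// mul1r rt2_lt2.
have lam0 : 0 <= lam by rewrite /lam divr_ge0// mulr_ge0// subr_ge0 ltW.
have M0 : 0 <= M by have [h1 _ _ _ _] := hf; have /andP[a b] := h1 0; exact: le_trans b.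
have l0 i : 0 <= lam / 2 ^+ i by rewrite divr_ge0 ?exprn_ge0.
have step i : (Num.truncn (rt (2 ^+ i))).+1%:R * (lam / 2 ^+ i) <= A * th ^+ i - A * th ^+ i.+1.
  have -> : A * th ^+ i - A * th ^+ i.+1 = 2 * rt (2 ^+ i) * (lam / 2 ^+ i).
    rewrite rtX exprS /lam /th expr_div_n; field.
    by rewrite expf_neq0.
  apply: ler_wpM2r; first exact: l0.
  have r1 : 1 <= rt (2 ^+ i) by apply: rt_ge1 => //; rewrite ger0_norm ?exprn_ge0// exprn_ege1// ler1n.
  have /andP[t1 _] := truncn_itv (le_trans ler01 r1).
  by rewrite -[(_).+1]addn1 natrD; lra.
have key i : bumpy M dl (r + (A - A * th ^+ i)) (h - (A - A * th ^+ i)) (smoothing lam f i).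
  elim: i => [|i IH]; first by rewrite expr0 mulr1 subrr addr0 subr0.
  have [h1 _] := iter_avg (Num.truncn (rt (2 ^+ i))).+1 (l0 i) IH.
  by apply: bumpy_weaken h1; have := step i; lra.
split => // t; have [_ h2] := iter_avg (Num.truncn (rt (2 ^+ N))).+1 (l0 N) (key N).
by apply: le_trans (h2 t) _; rewrite ler_wpM2l.
Qed.

Lemma cos_pow_le (lam x : R) (m : nat) : 0 <= lam -> lam <= `|x| -> `|x| <= 2 * lam -> lam <= pi / 4 ->
  `|cos x ^+ m| <= expR (- (1 - cos lam) * m%:R).
Proof.
move=> l0 lx xl lp; have p0 := pi_gt0 R.
have -> : cos x = cos `|x| by case: (ger0P x) => // _; rewrite cosN.
have c1 : cos `|x| <= cos lam by apply: ler_cos => //; lra.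
have c0 : 0 <= cos `|x| by apply: cos_ge0_pihalf; have := normr_ge0 x; lra.
rewrite expRM_natr ger0_norm ?exprn_ge0//; apply: lerXn2r; rewrite ?nnegrE ?expR_ge0//.
by apply: le_trans c1 (le_trans _ (expR_ge1Dx _)); lra.
Qed.

Lemma coef_smoothing_le M dl r h A f N (k : 'rV[int]_1) (th := rt 2 / 2) (lam := A * (1 - th) / 2) : 0 <= A -> bumpy M dl r h f ->
  cmod (coef (lift1 (smoothing lam f N.+1)) k) <=
  `|cos ((k 0 0)%:~R * (lam / 2 ^+ N)) ^+ (Num.truncn (rt (2 ^+ N))).+1| * cmod (coef (lift1 (smoothing lam f N)) k).
Proof.
move=> A0 hf; have [hN _] := smoothing_bumpy N A0 hf; rewrite -/th -/lam in hN.
have th1 : th < 1 by rewrite ltr_pdivrMr// mul1r rt2_lt2.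
have l0 : 0 <= lam / 2 ^+ N by rewrite divr_ge0 ?exprn_ge0// /lam divr_ge0// mulr_ge0// subr_ge0 ltW.
have -> : smoothing lam f N.+1 =
  iter (Num.truncn (rt (2 ^+ N))).+1 (avg (lam / 2 ^+ N)) (smoothing lam f N) by [].
by rewrite (coef_iter_avg _ k l0 hN) cmodM cmodR.
Qed.

(** The block of index [trunc_log 2 |k|] provides the decay; all other factors are at most 1 in
    modulus. The condition on [N] says that this block has been applied. *)
Lemma coef_smoothing_decay M dl r h A f N (k : 'rV[int]_1) (th := rt 2 / 2) (lam := A * (1 - th) / 2) : 0 <= A -> lam <= pi / 4 ->
  bumpy M dl r h f -> (trunc_log 2 (absz (k ord0 ord0)) < N)%N ->
  cmod (coef (lift1 (smoothing lam f N)) k) <= 2 * M * expR (- ((1 - cos lam) / 2) * rt (k 0 0)%:~R).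
Proof.
move=> A0 lp hf; have M0 : 0 <= M by have [h1 _ _ _ _] := hf; have /andP[a b] := h1 0; exact: le_trans b.
have th1 : th < 1 by rewrite ltr_pdivrMr// mul1r rt2_lt2.
have l0 : 0 <= lam by rewrite /lam divr_ge0// mulr_ge0// subr_ge0 ltW.
have bound i : cmod (coef (lift1 (smoothing lam f i)) k) <= 2 * M.
  have [hi _] := smoothing_bumpy i A0 hf; rewrite -(expr1 2); apply: coef_norm; first exact: BL_lift hi.
  by move=> y; have [h1 _ _ _ _] := hi; have /andP[a b] := h1 (y 0 0); rewrite cmodR ger0_norm.
have [k0 _|k0] := eqVneq (k 0 0) 0.
  by rewrite k0 rt0// mulr0 expR0 mulr1.
elim: N => // N IH; rewrite ltnS leq_eqVlt => /orP[/eqP tN|/IH {}IH]; last first.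
  apply: le_trans (coef_smoothing_le _ _ A0 hf) (le_trans _ IH); rewrite ler_piMl ?cmod_ge0//.
  by rewrite normrX exprn_ile1// ler_norml cos_le1 cos_geN1.
have := @trunc_log_bounds 2 (absz (k ord0 ord0)) isT; rewrite absz_gt0 => /(_ k0); rewrite /= tN => /andP[b1 b2].
have c1 : 2 ^+ N <= `|(k 0 0)%:~R : R|.
  by rewrite -intr_norm -abszE -natrX ler_nat.
have c2 : `|(k 0 0)%:~R : R| <= 2 * 2 ^+ N.
  by rewrite -exprS -intr_norm -abszE -natrX ler_nat ltnW.
have p2 : 0 < 2 ^+ N :> R by rewrite exprn_gt0.
apply: le_trans (coef_smoothing_le _ _ A0 hf) _; rewrite mulrC; apply: ler_pM; rewrite ?cmod_ge0//.
apply: (@le_trans _ _ (expR (- (1 - cos lam) * (Num.truncn (rt (2 ^+ N))).+1%:R))).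
  have ll : 0 <= lam / 2 ^+ N by apply: divr_ge0 => //; exact: ltW.
  rewrite -/th -/lam; apply: cos_pow_le => //; rewrite normrM (ger0_norm ll) mulrCA.
    by rewrite ler_peMr// ler_pdivlMr// mul1r.
  by rewrite [leRHS]mulrC ler_wpM2l// ler_pdivrMr.
rewrite ler_expR !mulNr lerN2 -mulrA; apply: ler_wpM2l; first by rewrite subr_ge0 cos_le1.
have h1 : rt (k 0 0)%:~R <= rt 2 * rt (2 ^+ N).
  by rewrite -rtM; apply: rt_le => //; apply: le_trans c2 (ler_norm _).
have h2 : rt 2 * rt (2 ^+ N) <= 2 * rt (2 ^+ N) by rewrite ler_wpM2r ?rt_ge0// ltW ?rt2_lt2.
have /andP[_ h3] := truncn_itv (rt_ge0 s (2 ^+ N)).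
by rewrite mulrC ler_pdivrMr//; lra.
Qed.

(** The iterates of [smoothing] converge uniformly at the geometric rate [E]. Their pointwise bounds
    pass to the limit, and so does the decay of the coefficients, [coef] being continuous for the
    uniform norm. *)
Lemma gevrey_bump rho : 0 < rho -> rho <= pi -> exists c d D psi,
  [/\ 0 < d, dec d D c, forall t, fn c t = (psi t)%:C, forall t, 0 <= psi t &
      (forall t, rho <= t <= 2 * pi - rho -> psi t = 0) /\ psi 0 != 0].
Proof.
move=> r0 rp; have r20 : 0 < rho / 2 by rewrite divr_gt0.
have [|dl [dl0 hf]] := base_bump r20; first by lra.
set f := fun t => _ in hf.
(* The support has radius [rho / 2] at the start and grows by at most [A]; the interval where the
   function is at least [dl] has half-width [rho / 4] and shrinks by at most [A]. Hence [rho / 8]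
   leaves room on both sides. *)
pose th := rt 2 / 2; pose A := rho / 8; pose lam := A * (1 - th) / 2.
have A0 : 0 <= A by rewrite divr_ge0// ltW.
have th0 : 0 < th by rewrite divr_gt0// (lt_le_trans ltr01)//; apply: rt_ge1 => //; rewrite ger0_norm// ler1n.
have th1 : th < 1 by rewrite ltr_pdivrMr// mul1r rt2_lt2.
have lam0 : 0 < lam by rewrite divr_gt0// mulr_gt0 ?subr_gt0// divr_gt0.
have lamp : lam <= pi / 4.
  have : A * (1 - th) <= A by rewrite ler_piMr//; lra.
  by rewrite /lam /A; lra.
pose F := smoothing lam f; pose E N := 2 * (A * th ^+ N).
have FE N t : `|F N.+1 t - F N t| <= E N - E N.+1.
  by have [_ h2] := smoothing_bumpy N A0 hf; apply: le_trans (h2 t) _; rewrite /E; lra.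
have E0 N : 0 <= E N by rewrite mulr_ge0// mulr_ge0// exprn_ge0// ltW.
have Fle N p t : `|F (N + p)%N t - F N t| <= E N - E (N + p)%N.
  elim: p => [|p IH]; first by rewrite addn0 !subrr normr0.
  rewrite addnS (_ : _ - F N t = (F (N + p).+1 t - F (N + p)%N t) + (F (N + p)%N t - F N t)); last by ring.
  by apply: le_trans (ler_normD _ _) _; have := FE (N + p)%N t; lra.
(* As [E N] bounds the distance from [F N] to all later iterates, the limit is the supremum of the
   lower bounds [F N t - E N]. *)
pose X t := [set x | exists N, x = F N t - E N].
pose psi t := sup (X t).
have Xub N t x : X t x -> x <= F N t + E N.
  move=> [p ->]; have [pN|/ltnW Np] := leqP p N.
    have := Fle p (N - p)%N t; rewrite subnKC// ler_norml => /andP[h _].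
    by have := E0 N; lra.
  have := Fle N (p - N)%N t; rewrite subnKC// ler_norml => /andP[_ h].
  by have := E0 p; lra.
have Xsup t : has_sup (X t).
  by split; [exists (F 0%N t - E 0%N); exists 0%N|exists (F 0%N t + E 0%N); exact: Xub].
have psiF N t : `|psi t - F N t| <= E N.
  rewrite ler_norml; apply/andP; split.
    have : F N t - E N <= psi t by apply: sup_upper_bound => //; exists N.
    by lra.
  have : psi t <= F N t + E N by apply: sup_le_ub => //; [exact: (Xsup t).1|exact: Xub].
  by lra.
have lim0 (x C : R) N0 : (forall N, (N0 <= N)%N -> x <= C * E N) -> x <= 0.
  move=> h; apply: (@le_geometric x (C * (2 * A) * th ^+ N0) th th0 th1) => N.
  have -> : C * (2 * A) * th ^+ N0 * th ^+ N = C * E (N0 + N)%N by rewrite /E exprD; ring.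
  exact/h/leq_addr.
have hF N : bumpy 2 dl (rho / 2 + (A - A * th ^+ N)) (rho / 2 / 2 - (A - A * th ^+ N)) (F N).
  exact: (smoothing_bumpy N A0 hf).1.
have hpsi : bumpy 2 dl rho 0 psi.
  have Ath N : A - A * th ^+ N <= rho / 8.
    have : 0 <= A * th ^+ N by rewrite mulr_ge0// exprn_ge0// ltW.
    by rewrite /A; lra.
  split.
  - move=> t; apply/andP; split.
      rewrite -subr_le0 add0r; apply: (@lim0 _ 1 0%N) => N _.
      have := psiF N t; rewrite ler_norml; have [h1 _ _ _ _] := hF N; have := h1 t; lra.
    rewrite -subr_le0; apply: (@lim0 _ 1 0%N) => N _.
    have := psiF N t; rewrite ler_norml; have [h1 _ _ _ _] := hF N; have := h1 t; lra.
  - move=> x y; rewrite -subr_le0; apply: (@lim0 _ 2 0%N) => N _.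
    have [_ h2 _ _ _] := hF N; have := h2 x y; have := psiF N x; have := psiF N y.
    rewrite !ler_norml => /andP[a1 a2] /andP[a3 a4] /andP[a5 a6].
    by rewrite lerBlDr ler_norml; apply/andP; split; lra.
  - move=> t; apply/eqP; rewrite -subr_eq0 -normr_le0; apply: (@lim0 _ 2 0%N) => N _.
    have [_ _ h3 _ _] := hF N; have := psiF N (t + 2 * pi); have := psiF N t.
    by rewrite h3 !ler_norml => /andP[a1 a2] /andP[a3 a4]; apply/andP; split; lra.
  - move=> t ht; apply/eqP; rewrite -normr_le0; apply: (@lim0 _ 1 0%N) => N _.
    have [_ _ _ h4 _] := hF N; have := psiF N t; rewrite h4 ?subr0 ?mul1r//.
    by have := Ath N; lra.
  move=> t; rewrite normr_le0 => /eqP ->; rewrite -subr_le0; apply: (@lim0 _ 1 0%N) => N _.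
  have [_ _ _ _ h5] := hF N; have := psiF N 0; have := h5 0; rewrite normr0 => H.
  have {}H := H _; have : dl <= F N 0 by apply: H; have := Ath N; lra.
  by rewrite ler_norml; lra.
have bl := BL_lift hpsi; have pl := periodic_lift hpsi.
have hc : dec ((1 - cos lam) / 2) 4 (coef (lift1 psi)).
  move=> k; rewrite /expweight pw1E -subr_le0; apply: (@lim0 _ 2 (trunc_log 2 (absz (k ord0 ord0))).+1) => N hN.
  have h1 := coef_smoothing_decay A0 lamp hf hN; rewrite -/th -/lam -/F in h1.
  have h2 : cmod (coef (lift1 psi) k - coef (lift1 (F N)) k) <= 2 * E N.
    rewrite -(coefB k bl (BL_lift (hF N))) -(expr1 2); apply: coef_norm.
      by apply: BLB => //; exact: BL_lift (hF N).
    by move=> y; rewrite /lift1 -rmorphB cmodR; exact: psiF.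
  have := cmodD (coef (lift1 psi) k - coef (lift1 (F N)) k) (coef (lift1 (F N)) k).
  by rewrite subrK; lra.
have dd0 : 0 < (1 - cos lam) / 2.
  rewrite divr_gt0// subr_gt0 -cos0 ltr_cos ?in_itv/=; have := pi_gt0 R; lra.
exists (coef (lift1 psi)), ((1 - cos lam) / 2), 4, psi; split => //.
- move=> t; have := congr1 (fun G => G (const_mx t)) (fourier_inversion s1 dd0 bl pl hc).
  by rewrite /= /lift1 mxE /fn => <-.
- by move=> t; have [h1 _ _ _ _] := hpsi; have /andP[] := h1 t.
have [_ _ _ h4 h5] := hpsi; split=> //.
by rewrite gt_eqF// (lt_le_trans dl0)// h5// normr0.
Qed.

End Bump.

(** * Quasimodes *)

Section Modes.
Variables (R : realType) (s : R).
Hypothesis s1 : 1 < s.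
Local Notation K1 := 'rV[int]_1.
Local Notation om := (expweight s).
Local Notation rt := (sroot s).
Local Notation dec := (dec s).

Lemma partial_lift (v dv : R -> R[i]) : (forall t, cder v t (dv t)) ->
  has_partial ord0 (fun y : 'rV[R]_1 => v (y 0 0)) /\
  partial ord0 (fun y : 'rV[R]_1 => v (y 0 0)) = fun y => dv (y 0 0).
Proof.
have key (g : R -> R) (y : 'rV[R]_1) dg : is_derive (y 0 0) (1 : R) g dg ->
    is_derive y (basis_vec R ord0) (fun z : 'rV[R]_1 => g (z 0 0)) dg.
  move=> [h e].
  have E : (fun x : R => x^-1 *: (g ((x *: basis_vec R ord0 + y) 0 0) - g (y 0 0))) =
           (fun x : R => x^-1 *: (g (x *: (1 : R) + y 0 0) - g (y 0 0))).
    by apply/funext => x; congr (_ *: (g _ - _)); rewrite addrC add_basisE eqxx [x *: (1 : R)]mulr1 addrC.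
  apply: DeriveDef; first by rewrite /derivable E.
  by rewrite /derive E.
move=> hv; split.
  by move=> y; have [h1 h2] := hv (y 0 0); split; [have [] := key _ _ _ h1|have [] := key _ _ _ h2].
apply/funext => y; have [h1 h2] := hv (y 0 0).
have [_ e1] := key _ _ _ h1; have [_ e2] := key _ _ _ h2.
by rewrite /partial e1 e2; case: (dv _).
Qed.

Lemma BL_lift_cder (v dv : R -> R[i]) B B' : (forall t, cder v t (dv t)) ->
  (forall t, cmod (v t) <= B) -> (forall t, cmod (dv t) <= B') -> BL (fun y : 'rV[R]_1 => v (y 0 0)).
Proof.
move=> hd hB hB'; have B0 : 0 <= B := le_trans (cmod_ge0 _) (hB 0).
have B'0 : 0 <= B' := le_trans (cmod_ge0 _) (hB' 0).
exists (B + 2 * B') => [y|y z]; first by apply: le_trans (hB _) _; rewrite lerDl mulr_ge0.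
have L (a b : R) : cmod (v a - v b) <= 2 * B' * `|a - b|.
  wlog ab : a b / b <= a => [H|].
    by case/orP: (le_total b a) => [/H//|/H h]; rewrite cmod_distC distrC.
  by rewrite ger0_norm ?subr_ge0//; apply: cder_lip.
apply: le_trans (L _ _) _; apply: ler_pM => //; rewrite ?mulr_ge0 ?lerDr//.
by have := le_norm_rV (y - z) 0; rewrite !mxE.
Qed.

Lemma conv1D (d D D' E e : R) (c c' w : K1 -> R[i]) r : 0 < d -> dec d D c -> dec d D' c' ->
  0 < e -> dec e E w -> conv1 (fun q => c q + c' q) w r = conv1 c w r + conv1 c' w r.
Proof.
move=> d0 hc hc' e0 hw; have E0 := dec_ge0 hw.
have t x D0 : dec d D0 x -> dec d (D0 * E) (fun q => x q * w (r - q)).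
  move=> hx q; have D00 := dec_ge0 hx; rewrite cmodM -mulrAC; apply: ler_pM; rewrite ?cmod_ge0//.
  by apply: le_trans (hw _) _; rewrite ler_piMr// om_le1// ltW.
rewrite /conv1 -(csumD s1 d0 (t _ _ hc) (t _ _ hc')).
by congr csum; apply/funext => q; rewrite mulrDl.
Qed.

(* The function [cexp (- i X (prim c - prim c t0))] solves [v' + i X c v = 0]. *)
Lemma exact_mode (c : K1 -> R[i]) (d0 Dc X t0 : R) :
  0 < d0 -> dec d0 Dc c -> cexp (- ((2 * pi * X)%:C * 'i * c 0)) = 1 ->
  (forall t, X * complex.Im (prim c t) <= X * complex.Im (prim c t0)) ->
  exists w : K1 -> R[i],
  [/\ forall t, fn w t = cexp (- (X%:C * 'i * (prim c t - prim c t0))),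
      forall r : K1, (r 0 0)%:~R%:C * 'i * w r + X%:C * 'i * conv1 c w r = 0 &
      forall dl, 0 < dl -> dl <= d0 / 2 ->
        dec dl (4 * expR (dl * rt (2 * (`|X| * (2 * Dc * tot s 1 (d0 / 2))) + 1))) w].
Proof.
move=> d00 hc per le0.
pose v t := cexp (- (X%:C * 'i * (prim c t - prim c t0))).
have vn t : cmod (v t) = expR (X * complex.Im (prim c t) - X * complex.Im (prim c t0)).
  by rewrite /v cmod_cexp !ReIm; congr expR; ring.
have v1 t : cmod (v t) <= 1 by rewrite vn -[leRHS]expR0 ler_expR subr_le0.
pose dv t := - (X%:C * 'i) * (fn c t * v t).
have hd t : cder v t (dv t).
  have h1 := cderD (prim_cder s1 t d00 hc) (cder_cst (- prim c t0) t).
  have := cder_cexp (cderZ (- (X%:C * 'i)) h1).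
  have -> : (fun x => cexp (- (X%:C * 'i) * (prim c x + - prim c t0))) = v.
    by apply/funext => x; rewrite /v mulNr.
  have -> z : cexp (- (X%:C * 'i) * z) = cexp (- (X%:C * 'i * z)) by rewrite mulNr.
  by rewrite addr0 -mulrA.
pose B := 2 * Dc * tot s 1 d0.
have fB t : cmod (fn c t) <= B by exact: fn_norm.
have B0 : 0 <= B := le_trans (cmod_ge0 _) (fB 0).
have dvB t : cmod (dv t) <= `|X| * B.
  rewrite /dv cmodM cmodN cmodM cmodi mulr1 cmodR ler_wpM2l// cmodM.
  by rewrite -[leRHS]mulr1; apply: ler_pM; rewrite ?cmod_ge0.
pose V (y : 'rV[R]_1) := v (y 0 0).
have bV : BL V := BL_lift_cder hd v1 dvB.
have pV : periodic V.
  move=> k y; rewrite /V add_basisE (ord1 k) eqxx /v prim_period.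
  rewrite (_ : - (_) = - (X%:C * 'i * (prim c (y 0 0) - prim c t0)) + - ((2 * pi * X)%:C * 'i * c 0)).
    by rewrite cexpD per mulr1.
  by rewrite !rmorphM /=; ring.
have [hp eP] := partial_lift hd.
pose w := coef V.
have cb : BL (cfun (ord0 : 'I_1) c) := BL_cfun s1 ord0 d00 hc.
have eP' : partial ord0 V = fun y => - (X%:C * 'i) * (cfun (ord0 : 'I_1) c y * V y).
  by rewrite eP; apply/funext => y; rewrite /dv /cfun /V.
have bP : BL (partial ord0 V) by rewrite eP'; apply: BLZ; exact: BLM.
have eq (r : K1) : (r 0 0)%:~R%:C * 'i * w r + X%:C * 'i * conv1 c w r = 0.
  rewrite /w -(coef_partial r bV pV hp bP) eP' coefZ; last exact: BLM.
  by rewrite (coef_mulc s1 ord0 r d00 hc bV) conv1E; ring.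
have w2 r : cmod (w r) <= 2.
  rewrite -[leRHS]mulr1 -(expr1 2); apply: coef_norm => // y; exact: v1.
have hdec dl : 0 < dl -> dl <= d0 / 2 ->
    dec dl (4 * expR (dl * rt (2 * (`|X| * (2 * Dc * tot s 1 (d0 / 2))) + 1))) w.
  move=> dl0 dld.
  (* The coefficients of a function of modulus at most 1 are at most 2: this is growth of rate 0,
     and [S = 2] in the bootstrap with right-hand side 0, hence the constant 4. *)
  have hw : dec (- 0) 2 w by move=> r; rewrite oppr0 /expweight oppr0 mul0r expR0 mulr1.
  pose z : K1 -> R[i] := fun=> 0.
  have hg : dec dl 0 z by move=> r; rewrite /z cmod0 mul0r.
  have := @bootstrap R s s1 c w z d0 Dc dl 0 2 X 2 0 d00 hc dl0 dld (lexx _) _ hw hg _ _ _ erefl (fun r _ => w2 r).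
  rewrite addr0 mulrA (_ : 2 * 2 = 4 :> R); last by ring.
  apply=> //; first by rewrite divr_ge0// ltW.
  move=> r; rewrite /z cmod0 add0r -[X in X <= _]mulr1 -[X in _ <= X]mulr1.
  have := eq r; move=> /eqP; rewrite addr_eq0 => /eqP /(congr1 (@cmod R)).
  by rewrite cmodN !cmodM cmodi !cmodR !mulr1 => ->.
exists w; split => // t.
have d02 : 0 < d0 / 2 by rewrite divr_gt0.
have := congr1 (fun F => F (const_mx t)) (fourier_inversion s1 d02 bV pV (hdec _ d02 (lexx _))).
by rewrite /= /V mxE /fn => <-.
Qed.

(** The exponent of the loss in the first clause is proportional to [dl], with a factor [kap] meant
    to be independent of [X]. The last clause is a normalization, without which small functions
    would qualify. *)
Definition quasimode (c : K1 -> R[i]) (X eps kap d0 D : R) (w : K1 -> R[i]) : Prop :=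
  [/\ forall dl, 0 < dl -> dl <= d0 -> dec dl (4 * expR (dl * (kap * rt X + 1))) w,
      forall r : K1, cmod ((r 0 0)%:~R%:C * 'i * w r + X%:C * 'i * conv1 c w r) <= D * expR (- eps * rt X) &
      exists t, cmod (fn w t) = 1].

Lemma quasimode_weaken c X eps eps' kap kap' d0 d0' D D' w : eps' <= eps -> kap <= kap' ->
  d0' <= d0 -> D <= D' -> quasimode c X eps kap d0 D w -> quasimode c X eps' kap' d0' D' w.
Proof.
move=> he hk hd hD [h1 h2 h3]; have rX := rt_ge0 s X; split => //.
  move=> dl dl0 dld r; apply: le_trans (h1 dl dl0 (le_trans dld hd) r) _.
  by rewrite ler_wpM2r ?om_ge0// ler_pM2l// ler_expR ler_pM2l// lerD2r ler_wpM2r.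
have D0 : 0 <= D.
  by have := le_trans (cmod_ge0 _) (h2 0); rewrite pmulr_lge0// expR_gt0.
by move=> r; apply: le_trans (h2 r) _; apply: ler_pM; rewrite ?expR_ge0// ler_expR !mulNr lerN2 ler_wpM2r.
Qed.

Lemma rt_threshold (X Kc : R) : 0 <= Kc -> rt (2 * (`|X| * Kc) + 1) <= rt (2 * Kc) * rt X + 1.
Proof.
move=> Kc0; have rt1 : rt 1 = 1 by rewrite /sroot normr1 powR1.
rewrite (_ : 2 * (`|X| * Kc) = (2 * Kc) * `|X|); last by ring.
by apply: le_trans (rtD s1 _ _) _; rewrite rtM rt_norm rt1.
Qed.

(* Perturbing [c] by [- e] makes the mode exact; it is then a quasimode of [c]
   as soon as [X e v] is small. *)
Lemma perturbed_mode (c e : K1 -> R[i]) (d0 Dc De X t0 B eps D : R) :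
  0 < d0 -> dec d0 Dc c -> dec d0 De e ->
  let c' := fun r => c r - e r in
  cexp (- ((2 * pi * X)%:C * 'i * c' 0)) = 1 ->
  (forall t, X * complex.Im (prim c' t) <= X * complex.Im (prim c' t0)) ->
  (forall t, cmod (fn e t) * expR (X * complex.Im (prim c' t) - X * complex.Im (prim c' t0)) <= B) ->
  `|X| * (2 * B) <= D * expR (- eps * rt X) ->
  exists w, quasimode c X eps (rt (2 * (2 * (Dc + De) * tot s 1 (d0 / 2)))) (d0 / 2) D w.
Proof.
move=> d00 hc he c' per le0 hB hD.
have d02 : 0 < d0 / 2 by rewrite divr_gt0.
have hNe : dec d0 De (fun r => - e r) by move=> r; rewrite cmodN.
have hc' : dec d0 (Dc + De) c' by exact: decD.
have DD0 := dec_ge0 hc'.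
have [w [h1 h2 h3]] := exact_mode d00 hc' per le0.
set Kc := 2 * (Dc + De) * tot s 1 (d0 / 2) in h3 *.
have Kc0 : 0 <= Kc by apply: mulr_ge0; [exact: mulr_ge0|exact: tot_ge0].
have hw := h3 _ d02 (lexx _).
exists w; split.
- move=> dl dl0 dld r; apply: le_trans (h3 dl dl0 dld r) _.
  rewrite ler_wpM2r ?om_ge0// ler_pM2l// ler_expR ler_pM2l//; exact: rt_threshold.
- move=> r.
  have -> : (r 0 0)%:~R%:C * 'i * w r + X%:C * 'i * conv1 c w r = X%:C * 'i * conv1 e w r.
    have ce : (fun q => c' q + e q) = c by apply/funext => q; rewrite /c' subrK.
    have -> : conv1 c w r = conv1 c' w r + conv1 e w r.
      by have := conv1D r d00 hc' he d02 hw; rewrite ce.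
    by rewrite mulrDr addrA h2 add0r.
  rewrite !cmodM cmodi mulr1 cmodR; apply: le_trans hD; rewrite ler_wpM2l//.
  have d03 : `|d0 / 2| < d0 by rewrite gtr0_norm// ltr_pdivrMr// ltr_pMr// ltr1n.
  have hcv := conv_norm s1 ord0 d03 he hw; rewrite -conv1E in hcv.
  apply: (coef_fn_norm s1 r d02 hcv) => t.
  rewrite -(fn_mul s1 t d00 he d02 hw) cmodM h1.
  apply: le_trans (hB t); rewrite cmod_cexp !ReIm le_eqVlt; apply/orP; left; apply/eqP.
  by congr (_ * expR _); ring.
by exists t0; rewrite h1 subrr mulr0 oppr0 cexp0 cmod1.
Qed.

End Modes.

(** * Upper and lower bounds for the coefficients of quasimodes *)

Section QuasimodeBounds.
Variables (R : realType) (s : R).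
Hypothesis s1 : 1 < s.
Local Notation K1 := 'rV[int]_1.
Local Notation om := (expweight s).
Local Notation rt := (sroot s).
Local Notation dec := (dec s).

Lemma interpolation (a A B x : R) : 0 <= a -> a <= A -> a <= B * expR (- x) ->
  a <= Num.sqrt (A * B) * expR (- (x / 2)).
Proof.
move=> a0 aA aB; have A0 : 0 <= A := le_trans a0 aA.
have B0 : 0 <= B by have := le_trans a0 aB; rewrite pmulr_lge0// expR_gt0.
rewrite -(@ler_pXn2r _ 2) ?nnegrE ?mulr_ge0 ?sqrtr_ge0 ?expR_ge0//.
rewrite exprMn sqr_sqrtr ?mulr_ge0// -expRM_natl (_ : 2%:R * - (x / 2) = - x); last by field.
by rewrite expr2 -mulrA; exact: ler_pM.
Qed.

(* [L w] is uniformly small and decays slowly; interpolation gives both at once. *)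
Lemma quasimode_small (c : K1 -> R[i]) (dc Dc eps kap d0 D dl : R) :
  0 < dc -> dec dc Dc c -> 0 < eps -> 0 <= kap -> 0 < dl -> dl <= d0 -> dl <= dc / 2 ->
  dl * (kap + 1) <= eps / 2 ->
  exists2 C, 0 <= C & forall X w, 1 <= X -> quasimode s c X eps kap d0 D w ->
    dec (dl / 4) (C * expR (- (eps / 4) * rt X))
      (fun r => (r 0 0)%:~R%:C * 'i * w r + X%:C * 'i * conv1 c w r).
Proof.
move=> dc0 hc eps0 kap0 dl0 dld dldc hk; have Dc0 := dec_ge0 hc.
have dl20 : 0 < dl / 2 by rewrite divr_gt0.
have ddc : `|dl / 2| < dc by rewrite gtr0_norm//; lra.
have T0 := @tot_ge0 R s s1 1 (dc - `|dl / 2|).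
(* [C1] comes from the factor [tau_j], at the cost of half of the rate; [C2] comes from the
   convolution and from the factor [X], which is absorbed by [exp (dl * X^(1/s))]. Hence [kap + 1]
   in the condition on [dl]. *)
pose C1 := (s / (dl / 2)) `^ s; pose C2 := (s / dl) `^ s * (2 * Dc * tot s 1 (dc - `|dl / 2|)).
pose C3 := 4 * expR dl * (C1 + C2).
have C10 : 0 <= C1 by exact: powR_ge0.
have C20 : 0 <= C2.
  apply: mulr_ge0; first exact: powR_ge0.
  by apply: mulr_ge0; [exact: mulr_ge0|apply: T0; rewrite subr_gt0].
have C30 : 0 <= C3 by apply: mulr_ge0; [rewrite mulr_ge0 ?expR_ge0|exact: addr_ge0].
exists (Num.sqrt (`|D| * C3)); first exact: sqrtr_ge0.
move=> X w X1 [h1 h2 _] r.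
have X0 : 0 <= X := le_trans ler01 X1.
have rX : 0 <= rt X := rt_ge0 _ _.
have rX1 : 1 <= rt X by apply: rt_ge1 => //; rewrite ger0_norm.
have hw := h1 dl dl0 dld.
have hw2 : dec (dl / 2) (4 * expR (dl * (kap * rt X + 1))) w by apply: dec_weaken hw; lra.
have hd := dec_deriv s1 ord0 dl0 hw.
have hv := conv_norm s1 ord0 ddc hc hw2; rewrite -conv1E in hv.
have hXv := decZ (X%:C * 'i) hv.
have hs := decD hd hXv r.
have XE : cmod (X%:C * 'i : R[i]) <= (s / dl) `^ s * expR (dl * rt X).
  rewrite cmodM cmodi mulr1 cmodR.
  have := rt_absorb s1 X dl0; rewrite -ler_pdivlMr ?expR_gt0// mulNr expRN invrK.
  exact.
have bnd : cmod ((r 0 0)%:~R%:C * 'i * w r + X%:C * 'i * conv1 c w r) <=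
    C3 * expR (dl * (kap + 1) * rt X) * expR (- (dl / 2 * weight s r)).
  apply: le_trans hs _; rewrite {1}/expweight mulNr ler_wpM2r ?expR_ge0//.
  have e1 : expR (dl * (kap * rt X + 1)) <= expR dl * expR (dl * (kap + 1) * rt X).
    rewrite -expRD ler_expR; have : 0 <= dl * rt X by apply: mulr_ge0 => //; exact: ltW.
    by lra.
  have e2 : expR (dl * rt X) * expR (dl * (kap * rt X + 1)) = expR dl * expR (dl * (kap + 1) * rt X).
    by rewrite -!expRD; congr expR; ring.
  set Z := expR (dl * (kap + 1) * rt X) in e1 e2 *.
  have -> : C3 * Z = 4 * expR dl * C1 * Z + 4 * expR dl * C2 * Z by rewrite /C3; ring.
  apply: lerD.
    have -> : 4 * expR dl * C1 * Z = 4 * C1 * (expR dl * Z) by ring.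
    rewrite mulrAC ler_wpM2l// mulr_ge0//.
  set Tt := tot s 1 _; have Tt0 : 0 <= Tt by apply: T0; rewrite subr_gt0.
  apply: (@le_trans _ _ ((s / dl) `^ s * expR (dl * rt X) * (2 * (Dc * (4 * expR (dl * (kap * rt X + 1)))) * Tt))).
    apply: ler_wpM2r; last exact: XE.
    by apply: mulr_ge0 => //; apply: mulr_ge0 => //; apply: mulr_ge0 => //; rewrite mulr_ge0 ?expR_ge0.
  rewrite (_ : _ * _ * (_ * _) = (s / dl) `^ s * (2 * Dc * Tt) * 4 * (expR (dl * rt X) * expR (dl * (kap * rt X + 1)))); last by ring.
  by rewrite e2 /C2 -/Tt le_eqVlt; apply/orP; left; apply/eqP; ring.
have sm : cmod ((r 0 0)%:~R%:C * 'i * w r + X%:C * 'i * conv1 c w r) <= `|D| * expR (- eps * rt X).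
  by apply: le_trans (h2 r) _; rewrite ler_wpM2r ?expR_ge0// ler_norm.
apply: le_trans (interpolation (cmod_ge0 _) sm bnd) _.
rewrite (_ : - (dl / 2 * weight s r / 2) = - (dl / 4) * weight s r); last by field.
rewrite ler_wpM2r ?expR_ge0//.
rewrite (_ : _ * _ * _ = `|D| * C3 * (expR (- eps * rt X) * expR (dl * (kap + 1) * rt X))); last by ring.
have DC0 : 0 <= `|D| * C3 by exact: mulr_ge0.
rewrite (sqrtrM _ DC0) ler_wpM2l ?sqrtr_ge0// -expRD.
rewrite -(@ler_pXn2r _ 2) ?nnegrE ?sqrtr_ge0 ?expR_ge0// sqr_sqrtr ?expR_ge0// -expRM_natl ler_expR.
have : dl * (kap + 1) * rt X <= eps / 2 * rt X by rewrite ler_wpM2r.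
by lra.
Qed.

(** If all coefficients were smaller than this, interpolation with their decay would cancel the loss
    and bound the function by 1/2, against the normalization. The value of [a] is adjusted to this
    bound. *)
Lemma quasimode_low (c : K1 -> R[i]) (eps kap d0 D dl : R) : 0 < dl -> dl <= d0 ->
  exists2 a, 0 < a & forall X w, quasimode s c X eps kap d0 D w ->
    exists r, a * expR (- (dl * kap) * rt X) <= cmod (w r).
Proof.
move=> dl0 dld; have dl20 : 0 < dl / 2 by rewrite divr_gt0.
pose T := tot s 1 (dl / 2) + 1.
have T0 : 0 <= tot s 1 (dl / 2) by exact: tot_ge0.
have T1 : 0 < T by rewrite ltr_wpDl.
pose a := (4 * T)^-1 ^+ 2 / (4 * expR dl).
have a0 : 0 < a by rewrite divr_gt0 ?exprn_gt0 ?invr_gt0 ?mulr_gt0 ?expR_gt0.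
exists a => // X w [h1 _ [t ht]]; apply: contrapT => hn.
have hw r : cmod (w r) <= a * expR (- (dl * kap) * rt X).
  by rewrite leNgt; apply/negP => h; apply: hn; exists r; exact: ltW.
have hd : dec (dl / 2) ((4 * T)^-1) w.
  move=> r; have := h1 dl dl0 dld r; rewrite /expweight mulNr => b.
  apply: le_trans (interpolation (cmod_ge0 _) (hw r) b) _.
  rewrite (_ : - (dl * weight s r / 2) = - (dl / 2) * weight s r); last by field.
  rewrite ler_wpM2r ?expR_ge0//.
  have -> : a * expR (- (dl * kap) * rt X) * (4 * expR (dl * (kap * rt X + 1))) = (4 * T)^-1 ^+ 2.
    have e : expR (dl * (kap * rt X + 1)) = expR dl * expR (dl * kap * rt X).
      by rewrite -expRD; congr expR; ring.
    rewrite e mulNr expRN /a; field.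
    by rewrite !gt_eqF ?expR_gt0.
  by rewrite sqrtr_sqr ger0_norm// invr_ge0 mulr_ge0// ltW.
have := fn_norm s1 t dl20 hd; rewrite ht.
have : 2 * (4 * T)^-1 * tot s 1 (dl / 2) <= 1 / 2.
  rewrite invfM (_ : _ * _ * _ = tot s 1 (dl / 2) / T / 2); last by field; rewrite gt_eqF.
  by rewrite ler_pM2r ?invr_gt0// ler_pdivrMr// mul1r /T lerDl.
by lra.
Qed.

End QuasimodeBounds.

(** * The product of quasimodes *)

Section Product.
Variables (R : realType) (s : R) (n : nat) (a b : 'I_n -> R -> R).
Hypothesis s1 : 1 < s.
Hypothesis ha : forall j : 'I_n, gevrey_circle s (a j).
Hypothesis hb : forall j : 'I_n, gevrey_circle s (b j).
Local Notation K := 'rV[int]_n.+1.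
Local Notation K1 := 'rV[int]_1.
Local Notation om := (expweight s).
Local Notation rt := (sroot s).
Local Notation dec := (dec s).
Local Notation ch := (ch a b).
Local Notation Lseq := (Lhat a b).

Definition has_quasimodes (Xi : int -> Prop) (j : 'I_n) := exists eps kap d0 D : R,
  [/\ 0 < eps, 0 <= kap, 0 < d0 &
      forall X : int, Xi X -> exists w, quasimode s (ch j) X%:~R eps kap d0 D w].

Lemma uniform_quasimodes (Xi : int -> Prop) : (forall j, has_quasimodes Xi j) ->
  exists (eps kap d0 D : R) (W : 'I_n -> int -> K1 -> R[i]), [/\ 0 < eps, 0 <= kap, 0 < d0 &
    forall j X, Xi X -> quasimode s (ch j) X%:~R eps kap d0 D (W j X)].
Proof.
move=> H.
have key j : exists p : R * R * R * R, [/\ 0 < p.1.1.1, 0 <= p.1.1.2, 0 < p.1.2 &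
    forall X : int, Xi X -> exists w, quasimode s (ch j) X%:~R p.1.1.1 p.1.1.2 p.1.2 p.2 w].
  by have [eps [kap [d0 [D h]]]] := H j; exists (eps, kap, d0, D).
have [p hp] := choice key.
pose eps := \big[Num.min/1]_j (p j).1.1.1; pose kap := \sum_j (p j).1.1.2.
pose d0 := \big[Num.min/1]_j (p j).1.2; pose D := \sum_j `|(p j).2|.
have hk i : 0 <= (p i).1.1.2 by have [] := hp i.
have key2 j : exists W : int -> K1 -> R[i], forall X, Xi X -> quasimode s (ch j) X%:~R eps kap d0 D (W X).
  have k2 X : exists w : K1 -> R[i], Xi X -> quasimode s (ch j) X%:~R eps kap d0 D w.
    have [hX|hX] := pselect (Xi X); last by exists (fun=> 0).
    have [_ _ _ /(_ X hX)[w hw]] := hp j; exists w => _.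
    apply: quasimode_weaken hw; try exact: bigmin_le.
      by rewrite /kap (bigD1 j)//= lerDl sumr_ge0.
    by apply: le_trans (ler_norm _) _; rewrite /D (bigD1 j)//= lerDl sumr_ge0.
  by have [W hW] := choice k2; exists W.
have [W hW] := choice key2.
exists eps, kap, d0, D, W; split => //.
- by rewrite /eps; elim/big_ind : _ => // [x y x0 y0|j _]; [rewrite lt_min x0|have [] := hp j].
- exact: sumr_ge0.
- by rewrite /d0; elim/big_ind : _ => // [x y x0 y0|j _]; [rewrite lt_min x0|have [] := hp j].
Qed.

Lemma om_coords d (k : K) :
  om d k = expR (- d * rt (k 0 (x_idx n))%:~R) * \prod_(j < n) expR (- d * rt (k 0 (t_idx j))%:~R).
Proof. by rewrite om_prod (bigD1_ord (x_idx n)). Qed.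

Lemma prod_le_cst (A : R) (F : 'I_n -> R) : (forall j, 0 <= F j <= A) -> \prod_j F j <= A ^+ n.
Proof.
move=> h; rewrite -[n in _ ^+ n]card_ord -prodr_const; apply: ler_prod => j _; exact: h.
Qed.

(** [L_j] acts on the [j]-th factor only, and its smallness there has to beat the losses of all [n]
    factors. On the other hand each factor has a coefficient that is not too small; at the lattice
    point formed by these, decay of the product at a rate [d] fails for large [X], because the total
    loss can be kept below [d / 2]. *)
Theorem quasimode_obstruction (Xi : int -> Prop) : (forall X, Xi X -> 1 <= X) ->
  (forall N : R, exists2 X, Xi X & N <= X%:~R) -> (forall j, has_quasimodes Xi j) ->
  ~ globally_hypoelliptic s (vfield a b).
Proof.
move=> Xi1 Xiu /uniform_quasimodes[eps [kap [d0 [D [W [eps0 kap0 d00 hW]]]]]].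
rewrite (hypo_seq s1 ha hb) => hyp.
have [dc [Dc [dc0 Dc0 hc]]] := dec_ch s1 ha hb.
have X1R X : Xi X -> 1 <= (X%:~R : R) by move=> /Xi1; rewrite -(ler1z R).
have aE (x y : R) : 4 * expR (x * (kap * y + 1)) = 4 * expR x * expR (x * kap * y).
  by rewrite -mulrA -expRD; congr (4 * expR _); ring.
have nk (x : R) : 0 < x -> n%:R * (x * kap) <= n%:R * (x * (kap + 1)).
  by move=> x0; apply: ler_wpM2l => //; apply: ler_wpM2l; [exact: ltW|rewrite lerDl].
pose v (k : K) : R[i] :=
  if `[< Xi (k 0 (x_idx n)) >] then \prod_j W j (k 0 (x_idx n)) (const_mx (k 0 (t_idx j))) else 0.
(* The losses of the [n] factors at rate [dl] add up to at most [e]; [n.+1] in [z] keeps the divisor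
   positive. *)
have small (e : R) : 0 < e -> exists dl : R, [/\ 0 < dl, dl <= d0, dl <= dc / 2 & n%:R * (dl * (kap + 1)) <= e].
  move=> e0; pose z := n.+1%:R * (kap + 1).
  have z0 : 0 < z by rewrite mulr_gt0// ltr_wpDl.
  exists (Num.min d0 (Num.min (dc / 2) (e / z))); split; rewrite ?ge_min ?lexx ?orbT//.
    by rewrite !lt_min d00 !divr_gt0.
  set dl := Num.min _ _.
  have : dl <= e / z by rewrite !ge_min lexx !orbT.
  rewrite ler_pdivlMr// => h; apply: le_trans h; rewrite /z mulrCA ler_wpM2l//.
    by rewrite !le_min ltW//= ?divr_ge0 ?ltW.
  by rewrite ler_wpM2r ?ler_nat// addr_ge0.
have [d [Dv [dd0 hv]]] : exists d D : R, 0 < d /\ dec d D v.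
  apply: hyp.
    move=> d dd0; have [dl [dl0 dld _ dlk]] := small d dd0.
    exists ((4 * expR dl) ^+ n) => k; rewrite /v; case: asboolP => [hX|_]; last first.
      by rewrite cmod0 mulr_ge0 ?om_ge0// exprn_ge0// mulr_ge0 ?expR_ge0.
    set X : int := k 0 (x_idx n) in hX *.
    have rX : 0 <= rt X%:~R := rt_ge0 _ _.
    have pb j : cmod (W j X (const_mx (k 0 (t_idx j)))) <= 4 * expR dl * expR (dl * kap * rt X%:~R).
      have [h1 _ _] := hW j X hX; apply: le_trans (h1 dl dl0 dld _) _.
      by rewrite aE; apply: ler_piMr; rewrite ?mulr_ge0 ?expR_ge0 ?om_le1//; exact: ltW.
    rewrite cmod_prod.
    apply: (@le_trans _ _ ((4 * expR dl * expR (dl * kap * rt X%:~R)) ^+ n)).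
      by apply: prod_le_cst => j; rewrite cmod_ge0 pb.
    rewrite exprMn ler_wpM2l ?exprn_ge0 ?mulr_ge0 ?expR_ge0//.
    rewrite -expRM_natl ler_expR opprK.
    have h2 : rt X%:~R <= weight s k by exact: pw_ge.
    apply: (@le_trans _ _ (d * rt X%:~R)); last by apply: ler_wpM2l => //; exact: ltW.
    rewrite mulrA ler_wpM2r//; exact: le_trans (nk _ dl0) dlk.
  move=> j; have [dl [dl0 dld dldc dlk]] := small (eps / 8) (divr_gt0 eps0 (ltr0n _ 8)).
  have nn : (1 : R) <= n%:R by rewrite ler1n; case: (n) j => // -[].
  have dlk1 : dl * (kap + 1) <= eps / 2.
    have z0 : 0 <= dl * (kap + 1) by apply: mulr_ge0; [exact: ltW|exact: addr_ge0].
    have : dl * (kap + 1) <= n%:R * (dl * (kap + 1)) by rewrite ler_peMl.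
    by lra.
  have [C C0 hC] := quasimode_small s1 D dc0 (hc j) eps0 kap0 dl0 dld dldc dlk1.
  (* The [j]-th factor contributes decay [eps / 4] in [xi], of which the losses of the factors take
     at most [eps / 8]. *)
  pose e := Num.min (eps / 8) (dl / 4).
  have e0 : 0 < e by rewrite lt_min !divr_gt0.
  exists e, (C * (4 * expR dl) ^+ n); split => // k.
  set X : int := k 0 (x_idx n).
  pose P : R[i] := if `[< Xi X >] then \prod_(i | i != j) W i X (const_mx (k 0 (t_idx i))) else 0.
  have vE r : v (upd k (t_idx j) r) = W j X r * P.
    rewrite /v upd_neq ?x_neq_t// -/X /P; case: ifP => _; last by rewrite mulr0.
    rewrite (bigD1 j)//= updE; congr (W j X _ * _).
      by apply/rowP => i; rewrite mxE (ord1 i).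
    apply: eq_bigr => i ij; rewrite upd_neq//.
    by apply: contra ij => /eqP /lift_inj ->.
  have := Lseq_upd a b j v k (const_mx (k 0 (t_idx j))); rewrite upd_id => ->.
  rewrite -[X in v X](upd_id k (t_idx j)) vE (funext vE) mxE -/X.
  case: (pselect (Xi X)) => hX; last first.
    have P0 : P = 0 by rewrite /P; case: asboolP.
    rewrite P0 mulr0 mulr0 add0r (_ : (fun r => W j X r * 0) = fun=> 0); last by apply/funext => r; rewrite mulr0.
    have -> : conv1 (ch j) (fun=> 0) (const_mx (k 0 (t_idx j))) = 0.
      rewrite /conv1 (_ : (fun q => _) = fun=> 0); last by apply/funext => q; rewrite mulr0.
      have := @csumZ R s 1 s1 1 0 0 (fun=> 0) ltr01.
      rewrite (_ : (fun k => 0 * 0) = (fun=> 0 : R[i])); last by apply/funext => q; rewrite mulr0.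
      by rewrite mul0r; apply => q; rewrite cmod0 mul0r.
    by rewrite mulr0 cmod0 mulr_ge0 ?om_ge0// mulr_ge0// exprn_ge0// mulr_ge0 ?expR_ge0.
  have qm i := hW i X hX.
  have cE : conv1 (ch j) (fun r => W j X r * P) (const_mx (k 0 (t_idx j))) =
      P * conv1 (ch j) (W j X) (const_mx (k 0 (t_idx j))).
    have [h1 _ _] := qm j; have hw := h1 dl dl0 dld; have w0 := dec_ge0 hw.
    have t : dec dc (Dc * (4 * expR (dl * (kap * rt X%:~R + 1))))
        (fun q => ch j q * W j X (const_mx (k 0 (t_idx j)) - q)).
      move=> q; rewrite cmodM -mulrAC; apply: ler_pM; rewrite ?cmod_ge0 ?hc//.
      by apply: le_trans (hw _) _; rewrite ler_piMr// om_le1// ltW.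
    rewrite /conv1 -(csumZ s1 P dc0 t).
    by congr csum; apply/funext => q; ring.
  rewrite cE (_ : _ + _ = P * ((k 0 (t_idx j))%:~R%:C * 'i * W j X (const_mx (k 0 (t_idx j))) +
      X%:~R%:C * 'i * conv1 (ch j) (W j X) (const_mx (k 0 (t_idx j))))); last by ring.
  have Lb := hC _ _ (X1R X hX) (qm j) (const_mx (k 0 (t_idx j))); rewrite mxE in Lb.
  rewrite cmodM.
  have rX : 0 <= rt X%:~R := rt_ge0 _ _.
  pose A := 4 * expR dl * expR (dl * kap * rt X%:~R).
  have A1 : 1 <= A.
    have h1 : 1 <= expR dl by rewrite -[leLHS]expR0 ler_expR ltW.
    have h2 : 1 <= expR (dl * kap * rt X%:~R).
      by rewrite -[leLHS]expR0 ler_expR; apply: mulr_ge0 => //; apply: mulr_ge0 => //; exact: ltW.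
    by rewrite /A; nra.
  have pb i : cmod (W i X (const_mx (k 0 (t_idx i)))) <= A * expR (- (dl / 4) * rt (k 0 (t_idx i))%:~R).
    have [h1 _ _] := qm i; apply: le_trans (h1 dl dl0 dld _) _.
    rewrite aE -/A; apply: ler_wpM2l; first by rewrite (le_trans ler01).
    rewrite /expweight pw1E mxE ler_expR !mulNr lerN2 ler_wpM2r ?rt_ge0//; lra.
  have Pb : cmod P <= A ^+ n * \prod_(i | i != j) expR (- (dl / 4) * rt (k 0 (t_idx i))%:~R).
    rewrite /P asboolT// cmod_prod.
    apply: (@le_trans _ _ (\prod_(i | i != j) (A * expR (- (dl / 4) * rt (k 0 (t_idx i))%:~R)))).
      by apply: ler_prod => i _; rewrite cmod_ge0 pb.
    rewrite big_split/=; apply: ler_wpM2r.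
      by apply: prodr_ge0 => i _; exact: expR_ge0.
    rewrite prodr_const; apply: ler_weXn2l => //.
    by rewrite -[X in (_ <= X)%N](card_ord n) max_card.
  apply: (le_trans (ler_pM (cmod_ge0 _) (cmod_ge0 _) Pb Lb)).
  rewrite om_coords -/X {1}/expweight pw1E mxE.
  rewrite (_ : _ * _ * (_ * _ * _) = C * (A ^+ n * expR (- (eps / 4) * rt X%:~R)) *
     \prod_i expR (- (dl / 4) * rt (k 0 (t_idx i))%:~R)); last first.
    rewrite [in RHS](bigD1 j)//=.
    have key (x y z u t : R) : x * y * (z * u * t) = z * (x * u) * (t * y) by ring.
    exact: key.
  have -> : C * (4 * expR dl) ^+ n * (expR (- e * rt X%:~R) * \prod_i expR (- e * rt (k 0 (t_idx i))%:~R)) =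
    C * ((4 * expR dl) ^+ n * expR (- e * rt X%:~R)) * \prod_i expR (- e * rt (k 0 (t_idx i))%:~R) by ring.
  apply: ler_pM; rewrite ?prodr_ge0 ?mulr_ge0 ?expR_ge0 ?exprn_ge0 ?(le_trans ler01 A1)//.
  - apply: ler_wpM2l => //.
    have -> : A ^+ n = (4 * expR dl) ^+ n * expR (n%:R * (dl * kap * rt X%:~R)).
      by rewrite /A (exprMn _ (4 * expR dl)) -expRM_natl.
    rewrite -mulrA; apply: ler_wpM2l; first by rewrite exprn_ge0// mulr_ge0// expR_ge0.
    rewrite -expRD ler_expR.
    have h1 : n%:R * (dl * kap * rt X%:~R) <= eps / 8 * rt X%:~R.
      rewrite mulrA ler_wpM2r//; exact: le_trans (nk _ dl0) dlk.
    have h2 : e * rt X%:~R <= eps / 8 * rt X%:~R by rewrite ler_wpM2r// ge_min lexx.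
    by lra.
  apply: ler_prod => i _; rewrite expR_ge0/= ler_expR !mulNr lerN2 ler_wpM2r ?rt_ge0//.
  by rewrite ge_min lexx orbT.
have Dv0 := dec_ge0 hv.
have d20 : 0 < d / 2 by rewrite divr_gt0.
have [dl [dl0 dld _ dlk]] := small (d / 2) d20.
have lowj j := quasimode_low s1 (ch j) eps kap D dl0 dld.
have key j : exists c : R, 0 < c /\ forall X w, quasimode s (ch j) X eps kap d0 D w ->
    exists r, c * expR (- (dl * kap) * rt X) <= cmod (w r).
  by have [c c0 h] := lowj j; exists c.
have [c hcj] := choice key.
pose cc := \prod_j c j.
have cc0 : 0 < cc by apply: prodr_gt0 => j _; have [] := hcj j.
have bnd X : Xi X -> cc <= Dv * expR (- (d / 2) * rt X%:~R).
  move=> hX.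
  have k2 j : exists r : K1, c j * expR (- (dl * kap) * rt X%:~R) <= cmod (W j X r).
    by have [_ h] := hcj j; exact: h (hW j X hX).
  have [r hr] := choice k2.
  (* The lattice point where every factor has its large coefficient. *)
  pose k : K := \row_l (if unlift (x_idx n) l is Some j then (r j) 0 0 else X).
  have kx : k 0 (x_idx n) = X by rewrite mxE unlift_none.
  have kt j : k 0 (t_idx j) = (r j) 0 0 by rewrite mxE liftK.
  have := hv k; rewrite /v kx asboolT// cmod_prod => h.
  have rX : 0 <= rt X%:~R := rt_ge0 _ _.
  have l1 : cc * expR (- (dl * kap) * rt X%:~R) ^+ n <= Dv * expR (- d * rt X%:~R).
    apply: (@le_trans _ _ (\prod_j cmod (W j X (const_mx (k 0 (t_idx j)))))).
      rewrite -[n in _ ^+ n]card_ord -prodr_const -big_split/=; apply: ler_prod => j _.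
      have [cj0 _] := hcj j; rewrite mulr_ge0 ?expR_ge0 ?(ltW cj0)//= kt.
      by rewrite (_ : const_mx _ = r j) ?hr//; apply/rowP => i; rewrite mxE (ord1 i).
    apply: le_trans h _; rewrite ler_wpM2l// ler_expR !mulNr lerN2 ler_wpM2l ?(ltW dd0)//.
    by rewrite -{1}kx; exact: pw_ge.
  rewrite -expRM_natl in l1.
  have l2 : n%:R * (dl * kap * rt X%:~R) <= d / 2 * rt X%:~R.
    rewrite mulrA ler_wpM2r//; exact: le_trans (nk _ dl0) dlk.
  move: l1; rewrite mulNr mulrN expRN -ler_pdivlMr ?invr_gt0 ?expR_gt0// invrK -mulrA -expRD => l1.
  apply: le_trans l1 _; rewrite ler_wpM2l// ler_expR; lra.
have [X hX NX] := Xiu (Dv * (s / (d / 2)) `^ s / cc + 1).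
have := bnd X hX; have X1 := X1R X hX.
have := rt_absorb s1 (X%:~R : R) d20; rewrite ger0_norm ?(le_trans ler01 X1)// => h1 h2.
have : X%:~R * cc <= Dv * (s / (d / 2)) `^ s.
  apply: (@le_trans _ _ (Dv * (X%:~R * expR (- (d / 2) * rt X%:~R)))).
    by rewrite mulrCA ler_wpM2l// (le_trans ler01 X1).
  by rewrite ler_wpM2l.
rewrite -ler_pdivlMr//; lra.
Qed.

End Product.

(** * Normalized bumps and their primitives *)

Section BumpPrimitive.
Variables (R : realType) (s : R).
Hypothesis s1 : 1 < s.
Local Notation K1 := 'rV[int]_1.
Local Notation dec := (dec s).

Lemma fnD d D D' (c c' : K1 -> R[i]) t : 0 < d -> dec d D c -> dec d D' c' ->
  fn (fun r => c r + c' r) t = fn c t + fn c' t.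
Proof.
move=> d0 h h'; rewrite /fn /Fsum -(csumD s1 d0 (dec_ek _ h) (dec_ek _ h')).
by congr csum; apply/funext => r; rewrite mulrDl.
Qed.

Lemma fnZ d D z (c : K1 -> R[i]) t : 0 < d -> dec d D c -> fn (fun r => z * c r) t = z * fn c t.
Proof.
move=> d0 h; rewrite /fn /Fsum -(csumZ s1 z d0 (dec_ek _ h)).
by congr csum; apply/funext => r; rewrite mulrA.
Qed.

Lemma fn_shift (c : K1 -> R[i]) p t : fn (fun r => c r * ek r (const_mx (- p))) t = fn c (t - p).
Proof.
rewrite /fn /Fsum; congr csum; apply/funext => r; rewrite -mulrA; congr (_ * _).
rewrite mulrC /ek -cisD -kdotD; congr (cis (kdot _ _)).
by apply/rowP => i; rewrite !mxE.
Qed.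

Lemma periodicZ (T : Type) (f : R -> T) : (forall t, f (t + 2 * pi) = f t) ->
  forall (m : int) t, f (t + m%:~R * (2 * pi)) = f t.
Proof.
move=> h; have hn (m : nat) t : f (t + m%:R * (2 * pi)) = f t.
  elim: m t => [|m IH] t; first by rewrite mul0r addr0.
  by rewrite -natr1 mulrDl mul1r addrA h IH.
case=> m t; first by rewrite -pmulrn hn.
by rewrite NegzE mulrNz mulNr -pmulrn -[in RHS](subrK (m.+1%:R * (2 * pi)) t) hn.
Qed.

Lemma period_reduction (x0 t : R) : exists m : int, x0 <= t + m%:~R * (2 * pi) < x0 + 2 * pi.
Proof.
have p0 := pi2_gt0 R; exists (- Num.floor ((t - x0) / (2 * pi))).
have := ge_floor ((t - x0) / (2 * pi)); rewrite ler_pdivlMr// => h1.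
have := lt_succ_floor ((t - x0) / (2 * pi)); rewrite ltr_pdivrMr// intrD mulrDl mul1r => h2.
rewrite mulrNz mulNr; move: h1 h2; set z := _ * (2 * pi); lra.
Qed.

Lemma derive0_const (f : R -> R) : (forall x : R, is_derive x (1 : R) f 0) -> forall x y, f x = f y.
Proof.
move=> h; have key x y : x <= y -> f x = f y.
  move=> xy; apply/eqP; rewrite eq_sym -subr_eq0 -normr_le0 -[leRHS](mul0r (y - x)).
  by apply: (mvt_le xy (fun t _ => h t)) => t _; rewrite normr0.
by move=> x y; case/orP: (le_total x y) => [/key|/key].
Qed.

(** With mean 1, the primitive [Psi] is a smoothed staircase: constant off the bump, with total rise
    [2 * pi] over each period. The mean can be normalized because it is positive: otherwise the
    primitive of the nonnegative [psi] would be periodic, and [psi] identically 0. *)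
Lemma normalized_bump rho : 0 < rho -> rho <= pi -> exists (c : K1 -> R[i]) d D (psi Psi : R -> R),
  [/\ 0 < d, dec d D c, forall t, fn c t = (psi t)%:C &
   forall t, rho <= t <= 2 * pi - rho -> psi t = 0] /\
  [/\ c 0 = 1, forall x : R, is_derive x (1 : R) Psi (psi x), forall x y, x <= y -> Psi x <= Psi y,
   forall t, Psi (t + 2 * pi) = Psi t + 2 * pi &
   forall t, rho <= t <= 2 * pi - rho -> Psi t = Psi rho].
Proof.
move=> r0 rp; have [c [d [D [psi [d0 hc fE psi0 [supp psi00]]]]]] := gevrey_bump s1 r0 rp.
have dP (x : R) : is_derive x (1 : R) (fun t => complex.Re (prim c t)) (psi x).
  by have := (prim_cder s1 x d0 hc).1; rewrite fE.
have dQ (x : R) : is_derive x (1 : R) (fun t => complex.Im (prim c t)) 0.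
  by have := (prim_cder s1 x d0 hc).2; rewrite fE.
have c0i : complex.Im (c 0) = 0.
  have := derive0_const dQ (0 + 2 * pi) 0; rewrite prim_period cImD cImM cReR cImR mul0r addr0.
  move=> /eqP; rewrite -subr_eq0 addrAC subrr add0r mulf_eq0 gt_eqF ?pi2_gt0//= => /eqP.
  exact.
have mono x y : x <= y -> complex.Re (prim c x) <= complex.Re (prim c y).
  move=> xy; rewrite -subr_ge0 -[leLHS](mul0r (y - x)).
  by apply: (mvt_ge xy (fun t _ => dP t)) => t _; exact: psi0.
pose mu := complex.Re (c 0).
have per t : complex.Re (prim c (t + 2 * pi)) = complex.Re (prim c t) + 2 * pi * mu.
  by rewrite prim_period cReD cReM cReR cImR mul0r subr0.
have mu_ge0 : 0 <= mu.
  have p0 : 0 <= 0 + 2 * pi :> R by rewrite add0r ltW ?pi2_gt0.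
  by have := mono _ _ p0; rewrite per lerDl pmulr_rge0 ?pi2_gt0.
have mu0 : 0 < mu.
  rewrite lt0r mu_ge0 andbT; apply: contra psi00 => /eqP e.
  by apply/eqP/(periodic_monotone dP) => // t; rewrite per e mulr0 addr0.
have cE : c 0 = mu%:C by apply: complexP; rewrite !ReIm.
exists (fun r => (mu^-1)%:C * c r), d, (cmod (mu^-1)%:C * D), (fun t => mu^-1 * psi t),
  (fun t => mu^-1 * complex.Re (prim c t)); split; split.
- exact: d0.
- exact: decZ.
- by move=> t; rewrite (fnZ _ t d0 hc) fE rmorphM.
- by move=> t /supp ->; rewrite mulr0.
- by rewrite cE -rmorphM mulVf// gt_eqF.
- by move=> x; exact: is_deriveZ.
- by move=> x y xy; rewrite ler_pM2l ?invr_gt0// mono.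
- by move=> t; rewrite per mulrDr (mulrC (2 * pi)) mulKf// gt_eqF.
move=> t /andP[t1 t2]; congr (_ * _); apply/eqP; rewrite -subr_eq0 -normr_le0 -[leRHS](mul0r (t - rho)).
apply: (mvt_le t1 (fun x _ => dP x)) => x /andP[x1 x2]; rewrite supp ?normr0//.
by rewrite x1 (le_trans x2).
Qed.

(** On [[p, p + h]] the Lipschitz bound keeps the derivative above [df p / 2]. *)
Lemma increase_right (f df : R -> R) M p T : (forall x : R, is_derive x (1 : R) f (df x)) ->
  (forall x y, `|df x - df y| <= M * `|x - y|) -> 0 < df p -> p < T ->
  exists2 x, p <= x <= T & f p < f x.
Proof.
move=> hd hL dp pT; have M0 : 0 <= M.
  by have := hL 1 0; rewrite subr0 normr1 mulr1; apply: le_trans.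
pose h := Num.min (T - p) (df p / (2 * (M + 1))).
have z0 : 0 < 2 * (M + 1) by rewrite mulr_gt0// ltr_wpDl.
have h0 : 0 < h by rewrite lt_min subr_gt0 pT divr_gt0.
have h1 : h <= T - p by rewrite ge_min lexx.
have h2 : h * (2 * (M + 1)) <= df p by rewrite -ler_pdivlMr// ge_min lexx orbT.
exists (p + h); first by rewrite lerDl (ltW h0)/=; lra.
have ph : p <= p + h by rewrite lerDl ltW.
have H : df p / 2 * (p + h - p) <= f (p + h) - f p.
  apply: (mvt_ge ph (fun x _ => hd x)) => x /andP[x1 x2].
  have := hL x p; rewrite (@ger0_norm _ (x - p)) ?subr_ge0// ler_norml => /andP[a1 _].
  have : M * (x - p) <= M * h by rewrite ler_wpM2l//; lra.
  by move: h2; rewrite (_ : h * (2 * (M + 1)) = 2 * (M * h) + 2 * h); [lra|ring].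
have : 0 < df p / 2 * (p + h - p) by rewrite addrAC subrr add0r mulr_gt0// divr_gt0.
by lra.
Qed.

Lemma increase_left (f df : R -> R) M q T : (forall x : R, is_derive x (1 : R) f (df x)) ->
  (forall x y, `|df x - df y| <= M * `|x - y|) -> df q < 0 -> T < q ->
  exists2 x, T <= x <= q & f q < f x.
Proof.
move=> hd hL dq Tq.
have hd' (x : R) : is_derive x (1 : R) (fun x => f (- x)) (- df (- x)).
  have := @is_derive1_comp R f -%R x _ _ (hd (- x)) (is_deriveN (is_derive_id x 1)).
  by rewrite mulrN1.
have [|||x hx fx] := @increase_right _ _ M (- q) (- T) hd'.
- move=> x y; rewrite (_ : - df (- x) - - df (- y) = - (df (- x) - df (- y))); last by ring.
  rewrite normrN; apply: le_trans (hL _ _) _.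
  by rewrite (_ : - x - - y = - (x - y)) ?normrN//; ring.
- by rewrite opprK oppr_gt0.
- by rewrite ltrN2.
exists (- x); first by lra.
by rewrite opprK in fx.
Qed.

End BumpPrimitive.

(** * Quasimodes for a coefficient whose imaginary part changes sign *)

Section ModeExistence.
Variables (R : realType) (s : R).
Hypothesis s1 : 1 < s.
Local Notation K1 := 'rV[int]_1.
Local Notation rt := (sroot s).
Local Notation dec := (dec s).

Lemma fn_lip d D (c : K1 -> R[i]) : 0 < d -> dec d D c ->
  exists2 M, 0 <= M & forall x y, cmod (fn c x - fn c y) <= M * `|x - y|.
Proof.
move=> d0 hc; have d20 : 0 < d / 2 by rewrite divr_gt0.
have hd := dec_deriv s1 ord0 d0 hc; set B := D * _ in hd.
pose M := 2 * (2 * B * tot s 1 (d / 2)).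
have M0 : 0 <= M.
  apply: mulr_ge0 => //; apply: mulr_ge0; last exact: tot_ge0.
  by apply: mulr_ge0 => //; exact: dec_ge0 hd.
exists M => // x y; wlog yx : x y / y <= x => [H|].
  by case/orP: (le_total y x) => [/H//|/H h]; rewrite cmod_distC distrC.
rewrite ger0_norm ?subr_ge0//; apply: cder_lip yx (fun t _ => fn_cder s1 t d0 hc) _ => t _.
exact: fn_norm d20 hd.
Qed.

(** [B] increases just after [p] and decreases just before [q], so its maximum over [[p, q]] exceeds
    both end values. In the proof [e] is half of the smaller gap, and [eta] is so small that [B]
    varies by at most [e] within [eta] of [p] and of [q]. *)
Lemma interior_peak (b B : R -> R) (M LB p q : R) :
  (forall x : R, is_derive x (1 : R) B (b x)) -> (forall x y, `|b x - b y| <= M * `|x - y|) ->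
  (forall x, `|b x| <= LB) -> 0 < b p -> b q < 0 -> p < q -> q < p + 2 * pi ->
  exists t0 eta e : R, [/\ 0 < e, 0 < eta, p + eta < t0 < q - eta, q + eta <= p + 2 * pi - eta &
   [/\ forall t, p <= t <= q -> B t <= B t0, forall t, `|t - p| <= eta -> B t <= B t0 - e &
     forall t, `|t - q| <= eta -> B t <= B t0 - e]].
Proof.
move=> dB bL bLB bp bq pq qp.
have LB0 : 0 <= LB := le_trans (normr_ge0 _) (bLB 0).
have BL x y : `|B x - B y| <= LB * `|x - y|.
  wlog yx : x y / y <= x => [H|].
    by case/orP: (le_total y x) => [/H//|/H h]; rewrite distrC (distrC x).
  by rewrite (ger0_norm (_ : 0 <= x - y)) ?subr_ge0//; apply: (mvt_le yx (fun t _ => dB t)) => t _.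
have cB : continuous B by exact: lip_continuous BL.
have [t0 t0pq t0max] := EVT_max (ltW pq) (continuous_subspaceT cB).
rewrite in_itv/= in t0pq; have {}t0max t : p <= t <= q -> B t <= B t0.
  by move=> h; apply: t0max; rewrite in_itv.
have Bp : B p < B t0.
  have [x hx fx] := increase_right dB bL bp pq; exact: lt_le_trans (t0max _ hx).
have Bq : B q < B t0.
  have [x hx fx] := increase_left dB bL bq pq; exact: lt_le_trans (t0max _ hx).
have [e [e0 ep eq]] : exists e : R, [/\ 0 < e, 2 * e <= B t0 - B p & 2 * e <= B t0 - B q].
  exists (Num.min (B t0 - B p) (B t0 - B q) / 2); split.
  - by rewrite divr_gt0// lt_min !subr_gt0 Bp.
  - by rewrite mulrC divfK// ge_min lexx.
  - by rewrite mulrC divfK// ge_min lexx orbT.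
have [eta [eta0 etaL eta1 eta2]] : exists eta : R,
    [/\ 0 < eta, LB * eta <= e, 2 * eta <= q - p & 2 * eta <= p + 2 * pi - q].
  have L1 : 0 < LB + 1 by rewrite ltr_wpDl.
  exists (Num.min (e / (LB + 1)) (Num.min ((q - p) / 2) ((p + 2 * pi - q) / 2))).
  set eta := Num.min _ _.
  have h1 : eta * (LB + 1) <= e by rewrite -ler_pdivlMr// ge_min lexx.
  have h2 : eta <= (q - p) / 2 by rewrite !ge_min lexx !orbT.
  have h3 : eta <= (p + 2 * pi - q) / 2 by rewrite !ge_min lexx !orbT.
  have h4 : 0 < eta by rewrite !lt_min !divr_gt0// subr_gt0.
  move: eta h1 h2 h3 h4 => eta; rewrite mulrDr mulr1 (mulrC eta) => *; split; lra.
have low (x t : R) : 2 * e <= B t0 - B x -> `|t - x| <= eta -> B t <= B t0 - e.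
  move=> hx h; have h1 : LB * `|t - x| <= LB * eta by rewrite ler_wpM2l.
  have h2 := le_trans (ler_norm _) (BL t x).
  by clear -h1 h2 etaL hx; lra.
have /andP[t0p0 t0q0] := t0pq.
exists t0, eta, e; split => //; last by split => // t; apply: low.
  apply/andP; split; rewrite ltNge; apply/negP => h.
    have h1 : `|t0 - p| <= eta by rewrite ger0_norm; lra.
    by have := low _ _ ep h1; lra.
  have h1 : `|t0 - q| <= eta by rewrite ler0_norm; lra.
  by have := low _ _ eq h1; lra.
by lra.
Qed.

(** [g] is the variation from [t0] of the primitive [B] after bumps of mass [A1] at [p] and [- A2]
    at [q] are added to its derivative. Between the bumps [B] is maximal at [t0]; near [p] and [q]
    the bumps only lower [g], and [B] is already lower by [e]; beyond [q] the drop [2 * pi * A2]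
    outweighs the growth of [B], which is at most [2 * pi * LB]. *)
Lemma concentration (B Psi psi : R -> R) (p q t0 eta e LB A1 A2 t : R) :
  (forall x y, x <= y -> Psi x <= Psi y) ->
  (forall t, eta <= t <= 2 * pi - eta -> psi t = 0 /\ Psi t = Psi eta) ->
  (forall t, psi (t + 2 * pi) = psi t) -> (forall t, Psi (t + 2 * pi) = Psi t + 2 * pi) ->
  0 <= A1 -> 0 <= LB -> LB <= A2 -> 0 < e -> 0 < eta ->
  p + eta < t0 -> t0 < q - eta -> q + eta <= p + 2 * pi - eta ->
  (forall t, p <= t <= q -> B t <= B t0) -> (forall t, `|t - p| <= eta -> B t <= B t0 - e) ->
  (forall t, `|t - q| <= eta -> B t <= B t0 - e) -> (forall x y, `|B x - B y| <= LB * `|x - y|) ->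
  p - eta <= t <= p + 2 * pi - eta ->
  let g := (B t - B t0) + A1 * (Psi (t - p) - Psi (t0 - p)) - A2 * (Psi (t - q) - Psi (t0 - q)) in
  g <= 0 /\ (g <= - e \/ (psi (t - p) = 0 /\ psi (t - q) = 0)).
Proof.
move=> Pmono Pcst pper Pper A10 LB0 LBA e0 eta0 t0p t0q qpe t0max lowp lowq BL /andP[tp tq] g.
have A20 : 0 <= A2 := le_trans LB0 LBA; have pi0 := pi_gt0 R.
have Pcst2 x : eta - 2 * pi <= x <= - eta -> psi x = 0 /\ Psi x = Psi eta - 2 * pi.
  move=> h; have [|h1 h2] := Pcst (x + 2 * pi); first by clear -h; lra.
  by rewrite pper in h1; rewrite Pper in h2; split=> //; rewrite -h2 addrK.
have [_ P0p] : psi (t0 - p) = 0 /\ Psi (t0 - p) = Psi eta by apply: Pcst; clear -t0p t0q qpe eta0; lra.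
have [_ P0q] : psi (t0 - q) = 0 /\ Psi (t0 - q) = Psi eta - 2 * pi.
  by apply: Pcst2; clear -t0p t0q qpe eta0; lra.
have reg1 : t <= q + eta -> g <= B t - B t0.
  move=> tqe; rewrite /g; have [tt|tt] := lerP t t0.
    have [_ ->] : psi (t - q) = 0 /\ Psi (t - q) = Psi eta - 2 * pi.
      by apply: Pcst2; clear -tp tt t0q qpe; lra.
    rewrite P0q subrr mulr0 subr0 gerDl.
    by rewrite mulr_ge0_le0// subr_le0 Pmono// lerD2r.
  have [_ ->] : psi (t - p) = 0 /\ Psi (t - p) = Psi eta.
    by apply: Pcst; clear -tq tt t0p; lra.
  rewrite P0p subrr mulr0 addr0 gerBl.
  by rewrite mulr_ge0// subr_ge0 Pmono// lerD2r ltW.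
have [h1|h1] := lerP t (p + eta).
  have h : g <= - e.
    apply: le_trans (reg1 _) _; first by clear -h1 t0p t0q eta0; lra.
    have hn : `|t - p| <= eta by rewrite ler_norml; clear -h1 tp; lra.
    by have := lowp _ hn; clear; lra.
  by split; [clear -h e0; lra|left].
have [sp Pp] : psi (t - p) = 0 /\ Psi (t - p) = Psi eta by apply: Pcst; clear -h1 tq; lra.
have [h2|h2] := lerP t (q - eta).
  have [sq _] : psi (t - q) = 0 /\ Psi (t - q) = Psi eta - 2 * pi.
    by apply: Pcst2; clear -h1 h2 qpe eta0; lra.
  split; last by right.
  apply: le_trans (reg1 _) _; first by clear -h2 eta0; lra.
  by rewrite subr_le0; apply: t0max; clear -h1 h2 eta0; lra.
have [h3|h3] := lerP t (q + eta).
  have h : g <= - e.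
    apply: le_trans (reg1 h3) _.
    have hn : `|t - q| <= eta by rewrite ler_norml; clear -h2 h3; lra.
    by have := lowq _ hn; clear; lra.
  by split; [clear -h e0; lra|left].
have [sq Pq] : psi (t - q) = 0 /\ Psi (t - q) = Psi eta.
  by apply: Pcst; clear -h3 tq t0p t0q eta0; lra.
split; last by right.
rewrite /g Pp P0p Pq P0q subrr mulr0 addr0 (_ : Psi eta - (Psi eta - 2 * pi) = 2 * pi); last by ring.
have h4 : B t - B t0 <= LB * (2 * pi).
  apply: le_trans (ler_norm _) (le_trans (BL _ _) _); rewrite ler_wpM2l// ger0_norm.
    by clear -tq t0p eta0; lra.
  by clear -h3 t0q eta0; lra.
by rewrite subr_le0; apply: le_trans h4 _; rewrite ler_pM2r// pi2_gt0.
Qed.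

(* [b = Im (fn c)] is positive at [p] and negative at [q], with [p < q < p + 2 pi].
   Bumps near [p] and [q] make the mean of [c] vanish, and the exact mode of the
   perturbed coefficient concentrates at the maximum of the primitive of [b] on
   [[p, q]], away from the bumps. *)
Lemma sign_change_mode d Dc (c : K1 -> R[i]) p q :
  0 < d -> dec d Dc c -> 0 < complex.Im (fn c p) -> complex.Im (fn c q) < 0 ->
  p < q -> q < p + 2 * pi ->
  exists eps kap d0 D, [/\ 0 < eps, 0 <= kap, 0 < d0 &
    forall X, 1 <= X -> exists w, quasimode s c X eps kap d0 D w].
Proof.
move=> d0 hc bp bq pq qp.
have Dc0 := dec_ge0 hc; have pi0 := pi_gt0 R.
pose b x := complex.Im (fn c x); pose B x := complex.Im (prim c x).
have dB (x : R) : is_derive x (1 : R) B (b x) by exact: (prim_cder s1 x d0 hc).2.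
have [M M0 cL] := fn_lip d0 hc.
have bL x y : `|b x - b y| <= M * `|x - y|.
  by apply: le_trans (cL x y); rewrite /b -cImN -cImD; exact: Im_le_cmod.
pose LB := 2 * Dc * tot s 1 d.
have bLB x : `|b x| <= LB by apply: le_trans (Im_le_cmod _) _; exact: fn_norm d0 hc.
have LB0 : 0 <= LB := le_trans (normr_ge0 _) (bLB 0).
have BL x y : `|B x - B y| <= LB * `|x - y|.
  wlog yx : x y / y <= x => [H|].
    by case/orP: (le_total y x) => [/H//|/H h]; rewrite distrC (distrC x).
  by rewrite (ger0_norm (_ : 0 <= x - y)) ?subr_ge0//; apply: (mvt_le yx (fun t _ => dB t)) => t _.
have [t0 [eta [e1 [e10 eta0 /andP[t0p t0q] qpe [t0max lowp lowq]]]]] :=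
  interior_peak dB bL bLB bp bq pq qp.
have etapi : eta <= pi by clear -t0p t0q qpe pi0; lra.
have [c1 [d1 [D1 [psi [Psi [[d10 hc1 fE supp] [c10 dPsi Pmono Pper Pcst]]]]]]] :=
  normalized_bump s1 eta0 etapi.
(* [A2 >= LB] is what [concentration] requires, and [A2 >= |Im (c 0)|] makes the real part of [al1]
   nonnegative. *)
pose A2 := LB + cmod (c 0).
have A20 : 0 <= A2 by rewrite addr_ge0 ?cmod_ge0.
(* As [al1 - al2 = 'i * c 0], the perturbation satisfies [e 0 = c 0]: the perturbed coefficient has
   mean 0 and its mode is periodic for every [X]. *)
pose al2 : R[i] := A2%:C; pose al1 : R[i] := A2%:C + 'i * c 0.
have Ral1 : 0 <= complex.Re al1.
  rewrite /al1 !ReIm; have := Im_le_cmod (c 0); rewrite ler_norml /A2 => /andP[_].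
  by move: LB0; clear; lra.
pose cp (x : R) (r : K1) := c1 r * ek r (const_mx (- x)).
have hcp x : dec d1 D1 (cp x) by exact: dec_ek.
pose e (r : K1) := - 'i * (al1 * cp p r + - al2 * cp q r).
pose dd := Num.min d d1; have dd0 : 0 < dd by rewrite lt_min d0.
have ddd : dd <= d by rewrite ge_min lexx.
have ddd1 : dd <= d1 by rewrite ge_min lexx orbT.
pose De := cmod (- 'i : R[i]) * (cmod al1 * D1 + cmod (- al2) * D1).
have hs : dec d1 (cmod al1 * D1 + cmod (- al2) * D1) (fun r => al1 * cp p r + - al2 * cp q r).
  by apply: decD; exact: decZ.
have he : dec d1 De e by exact: decZ.
have fe t : fn e t = - 'i * (al1 * (psi (t - p))%:C - al2 * (psi (t - q))%:C).
  rewrite /e (fnZ s1 _ t d10 hs) (fnD s1 t d10 (decZ _ (hcp p)) (decZ _ (hcp q))).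
  by rewrite !(fnZ s1 _ t d10 (hcp _)) !fn_shift !fE (mulNr al2).
pose c' (r : K1) := c r - e r.
have hNe : dec d1 De (fun r => - e r) by move=> r; rewrite cmodN.
have hc' : dec dd (Dc + De) c' by apply: decD; [exact: dec_weaken hc|exact: dec_weaken hNe].
have fc' t : fn c' t = fn c t - fn e t.
  have hN1 : dec dd De (fun r => -1 * e r) by move=> r; rewrite mulN1r; exact: dec_weaken hNe r.
  have -> : c' = fun r => c r + -1 * e r by apply/funext => r; rewrite mulN1r.
  rewrite (fnD s1 t dd0 (dec_weaken ddd hc) hN1).
  by rewrite (fnZ s1 _ t dd0 (dec_weaken ddd1 he)) mulN1r.
have c'0 : c' 0 = 0.
  have ii : - 'i * 'i = 1 :> R[i] by rewrite mulNr -expr2 sqr_i opprK.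
  have e0 : e 0 = c 0.
    by rewrite /e /cp !ek0 c10 /al1 /al2 !mulr1 addrAC subrr add0r mulrA ii mul1r.
  by rewrite /c' e0 subrr.
pose G x := complex.Im (prim c' x).
have dG (x : R) : is_derive x (1 : R) G (b x + complex.Re al1 * psi (x - p) - A2 * psi (x - q)).
  have := (prim_cder s1 x dd0 hc').2; rewrite fc' fe.
  have -> // : complex.Im (fn c x - - 'i * (al1 * (psi (x - p))%:C - al2 * (psi (x - q))%:C)) =
     b x + complex.Re al1 * psi (x - p) - A2 * psi (x - q).
  by rewrite /b /al2; move: (fn c x) (al1) => z1 z2; rewrite !ReIm; ring.
have Gper t : G (t + 2 * pi) = G t by rewrite /G prim_period c'0 mulr0 addr0.
have dsh (y x : R) : is_derive x (1 : R) (fun x => Psi (x - y)) (psi (x - y)).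
  have h0 : is_derive x (1 : R) (fun x : R => x - y) 1.
    by have := is_deriveB (is_derive_id x (1 : R)) (is_derive_cst y x (1 : R)); rewrite subr0.
  by have := @is_derive1_comp R Psi (fun x => x - y) x _ _ (dPsi (x - y)) h0; rewrite mulr1.
have GE t : G t - G t0 = (B t - B t0) + complex.Re al1 * (Psi (t - p) - Psi (t0 - p))
    - A2 * (Psi (t - q) - Psi (t0 - q)).
  pose Q x := G x - (B x + complex.Re al1 * Psi (x - p) - A2 * Psi (x - q)).
  have dQ (x : R) : is_derive x (1 : R) Q 0.
    have h1 := is_deriveB (is_deriveD (dB x) (is_deriveZ (complex.Re al1) (dsh p x)))
       (is_deriveZ A2 (dsh q x)).
    by have := is_deriveB (dG x) h1; rewrite subrr.
  have := derive0_const dQ t t0; rewrite /Q; clear; lra.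
have LBA : LB <= A2 by rewrite lerDl cmod_ge0.
have pper t : psi (t + 2 * pi) = psi t.
  by have := fn_periodic c1 t; rewrite !fE => /(congr1 (@complex.Re R)).
have win (t : R) : p - eta <= t <= p + 2 * pi - eta -> G t - G t0 <= 0 /\
    (G t - G t0 <= - e1 \/ (psi (t - p) = 0 /\ psi (t - q) = 0)).
  rewrite GE; apply: concentration Pmono _ pper Pper Ral1 LB0 LBA e10 eta0 t0p t0q qpe t0max lowp lowq BL.
  by move=> x hx; rewrite supp// Pcst.
have eper t : fn e (t + 2 * pi) = fn e t by exact: fn_periodic.
pose Be := 2 * De * tot s 1 d1.
have Be0 t : cmod (fn e t) <= Be by exact: fn_norm d10 he.
have Be00 : 0 <= Be := le_trans (cmod_ge0 _) (Be0 0).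
have all t : G t - G t0 <= 0 /\ (G t - G t0 <= - e1 \/ fn e t = 0).
  have [k hk] := period_reduction (p - eta) t.
  rewrite -(periodicZ Gper k t) -(periodicZ eper k t).
  have [|w1 [w2|[w2 w3]]] := win (t + k%:~R * (2 * pi)); first by move: hk; clear; lra.
    by split=> //; left.
  by split=> //; right; rewrite fe w2 w3 !mulr0 subrr mulr0.
(* On the mode, the perturbation is at most a multiple of [exp (- e1 * X)], and [X >= X^(1/s)]; half
   of [e1] is spent on the factor [X]. *)
have e20 : 0 < e1 / 2 by rewrite divr_gt0.
exists (e1 / 2), (rt (2 * (2 * (Dc + De) * tot s 1 (dd / 2)))), (dd / 2), (2 * Be * (s / (e1 / 2)) `^ s).
split; [exact: e20|exact: rt_ge0|by rewrite divr_gt0|].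
move=> X X1; have X0 : 0 <= X := le_trans ler01 X1.
apply: (@perturbed_mode R s s1 c e dd Dc De X t0 (Be * expR (- e1 * X))) => //.
- exact: dec_weaken hc.
- exact: dec_weaken he.
- by rewrite -/(c' 0) c'0 mulr0 oppr0 cexp0.
- by move=> t; rewrite ler_wpM2l// -subr_le0; have [] := all t.
- move=> t; have [g0 [g1|->]] := all t; last by rewrite cmod0 mul0r mulr_ge0 ?expR_ge0.
  apply: ler_pM; rewrite ?cmod_ge0 ?expR_ge0// ler_expR -mulrBr mulrC.
  by rewrite ler_wpM2r.
rewrite ger0_norm//.
have rX1 : 1 <= rt X by apply: rt_ge1 => //; rewrite ger0_norm.
have rXX : rt X <= X.
  have := rtK s1 X; rewrite ger0_norm// => {2}<-.
  by rewrite -[leLHS]powRr1 ?(le_trans ler01)//; apply: ler_powR => //; exact: ltW.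
have ee : expR (- e1 * X) <= expR (- (e1 / 2) * rt X) * expR (- (e1 / 2) * rt X).
  rewrite -expRD ler_expR; have : e1 * rt X <= e1 * X by rewrite ler_pM2l.
  by clear; lra.
have ab := rt_absorb s1 X e20; rewrite ger0_norm// in ab.
rewrite (_ : X * (2 * (Be * _)) = 2 * Be * (X * expR (- e1 * X))); last by ring.
rewrite -(mulrA (2 * Be) (_ `^ _)); apply: ler_wpM2l; first exact: mulr_ge0.
apply: (@le_trans _ _ (X * (expR (- (e1 / 2) * rt X) * expR (- (e1 / 2) * rt X)))).
  by rewrite ler_wpM2l.
by rewrite mulrA ler_wpM2r ?expR_ge0.
Qed.

End ModeExistence.

(** * Necessity *)

Section Resonance.
Variables (R : realType) (s : R).
Hypothesis s1 : 1 < s.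
Local Notation rt := (sroot s).

Lemma finite_bounded_lattice m (B : nat) (A : set ('rV[int]_m * int)) :
  (forall p q, A (p, q) -> (absz q <= B)%N /\ forall i, (absz (p ord0 i) <= B)%N) -> finite_set A.
Proof.
move=> H.
pose F (x : 'rV['I_(B + B).+1]_m * 'I_(B + B).+1) : 'rV[int]_m * int :=
  (map_mx (fun i : 'I_(B + B).+1 => (i : nat)%:Z - B%:Z) x.1, (x.2 : nat)%:Z - B%:Z).
have inK (z : int) : (absz z <= B)%N ->
    ((inord (absz (z + B%:Z)) : 'I_(B + B).+1) : nat)%:Z - B%:Z = z.
  move=> zB; rewrite inordK; last by lia.
  by lia.
apply: (@sub_finite_set _ _ (F @` setT)); last by apply: finite_image; exact: finite_finset.
move=> [p q] /H[qB pB].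
exists (map_mx (fun z : int => inord (absz (z + B%:Z))) p, inord (absz (q + B%:Z))) => //.
rewrite /F /=; congr (_, _); last exact: inK.
by apply/rowP => i; rewrite !mxE inK.
Qed.

(** Common consequence of the rational and of the Liouville case, from which the modes for the
    indices in [J] are built. *)
Definition resonant m (v : 'rV[R]_m) := exists2 eps : R, 0 < eps &
  forall N : R, exists X : int, [/\ 1 <= X, N <= X%:~R &
    forall i, exists p : int, `|X%:~R * v 0 i - p%:~R| <= expR (- eps * rt X%:~R)].

(** Multiples of a common denominator give exact integers. *)
Lemma resonant_rational m (v : 'rV[R]_m) : rational_vector v -> resonant v.
Proof.
move=> [r ->]; exists 1 => // N; pose P := \prod_i denq (r 0 i).
have P1 : 1 <= P.
  by rewrite -gtz0_ge1; apply: prodr_gt0 => i _; exact: denq_gt0.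
pose t := (Num.truncn `|N|).+1; exists (t%:Z * P); split.
- by rewrite -gtz0_ge1 mulr_gt0// (lt_le_trans ltr01).
- rewrite intrM; apply: (@le_trans _ _ t%:R).
    apply: le_trans (ler_norm _) _; have /andP[_ h] := truncn_itv (normr_ge0 N); exact: ltW.
  by rewrite -pmulrn ler_peMr// ler1z.
move=> i; exists (t%:Z * (numq (r 0 i) * \prod_(j | j != i) denq (r 0 j))).
rewrite mxE /ratr /P (bigD1 i)//= !intrM.
rewrite (_ : _ - _ = 0) ?normr0 ?expR_ge0//.
by field; rewrite intr_eq0 denq_neq0.
Qed.

(** For bounded [q] the inequality bounds [p] as well, so infinitely many solutions force [|q|] to
    be unbounded. A pair with negative [q] is replaced by its opposite. *)
Lemma resonant_liouville m (v : 'rV[R]_m) : exp_liouville s v -> resonant v.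
Proof.
move=> [_ [eps eps0 inf]]; exists eps => // N.
set A := [set pq | _] in inf.
pose M := (Num.truncn `|N|).+1.
have [[p q] [/= Apq Mq]] : exists pq, A pq /\ (M <= absz pq.2)%N.
  apply: contrapT => hn; apply: inf.
  pose B := (M + (Num.truncn (M%:R * `|v| + 1)).+1)%N.
  apply: (@finite_bounded_lattice m B) => p q Apq.
  have qM : (absz q < M)%N by rewrite ltnNge; apply/negP => h; apply: hn; exists (p, q).
  have qM' : `|q%:~R : R| <= M%:R.
    by rewrite -intr_norm -abszE -pmulrn ler_nat ltnW.
  split; first by rewrite /B; lia.
  move=> i; suff : (absz (p ord0 i) <= (Num.truncn (M%:R * `|v| + 1)).+1)%N by rewrite /B; lia.
  have := le_norm_rV (q%:~R *: v - map_mx intr p) i; rewrite !mxE => h1.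
  have h2 : `|q%:~R *: v - map_mx intr p| < 1.
    apply: lt_le_trans Apq _; rewrite -[leRHS]expR0 ler_expR mulNr oppr_le0.
    by apply: mulr_ge0; [exact: ltW|exact: powR_ge0].
  have h3 : `|q%:~R * v 0 i| <= M%:R * `|v|.
    by rewrite normrM; apply: ler_pM => //; exact: le_norm_rV.
  have h4 : `|(p 0 i)%:~R : R| <= M%:R * `|v| + 1.
    rewrite (_ : (p 0 i)%:~R = q%:~R * v 0 i - (q%:~R * v 0 i - (p 0 i)%:~R)); last by ring.
    by apply: le_trans (ler_normB _ _) _; apply: lerD => //; apply: le_trans h1 (ltW h2).
  rewrite -(ler_nat R) pmulrn abszE intr_norm; apply: (le_trans h4).
  have /andP[_ h] := truncn_itv (le_trans (normr_ge0 _) h4); exact: ltW.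
have qX : `|(q%:~R : R)| = (absz q)%:Z%:~R by rewrite abszE intr_norm.
exists (absz q)%:Z; split.
- by rewrite lez_nat (leq_trans _ Mq).
- apply: le_trans (ler_norm _) _; have /andP[_ h] := truncn_itv (normr_ge0 N).
  by apply: le_trans (ltW h) _; rewrite -pmulrn ler_nat.
move=> i.
have b1 : `|q%:~R * v 0 i - (p 0 i)%:~R| <= expR (- eps * rt (absz q)%:Z%:~R).
  have := le_norm_rV (q%:~R *: v - map_mx intr p) i; rewrite !mxE => h1.
  by apply: le_trans h1 _; rewrite -qX rt_norm; apply: ltW; exact: Apq.
have [q0|q0] := lerP 0 q.
  have qa : ((absz q)%:Z%:~R : R) = q%:~R by rewrite -qX ger0_norm// ler0z.
  by exists (p 0 i); apply: le_trans b1; rewrite qa.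
have qa : ((absz q)%:Z%:~R : R) = - q%:~R by rewrite -qX ltr0_norm// ltrz0.
exists (- p 0 i); apply: le_trans b1; rewrite qa mulrNz mulNr.
by rewrite (_ : - _ - - _ = - (q%:~R * v 0 i - (p 0 i)%:~R)) ?normrN//; ring.
Qed.

End Resonance.

Section Necessity.
Variables (R : realType) (s : R) (n : nat) (a b : 'I_n -> R -> R).
Hypothesis s1 : 1 < s.
Hypothesis ha : forall j : 'I_n, gevrey_circle s (a j).
Hypothesis hb : forall j : 'I_n, gevrey_circle s (b j).
Local Notation K1 := 'rV[int]_1.
Local Notation rt := (sroot s).
Local Notation dec := (dec s).
Local Notation ch := (ch a b).

(** The constant perturbation [kap = a_j0 - p / X] turns [X] times the mean into the integer [p],
    which makes the mode periodic. The mode has modulus 1 since [b_j = 0], and [X kap] is as small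
    as the error has to be. *)
Lemma real_modes (Xi : int -> Prop) (eps : R) j : 0 < eps -> (forall X, Xi X -> 1 <= X) ->
  (forall t, b j t = 0) ->
  (forall X, Xi X -> exists p : int, `|X%:~R * mean (a j) - p%:~R| <= expR (- eps * rt X%:~R)) ->
  has_quasimodes s a b Xi j.
Proof.
move=> eps0 Xi1 bj0 hX.
have [dc [Dc [dc0 Dc0 hc]]] := dec_ch s1 ha hb.
exists eps, (rt (2 * (2 * (Dc + 1) * tot s 1 (dc / 2)))), (dc / 2), 2.
split; [exact: eps0|exact: rt_ge0|by rewrite divr_gt0|].
move=> X XiX; have X1 : 1 <= (X%:~R : R) by rewrite ler1z Xi1.
have X0 : 0 < (X%:~R : R) := lt_le_trans ltr01 X1.
have [p hp] := hX X XiX.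
pose kap : R := mean (a j) - p%:~R / X%:~R.
have Xk : X%:~R * kap = X%:~R * mean (a j) - p%:~R by rewrite /kap; field; rewrite gt_eqF.
have k1 : `|kap| <= 1.
  have h : `|X%:~R * kap| <= 1.
    rewrite Xk; apply: le_trans hp _; rewrite -[leRHS]expR0 ler_expR mulNr oppr_le0.
    by apply: mulr_ge0; [exact: ltW|exact: rt_ge0].
  by apply: le_trans h; rewrite normrM gtr0_norm// ler_peMl.
pose e (r : K1) : R[i] := if r == 0 then kap%:C else 0.
have he : dec dc 1 e.
  move=> r; rewrite /e mul1r; case: eqP => [->|_]; last by rewrite cmod0 om_ge0.
  by rewrite cmodR /expweight pw1E mxE rt0// mulr0 expR0.
have fe t : fn e t = kap%:C by exact: (fn_const s1).
pose c' (r : K1) := ch j r - e r.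
have hN1 : dec dc 1 (fun r => -1 * e r) by move=> r; rewrite mulN1r cmodN.
have hc' : dec dc (Dc + 1) c' by apply: decD => // r; rewrite cmodN.
have fc' t : complex.Im (fn c' t) = 0.
  have -> : c' = fun r => ch j r + -1 * e r by apply/funext => r; rewrite mulN1r.
  rewrite (fnD s1 t dc0 (hc j) hN1) (fnZ s1 _ t dc0 he) fe mulN1r (fn_ch s1 ha hb).
  by rewrite cImD cImN cImR /= bj0 oppr0 addr0.
have dG (x : R) : is_derive x (1 : R) (fun t => complex.Im (prim c' t)) 0.
  by have := (prim_cder s1 x dc0 hc').2; rewrite fc'.
have mb : mean (b j) = 0 by rewrite /mean -/(RI (b j)) (eq_RI (g := fun=> 0) bj0) RI_cst !mulr0.
have c'0 : c' 0 = (p%:~R / X%:~R)%:C.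
  rewrite /c' /e eqxx (ch0E ha hb) mb /kap.
  by apply: complexP; rewrite !ReIm /=; ring.
apply: (@perturbed_mode R s s1 (ch j) e dc Dc 1 X%:~R 0 `|kap|) => //.
- rewrite -/(c' 0) c'0.
  have -> : - ((2 * pi * X%:~R)%:C * 'i * (p%:~R / X%:~R)%:C) = ((- p)%:~R * (2 * pi))%:C * 'i :> R[i].
    rewrite mulrAC -rmorphM -mulNr -rmorphN; congr (_%:C * _); rewrite mulrNz; field.
    by rewrite gt_eqF.
  have ci (x : R) : cexp (x%:C * 'i) = cis x.
    have e1 : complex.Re (x%:C * 'i) = 0 by rewrite !ReIm; ring.
    have e2 : complex.Im (x%:C * 'i) = x by rewrite !ReIm; ring.
    by rewrite /cexp e1 e2 expR0 mul1r.
  by rewrite ci cis2piz.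
- by move=> t; rewrite (derive0_const dG t 0).
- by move=> t; rewrite (derive0_const dG t 0) subrr expR0 mulr1 fe cmodR.
rewrite gtr0_norm// mulrCA ler_pM2l//; apply: le_trans hp.
by rewrite -Xk normrM gtr0_norm.
Qed.

Lemma sign_change_modes (Xi : int -> Prop) j : (forall X, Xi X -> 1 <= X) ->
  ~ keeps_sign (b j) -> has_quasimodes s a b Xi j.
Proof.
move=> Xi1 nk.
have [dc [Dc [dc0 Dc0 hc]]] := dec_ch s1 ha hb.
have fb t : complex.Im (fn (ch j) t) = b j t by rewrite (fn_ch s1 ha hb).
have [p bp] : exists p, 0 < b j p.
  apply: contrapT => h; apply: nk; right=> x; rewrite leNgt; apply/negP => hx.
  by apply: h; exists x.
have [q0 bq0] : exists q, b j q < 0.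
  apply: contrapT => h; apply: nk; left=> x; rewrite leNgt; apply/negP => hx.
  by apply: h; exists x.
(* A point where [b_j] is negative is moved by periods into [[p, p + 2 * pi)]; it differs from [p]
   because the signs differ. *)
have [m] := period_reduction p q0; set q := _ + _ => /andP[pq qp].
have bq : b j q < 0.
  by rewrite -fb /q (periodicZ (fn_periodic (ch j))) fb.
have {}pq : p < q.
  by rewrite lt_neqAle pq andbT; apply: contraTneq bp => ->; rewrite -leNgt ltW.
rewrite -fb in bp; rewrite -fb in bq.
have [eps [kap [d0 [D [e0 k0 d00 H]]]]] := sign_change_mode s1 dc0 (hc j) bp bq pq qp.
exists eps, kap, d0, D; split => // X XiX; apply: H.
by rewrite ler1z Xi1.
Qed.

(** Either [j] belongs to [J], and resonance provides the modes, or [b_j] changes sign, and every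
    [X >= 1] has a mode; so the frequencies given by resonance serve all the indices. *)
Theorem resonant_obstruction : resonant s (mean_vector a (real_indices b)) ->
  (forall j, keeps_sign (b j) -> forall x, b j x = 0) -> ~ globally_hypoelliptic s (vfield a b).
Proof.
move=> [eps eps0 res] ks.
pose v := mean_vector a (real_indices b).
pose Xi (X : int) := 1 <= X /\
  forall i, exists p : int, `|X%:~R * v 0 i - p%:~R| <= expR (- eps * rt X%:~R).
have Xi1 X : Xi X -> 1 <= X by case.
apply: (quasimode_obstruction s1 ha hb (Xi := Xi)) => // [N|j].
  by have [X [X1 NX h]] := res N; exists X.
have [z|nz] := pselect (forall x, b j x = 0); last first.
  by apply: sign_change_modes => // /ks.
apply: (real_modes eps0 Xi1 z) => X [_ h].
have jJ : j \in real_indices b by rewrite inE; apply/asboolP.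
by have := h (enum_rank_in jJ j); rewrite mxE enum_rankK_in.
Qed.

End Necessity.

Theorem theorem2p2 (R : realType) (s : R) (n : nat) (a b : 'I_n -> R -> R)
    (hs : 1 < s) (hn : (0 < n)%N)
    (ha : forall j : 'I_n, gevrey_circle s (a j))
    (hb : forall j : 'I_n, gevrey_circle s (b j)) :
  globally_hypoelliptic s (vfield a b) <->
  ((exists j : 'I_n, keeps_sign (b j) /\ ~ (forall x : R, b j x = 0)) \/
   [/\ real_indices b != finset.set0,
       ~ rational_vector (mean_vector a (real_indices b)) &
       ~ exp_liouville s (mean_vector a (real_indices b))]).
Proof.
split=> [H|cond].
  apply: contrapT => hc.
  have ks j : keeps_sign (b j) -> forall x, b j x = 0.
    by move=> kj; apply: contrapT => nz; apply: hc; left; exists j.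
  apply: (resonant_obstruction hs ha hb _ ks H).
  have [r|nr] := pselect (rational_vector (mean_vector a (real_indices b))).
    exact: resonant_rational.
  apply: resonant_liouville; apply: contrapT => nl; apply: hc; right; split => //.
  (* For empty [J] the vector has no entries and is trivially rational. *)
  apply/eqP => J0; apply: nr; exists 0; apply/rowP => -[i hi].
  by exfalso; move: hi; rewrite J0 cards0.
apply/(hypo_seq hs ha hb) => v hv hL; apply: (nonresonant_decay hs ha hb hv hL).
case: cond => [[j [ks nz]]|[_ nr nl]]; first exact: nonresonant_sign ks nz.
exact: nonresonant_diophantine.
Qed.
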